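(* Let $L$ be a Nijenhuis operator with a unity $e$ in the analytic category in dimension two. Then in a neighbourhood of a point $\mathsf p$ the pair $(L,e)$ can be brought to one of the following forms: 1. $$e=\partial_x,\quad L=\begin{pmatrix} \lambda_0+x&0 \\ 0&\lambda_0+x \end{pmatrix},\quad \lambda_0\in\mathbb R.$$ 2. $$e=\partial_x,\quad L=\begin{pmatrix} \lambda_0&0 \\ 0&\lambda_0 \end{pmatrix}+\begin{pmatrix} x&-\frac12 \\ 2(y+d)&x \end{pmatrix},\quad d,\lambda_0\in\mathbb R.$$ 3. $$e=\partial_x,\quad L=\begin{pmatrix} \lambda_0&0 \\ 0&\lambda_0 \end{pmatrix}+\begin{pmatrix} x&\mp\frac k2y^{k-1} \\ \frac2ky&x \end{pmatrix},\quad k\in\mathbb N,\ \lambda_0\in\mathbb R.$$ 4. $$e=\partial_x,\quad L=\begin{pmatrix} \lambda_0&0 \\ 0&\lambda_0 \end{pmatrix}+\begin{pmatrix} x&0 \\ f(x,y)&x \end{pmatrix},\quad \lambda_0\in\mathbb R.$$ Here $f(x,y)$ is an arbitrary function. Two semi-normal forms (of type 4) with functional parameters $f$ and $\bar f$ respectively are equivalent if and only if there exists a function $h(x,y)$ such that $\bar f(x,h(x,y))=\frac{\partial h}{\partial y}(x,y)\,f(x,y)$ and $\frac{\partial h}{\partial y}(0,0)\neq0$.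
   Context: For an operator field (field of endomorphisms of the tangent bundle) $L$, the Nijenhuis torsion is $\mathcal N_L(\xi,\eta)=[L\xi,L\eta]+L^2[\xi,\eta]-L[L\xi,\eta]-L[\xi,L\eta]$ for vector fields $\xi,\eta$; $L$ is a Nijenhuis operator if $\mathcal N_L=0$. A pair $(L,e)$ is a Nijenhuis operator with a unity if $L$ is Nijenhuis and the vector field $e$ satisfies $\mathcal L_eL=\mathrm{Id}$, where $\mathcal L_e$ is the Lie derivative along $e$. Here $(x,y)$ are local coordinates and the columns of the matrix of $L$ are the components of $L\partial_x$ and $L\partial_y$. An operator is said to be brought to a semi-normal form if the functional parameters of the corresponding form are defined up to equivalence, where the equivalence relation on functional parameters is defined by a coordinate change of the operator. *)

(* Defs.v *)
From Stdlib Require Import Reals.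
From Coquelicot Require Import Coquelicot.
Open Scope R_scope.

(** Real analyticity in two variables: near [p], [f] is the sum of an absolutely
    convergent double power series, summed by homogeneous degree. *)
Definition analytic_at (f : R * R -> R) (p : R * R) : Prop :=
  exists (a : nat -> nat -> R) (r : R), 0 < r /\
    forall s t : R, Rabs s < r -> Rabs t < r ->
      ex_series (fun n => sum_n (fun i => Rabs (a i (n - i)%nat * s ^ i * t ^ (n - i))) n) /\
      is_series (fun n => sum_n (fun i => a i (n - i)%nat * s ^ i * t ^ (n - i)) n)
                (f (fst p + s, snd p + t)).

(** Used both for vector fields and for maps between open sets of the plane. *)
Definition vanalytic_at (X : R * R -> R * R) (p : R * R) : Prop :=
  analytic_at (fun z => fst (X z)) p /\ analytic_at (fun z => snd (X z)) p.

(** [Mat2 a b c d] has rows [(a, b)] and [(c, d)]. *)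
Record mat2 : Type := Mat2 { m11 : R; m12 : R; m21 : R; m22 : R }.

Definition mapp (A : mat2) (v : R * R) : R * R :=
  (m11 A * fst v + m12 A * snd v, m21 A * fst v + m22 A * snd v).

Definition madd (A B : mat2) : mat2 :=
  Mat2 (m11 A + m11 B) (m12 A + m12 B) (m21 A + m21 B) (m22 A + m22 B).

Definition mmul (A B : mat2) : mat2 :=
  Mat2 (m11 A * m11 B + m12 A * m21 B) (m11 A * m12 B + m12 A * m22 B)
       (m21 A * m11 B + m22 A * m21 B) (m21 A * m12 B + m22 A * m22 B).

Definition manalytic_at (L : R * R -> mat2) (p : R * R) : Prop :=
  analytic_at (fun z => m11 (L z)) p /\ analytic_at (fun z => m12 (L z)) p /\
  analytic_at (fun z => m21 (L z)) p /\ analytic_at (fun z => m22 (L z)) p.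

Definition partial_x (f : R * R -> R) (z : R * R) : R :=
  Derive (fun t => f (t, snd z)) (fst z).

Definition partial_y (f : R * R -> R) (z : R * R) : R :=
  Derive (fun t => f (fst z, t)) (snd z).

Definition vderiv (X : R * R -> R * R) (f : R * R -> R) (z : R * R) : R :=
  fst (X z) * partial_x f z + snd (X z) * partial_y f z.

Definition lie_bracket (X Y : R * R -> R * R) (z : R * R) : R * R :=
  (vderiv X (fun w => fst (Y w)) z - vderiv Y (fun w => fst (X w)) z,
   vderiv X (fun w => snd (Y w)) z - vderiv Y (fun w => snd (X w)) z).

Definition oapp (L : R * R -> mat2) (X : R * R -> R * R) (z : R * R) : R * R :=
  mapp (L z) (X z).

Definition nijenhuis_torsion (L : R * R -> mat2) (X Y : R * R -> R * R)
    (z : R * R) : R * R :=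
  minus
    (minus
       (plus (lie_bracket (oapp L X) (oapp L Y) z)
             (oapp L (oapp L (lie_bracket X Y)) z))
       (oapp L (lie_bracket (oapp L X) Y) z))
    (oapp L (lie_bracket X (oapp L Y)) z).

Definition nijenhuis_on (U : R * R -> Prop) (L : R * R -> mat2) : Prop :=
  forall X Y : R * R -> R * R,
    (forall z, U z -> vanalytic_at X z) -> (forall z, U z -> vanalytic_at Y z) ->
    forall z, U z -> nijenhuis_torsion L X Y z = (0, 0).

(** [(Lie_e L) X = [e, L X] - L [e, X]]. *)
Definition lie_derivative_op (e : R * R -> R * R) (L : R * R -> mat2)
    (X : R * R -> R * R) (z : R * R) : R * R :=
  minus (lie_bracket e (oapp L X) z) (oapp L (lie_bracket e X) z).

Definition unity_on (U : R * R -> Prop) (L : R * R -> mat2)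
    (e : R * R -> R * R) : Prop :=
  forall X : R * R -> R * R,
    (forall z, U z -> vanalytic_at X z) ->
    forall z, U z -> lie_derivative_op e L X z = X z.

Definition nijenhuis_with_unity (U : R * R -> Prop) (L : R * R -> mat2)
    (e : R * R -> R * R) : Prop :=
  (forall z, U z -> manalytic_at L z) /\ (forall z, U z -> vanalytic_at e z) /\
  nijenhuis_on U L /\ unity_on U L e.

Definition local_diffeo (phi : R * R -> R * R) (p q : R * R) : Prop :=
  phi p = q /\ vanalytic_at phi p /\
  exists psi : R * R -> R * R,
    psi q = p /\ vanalytic_at psi q /\
    locally p (fun z => psi (phi z) = z) /\ locally q (fun w => phi (psi w) = w).

Definition jacobian (phi : R * R -> R * R) (z : R * R) : mat2 :=
  Mat2 (partial_x (fun w => fst (phi w)) z) (partial_y (fun w => fst (phi w)) z)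
       (partial_x (fun w => snd (phi w)) z) (partial_y (fun w => snd (phi w)) z).

(** The pushforward conditions [phi_* L = L'] and [phi_* e = e'] near [p]; the
    first is the conjugation [d phi o L = (L' o phi) o d phi]. *)
Definition op_pushed (phi : R * R -> R * R) (p : R * R) (L L' : R * R -> mat2) : Prop :=
  locally p (fun z => mmul (jacobian phi z) (L z) = mmul (L' (phi z)) (jacobian phi z)).

Definition vf_pushed (phi : R * R -> R * R) (p : R * R) (e e' : R * R -> R * R) : Prop :=
  locally p (fun z => mapp (jacobian phi z) (e z) = e' (phi z)).

(** New coordinates are always centred: the base point becomes [(0, 0)]. *)
Definition op_brought_to (p : R * R) (L L' : R * R -> mat2) : Prop :=
  exists phi, local_diffeo phi p (0, 0) /\ op_pushed phi p L L'.

Definition pair_brought_to (p : R * R) (L : R * R -> mat2) (e : R * R -> R * R)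
    (L' : R * R -> mat2) (e' : R * R -> R * R) : Prop :=
  exists phi, local_diffeo phi p (0, 0) /\ op_pushed phi p L L' /\ vf_pushed phi p e e'.

Definition d_x : R * R -> R * R := fun _ => (1, 0).

Definition normal_form1 (l0 : R) (z : R * R) : mat2 :=
  let (x, y) := z in Mat2 (l0 + x) 0 0 (l0 + x).

Definition normal_form2 (l0 d : R) (z : R * R) : mat2 :=
  let (x, y) := z in
  madd (Mat2 l0 0 0 l0) (Mat2 x (- (1 / 2)) (2 * (y + d)) x).

(** Upper sign for [sg = 1], lower sign for [sg = -1]; meant for [1 <= k]. *)
Definition normal_form3 (l0 sg : R) (k : nat) (z : R * R) : mat2 :=
  let (x, y) := z in
  madd (Mat2 l0 0 0 l0)
       (Mat2 x (- sg * (INR k / 2) * y ^ (k - 1)) (2 / INR k * y) x).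

Definition normal_form4 (l0 : R) (f : R * R -> R) (z : R * R) : mat2 :=
  let (x, y) := z in
  madd (Mat2 l0 0 0 l0) (Mat2 x 0 (f (x, y)) x).

(** [h (0, 0) = 0] is what makes the composite [fb (x, h (x, y))] meaningful for
    a germ [fb] at the origin. *)
Definition param_related (f fb : R * R -> R) : Prop :=
  exists h : R * R -> R,
    analytic_at h (0, 0) /\ h (0, 0) = 0 /\
    locally (0, 0) (fun z => fb (fst z, h z) = partial_y h z * f z) /\
    partial_y h (0, 0) <> 0.

Definition nijenhuis_with_unity_at (p : R * R) (L : R * R -> mat2)
    (e : R * R -> R * R) : Prop :=
  exists U : R * R -> Prop, open U /\ U p /\ nijenhuis_with_unity U L e.

(* Main.v *)
(** In dimension two, write [lam] for half the trace of [L], [N = L - lam] and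
    [delta = - det N], so that [N ^ 2 = delta]. The torsion of [L] vanishes iff
    [N^T (d lam) = (1/2) d delta], hence also [N^T (d delta) = 2 delta d lam], and
    [Lie_e L = Id] gives [e lam = 1] and [e delta = 0]. Rectifying [e] therefore yields
    coordinates [(lam, u)] with [e = d/d lam] and [delta = D (u)], where [L] is determined by [D]
    as soon as [D' <> 0]. If [D] is constant one gets form 4 (form 1 being [f = 0]); if [D' (0) <> 0] then [- D] is
    taken as second coordinate (form 2); otherwise [delta] vanishes at the base point, and a
    [k]-th root of [+- D] is taken as second coordinate (form 3). An equivalence between two
    operators of form 4 preserves the trace, hence has the shape [(x, h (x, y))].

    Analytic germs are handled through the Banach algebras of double power series with finite
    weighted l1 norm: composition is a convergent series in such an algebra, and both the
    implicit function theorem and the analytic dependence of solutions of an ODE are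
    contraction arguments there. *)
Require Import Defs.
From Stdlib Require Import Reals Lra Lia Classical Wf_nat IndefiniteDescription FunctionalExtensionality.
From Coquelicot Require Import Coquelicot.
Open Scope R_scope.

(** * Absolutely summable double sequences *)

(** Only series in two variables ever occur: the implicit equation has one unknown and one
    parameter, the flow is that of a scalar equation whose initial value is the second variable, and
    planar maps are inverted by solving one scalar equation at a time.

    The conjugation [d phi o L = L' o d phi] prescribes [N^T] on the coframe [d lam], [d v]. Its
    first row is [N^T (d lam) = (1/2) d delta]. Its second row is extracted from
    [N^T (d delta) = 2 delta d lam], where for [delta = - sg v^k] a factor [v^(k-1)] has to be
    divided out; the zero set of [v] is the delicate place.

    What separates the cases is the order of vanishing of [D - D 0] at the origin: infinite, one, or
    at least two. In the last case [d delta] vanishes at the base point, and pairing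
    [N^T (d delta) = 2 delta d lam] with [e], where [e lam = 1], gives [delta = 0] there. This is
    what rules out a non-zero constant in front of [u^m w (u)] when [m] is at least two. *)

Lemma sum_n_S (u : nat -> R) (n : nat) : sum_n u (S n) = sum_n u n + u (S n) :> R.
Proof. exact (sum_Sn u n). Qed.

Lemma sum_n_0 (u : nat -> R) : sum_n u 0 = u 0%nat :> R.
Proof. exact (sum_O u). Qed.

Lemma sum_n_eq (u v : nat -> R) (n : nat) :
  (forall i, u i = v i) -> sum_n u n = sum_n v n :> R.
Proof. exact (sum_n_ext u v n). Qed.

Lemma sum_n_add (u v : nat -> R) (n : nat) :
  sum_n (fun i => u i + v i) n = sum_n u n + sum_n v n :> R.
Proof. exact (sum_n_plus u v n). Qed.

Lemma sum_n_le (u v : nat -> R) (n : nat) :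
  (forall i, u i <= v i) -> sum_n u n <= sum_n v n.
Proof. intros H; apply sum_n_m_le, H. Qed.

Lemma sum_n_nonneg (u : nat -> R) (n : nat) : (forall i, 0 <= u i) -> 0 <= sum_n u n.
Proof.
  intros H; induction n; [rewrite sum_n_0 | rewrite sum_n_S; specialize (H (S n)) as H'];
    [apply H | lra].
Qed.

Lemma sum_n_mono (u : nat -> R) (n m : nat) :
  (forall i, 0 <= u i) -> (n <= m)%nat -> sum_n u n <= sum_n u m.
Proof.
  intros H Hnm; induction Hnm; [lra |].
  rewrite sum_n_S; specialize (H (S m)); lra.
Qed.

Lemma sum_n_scal (c : R) (u : nat -> R) (n : nat) :
  sum_n (fun i => c * u i) n = c * sum_n u n :> R.
Proof. exact (sum_n_mult_l c u n). Qed.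

Lemma sum_n_shift (u : nat -> R) (n : nat) :
  sum_n u (S n) = u 0%nat + sum_n (fun i => u (S i)) n :> R.
Proof.
  induction n.
  - rewrite sum_n_S, !sum_n_0; ring.
  - rewrite sum_n_S, IHn, sum_n_S; ring.
Qed.

Lemma sum_n_single (u : nat -> R) (n k : nat) :
  (forall i, i <> k -> u i = 0) -> (k <= n)%nat -> sum_n u n = u k :> R.
Proof.
  intros H.
  assert (Hz : forall m, (m < k)%nat -> sum_n u m = 0 :> R).
  { induction m; intros Hm.
    - rewrite sum_n_0; apply H; lia.
    - rewrite sum_n_S, IHm, H; [ring | lia | lia]. }
  induction n; intros Hk.
  - assert (k = 0)%nat by lia; subst; apply sum_n_0.
  - rewrite sum_n_S. destruct (Nat.eq_dec k (S n)) as [->|Hn].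
    + rewrite Hz by lia; ring.
    + rewrite IHn by lia. rewrite (H (S n)) by lia; ring.
Qed.

Definition abs_bd1 (u : nat -> R) (M : R) : Prop :=
  forall n, sum_n (fun i => Rabs (u i)) n <= M.

Lemma nonneg_bd_ex_series (u : nat -> R) (M : R) :
  (forall i, 0 <= u i) -> (forall n, sum_n u n <= M) -> ex_series u /\ Series u <= M.
Proof.
  intros Hp HM.
  assert (E : ex_finite_lim_seq (sum_n u)).
  { apply ex_finite_lim_seq_incr with M; auto.
    intros n; rewrite sum_n_S; specialize (Hp (S n)); lra. }
  split; [exact E |].
  destruct E as [l Hl].
  unfold Series; rewrite (is_lim_seq_unique _ _ Hl).
  exact (is_lim_seq_le _ (fun _ => M) l M HM Hl (is_lim_seq_const M)).
Qed.

Lemma sum_n_le_Series (u : nat -> R) (n : nat) :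
  (forall i, 0 <= u i) -> ex_series u -> sum_n u n <= Series u.
Proof.
  intros Hp E.
  apply (is_lim_seq_incr_compare (sum_n u)).
  - exact (Series_correct u E).
  - intros k; rewrite sum_n_S; specialize (Hp (S k)); lra.
Qed.

Lemma abs_bd1_ex_abs (u : nat -> R) (M : R) :
  abs_bd1 u M -> ex_series (fun i => Rabs (u i)).
Proof. intros H; apply (nonneg_bd_ex_series _ M); [intros; apply Rabs_pos | exact H]. Qed.

Lemma abs_bd1_ex (u : nat -> R) (M : R) : abs_bd1 u M -> ex_series u.
Proof. intros H; apply ex_series_Rabs, (abs_bd1_ex_abs _ M), H. Qed.

Lemma abs_bd1_Series_abs (u : nat -> R) (M : R) :
  abs_bd1 u M -> Series (fun i => Rabs (u i)) <= M.
Proof. intros H; apply (nonneg_bd_ex_series _ M); [intros; apply Rabs_pos | exact H]. Qed.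

Lemma abs_bd1_Series (u : nat -> R) (M : R) : abs_bd1 u M -> Rabs (Series u) <= M.
Proof.
  intros H. apply Rle_trans with (Series (fun i => Rabs (u i))).
  - apply Series_Rabs, (abs_bd1_ex_abs _ M), H.
  - apply abs_bd1_Series_abs, H.
Qed.

Lemma abs_bd1_of_ex (u : nat -> R) :
  ex_series (fun i => Rabs (u i)) -> abs_bd1 u (Series (fun i => Rabs (u i))).
Proof. intros H n; apply (sum_n_le_Series (fun i => Rabs (u i))); [intros; apply Rabs_pos | exact H]. Qed.

Lemma abs_bd1_le (u v : nat -> R) (M : R) :
  (forall i, Rabs (u i) <= Rabs (v i)) -> abs_bd1 v M -> abs_bd1 u M.
Proof. intros H Hv n; eapply Rle_trans; [apply sum_n_le, H | apply Hv]. Qed.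

(** * Double sequences: bounded sums and exchange of the order of summation *)

(** Finite rectangles, rather than iterated series, make the notion symmetric in the two indices and
    monotone under comparison, with no convergence side condition. *)
Definition abs_bd (u : nat -> nat -> R) (M : R) : Prop :=
  forall n m, sum_n (fun i => sum_n (fun j => Rabs (u i j)) m) n <= M.

(** [Series] is total, so this value is meaningful only together with a bound [abs_bd]. *)
Definition dsum (u : nat -> nat -> R) : R := Series (fun i => Series (u i)).

Lemma abs_bd_le (u v : nat -> nat -> R) (M : R) :
  (forall i j, Rabs (u i j) <= Rabs (v i j)) -> abs_bd v M -> abs_bd u M.
Proof.
  intros H Hv n m; eapply Rle_trans; [| apply (Hv n m)].
  apply sum_n_le; intros i; apply sum_n_le; intros j; apply H.
Qed.

Lemma abs_bd_weaken (u : nat -> nat -> R) (M M' : R) : M <= M' -> abs_bd u M -> abs_bd u M'.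
Proof. intros H Hu n m; eapply Rle_trans; [apply Hu | exact H]. Qed.

Lemma abs_bd_ext (u v : nat -> nat -> R) (M : R) :
  (forall i j, u i j = v i j) -> abs_bd u M -> abs_bd v M.
Proof. intros H; apply abs_bd_le; intros i j; rewrite H; lra. Qed.

Lemma abs_bd_nonneg (u : nat -> nat -> R) (M : R) : abs_bd u M -> 0 <= M.
Proof.
  intros H; eapply Rle_trans; [| apply (H 0%nat 0%nat)].
  apply sum_n_nonneg; intros; apply sum_n_nonneg; intros; apply Rabs_pos.
Qed.

Lemma abs_bd_row (u : nat -> nat -> R) (M : R) (i : nat) : abs_bd u M -> abs_bd1 (u i) M.
Proof.
  intros H m; eapply Rle_trans; [| apply (H i m)].
  assert (P : forall k, 0 <= sum_n (fun j => Rabs (u k j)) m)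
    by (intros; apply sum_n_nonneg; intros; apply Rabs_pos).
  destruct i; [rewrite sum_n_0; lra |].
  rewrite (sum_n_S (fun i => sum_n (fun j => Rabs (u i j)) m)).
  enough (0 <= sum_n (fun i => sum_n (fun j => Rabs (u i j)) m) i) by lra.
  apply sum_n_nonneg, P.
Qed.

Lemma sum_n_Series (u : nat -> nat -> R) (n : nat) :
  (forall i, ex_series (u i)) ->
  ex_series (fun j => sum_n (fun i => u i j) n) /\
  sum_n (fun i => Series (u i)) n = Series (fun j => sum_n (fun i => u i j) n).
Proof.
  intros H; induction n as [|n [IH1 IH2]].
  - split.
    + apply ex_series_ext with (u 0%nat); [intros; now rewrite sum_n_0 | apply H].
    + rewrite sum_n_0; apply Series_ext; intros; now rewrite sum_n_0.
  - assert (E : ex_series (fun j => sum_n (fun i => u i j) n + u (S n) j)).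
    { exact (ex_series_plus (fun j => sum_n (fun i => u i j) n) (u (S n)) IH1 (H (S n))). }
    split.
    + eapply ex_series_ext; [| exact E]; intros; simpl; now rewrite sum_n_S.
    + rewrite sum_n_S, IH2, <- Series_plus; auto.
      apply Series_ext; intros; now rewrite sum_n_S.
Qed.

(** Bridge from rectangles to iterated series: the number of columns goes to infinity first, then
    the number of rows; conversely, partial sums of nonnegative series lie below their sums. *)
Lemma abs_bd_iff_rows (u : nat -> nat -> R) (M : R) :
  abs_bd u M <->
  (forall i, ex_series (fun j => Rabs (u i j))) /\
  abs_bd1 (fun i => Series (fun j => Rabs (u i j))) M.
Proof.
  assert (P : forall i, ex_series (fun j => Rabs (u i j)) -> 0 <= Series (fun j => Rabs (u i j))).
  { intros i Hi; eapply Rle_trans; [apply Rabs_pos |].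
    rewrite <- (sum_n_0 (fun j => Rabs (u i j))).
    apply sum_n_le_Series; [intros; apply Rabs_pos | exact Hi]. }
  split.
  - intros H.
    assert (E : forall i, ex_series (fun j => Rabs (u i j)))
      by (intros i; apply (abs_bd1_ex_abs _ M), abs_bd_row, H).
    split; [exact E |]. intros n.
    rewrite (sum_n_eq _ (fun i => Series (fun j => Rabs (u i j))))
      by (intros i; apply Rabs_pos_eq, P, E).
    destruct (sum_n_Series (fun i j => Rabs (u i j)) n E) as [E1 ->].
    apply nonneg_bd_ex_series.
    + intros; apply sum_n_nonneg; intros; apply Rabs_pos.
    + intros m; rewrite (sum_n_switch (fun j i => Rabs (u i j))); apply H.
  - intros [E H] n m. eapply Rle_trans; [| apply (H n)].
    apply sum_n_le; intros i. rewrite Rabs_pos_eq by (apply P, E).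
    apply sum_n_le_Series; [intros; apply Rabs_pos | apply E].
Qed.

Lemma abs_bd_rowsums (u : nat -> nat -> R) (M : R) :
  abs_bd u M -> abs_bd1 (fun i => Series (u i)) M.
Proof.
  intros H; apply abs_bd_iff_rows in H as [E H].
  apply abs_bd1_le with (2 := H); intros i.
  eapply Rle_trans; [apply Series_Rabs, E | apply Rle_abs].
Qed.

Lemma abs_bd_dsum (u : nat -> nat -> R) (M : R) : abs_bd u M -> Rabs (dsum u) <= M.
Proof. intros H; apply abs_bd1_Series, abs_bd_rowsums, H. Qed.

Lemma dsum_ext (u v : nat -> nat -> R) : (forall i j, u i j = v i j) -> dsum u = dsum v.
Proof. intros H; apply Series_ext; intros i; apply Series_ext; intros j; apply H. Qed.

Lemma abs_bd_flip (u : nat -> nat -> R) (M : R) : abs_bd u M -> abs_bd (fun i j => u j i) M.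
Proof. intros H n m; rewrite (sum_n_switch (fun i j => Rabs (u j i))); apply H. Qed.

Lemma abs_bd_plus (u v : nat -> nat -> R) (M N : R) :
  abs_bd u M -> abs_bd v N -> abs_bd (fun i j => u i j + v i j) (M + N).
Proof.
  intros Hu Hv n m.
  apply Rle_trans with (sum_n (fun i => sum_n (fun j => Rabs (u i j)) m) n
                        + sum_n (fun i => sum_n (fun j => Rabs (v i j)) m) n).
  - rewrite <- sum_n_add. apply sum_n_le; intros i. rewrite <- sum_n_add.
    apply sum_n_le; intros j; apply Rabs_triang.
  - apply Rplus_le_compat; auto.
Qed.

Lemma abs_bd_scal (c : R) (u : nat -> nat -> R) (M : R) :
  abs_bd u M -> abs_bd (fun i j => c * u i j) (Rabs c * M).
Proof.
  intros H n m.
  rewrite (sum_n_eq _ (fun i => Rabs c * sum_n (fun j => Rabs (u i j)) m)).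
  - rewrite sum_n_scal; apply Rmult_le_compat_l; [apply Rabs_pos | apply H].
  - intros i; rewrite <- sum_n_scal; apply sum_n_eq; intros j; apply Rabs_mult.
Qed.

Lemma dsum_plus (u v : nat -> nat -> R) (M N : R) :
  abs_bd u M -> abs_bd v N -> dsum (fun i j => u i j + v i j) = dsum u + dsum v.
Proof.
  intros Hu Hv. unfold dsum.
  rewrite <- Series_plus.
  - apply Series_ext; intros i; apply Series_plus.
    + apply (abs_bd1_ex _ M), abs_bd_row, Hu.
    + apply (abs_bd1_ex _ N), abs_bd_row, Hv.
  - apply (abs_bd1_ex _ M), abs_bd_rowsums, Hu.
  - apply (abs_bd1_ex _ N), abs_bd_rowsums, Hv.
Qed.

Lemma dsum_scal (c : R) (u : nat -> nat -> R) : dsum (fun i j => c * u i j) = c * dsum u.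
Proof.
  unfold dsum; rewrite <- Series_scal_l; apply Series_ext; intros i; apply Series_scal_l.
Qed.

(* For nonnegative terms both iterated sums are the supremum of the rectangular sums. *)
Lemma dsum_flip_nonneg (u : nat -> nat -> R) (M : R) :
  (forall i j, 0 <= u i j) -> abs_bd u M -> dsum u = dsum (fun i j => u j i).
Proof.
  assert (Hle : forall v N, (forall i j, 0 <= v i j) -> abs_bd v N ->
                dsum v <= dsum (fun i j => v j i)).
  { intros v N Hp Hv.
    assert (Hb : abs_bd v (dsum (fun i j => v j i))).
    { intros n m. rewrite (sum_n_switch (fun i j => Rabs (v i j))).
      assert (Hf := abs_bd_flip _ _ Hv).
      apply abs_bd_iff_rows in Hf as [E1 E2].
      eapply Rle_trans.
      - apply sum_n_le; intros j.
        apply (sum_n_le_Series (fun i => Rabs (v i j)) n); [intros; apply Rabs_pos | apply E1].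
      - eapply Rle_trans.
        + apply sum_n_le; intros j; apply Rle_abs.
        + eapply Rle_trans; [apply (abs_bd1_of_ex _ (abs_bd1_ex_abs _ _ E2) m) |].
          apply Req_le; apply Series_ext; intros j.
          rewrite Rabs_pos_eq.
          * apply Series_ext; intros i; apply Rabs_pos_eq, Hp.
          * eapply Rle_trans; [apply Rabs_pos |].
            rewrite <- (sum_n_0 (fun i => Rabs (v i j))).
            apply sum_n_le_Series; [intros; apply Rabs_pos | apply E1]. }
    eapply Rle_trans; [apply Rle_abs | apply abs_bd_dsum, Hb]. }
  intros Hp Hu; apply Rle_antisym.
  - apply (Hle u M); auto.
  - apply (Hle (fun i j => u j i) M); auto using abs_bd_flip.
Qed.

(** Both [u + |u|] and [|u|] are nonnegative, and [u] is their difference. *)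
Lemma dsum_flip (u : nat -> nat -> R) (M : R) :
  abs_bd u M -> dsum u = dsum (fun i j => u j i).
Proof.
  intros Hu.
  assert (Ha : abs_bd (fun i j => Rabs (u i j)) M)
    by (apply abs_bd_le with (2 := Hu); intros; rewrite Rabs_Rabsolu; lra).
  assert (Hs := abs_bd_plus _ _ _ _ Hu Ha).
  assert (E1 := dsum_plus _ _ _ _ Hu Ha).
  assert (E2 := dsum_plus _ _ _ _ (abs_bd_flip _ _ Hu) (abs_bd_flip _ _ Ha)).
  rewrite (dsum_flip_nonneg _ M (fun i j => Rabs_pos (u i j)) Ha) in E1.
  assert (Hp : forall i j, 0 <= u i j + Rabs (u i j))
    by (intros i j; generalize (Rle_abs (- u i j)); rewrite Rabs_Ropp; lra).
  rewrite (dsum_flip_nonneg _ _ Hp Hs) in E1.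
  simpl in E1, E2; lra.
Qed.

(** Exchange of three summations by two exchanges of two: [k] with [j] at fixed [i], then [k] with
    [i] once [j] is summed. This is the source of the completeness of the algebra of power
    series. *)
Lemma abs_bd_series (u : nat -> nat -> nat -> R) (Mk : nat -> R) (M : R) :
  (forall k, abs_bd (u k) (Mk k)) -> (forall n, sum_n Mk n <= M) ->
  abs_bd (fun i j => Series (fun k => u k i j)) M /\
  dsum (fun i j => Series (fun k => u k i j)) = Series (fun k => dsum (u k)).
Proof.
  intros Hu HM.
  assert (R3 : forall n m l, sum_n (fun k => sum_n (fun i => sum_n (fun j => Rabs (u k i j)) m) n) l <= M).
  { intros n m l; eapply Rle_trans; [apply sum_n_le; intros k; apply (Hu k n m) | apply HM]. }
  assert (Hjk : forall i, abs_bd (fun k j => u k i j) M).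
  { intros i n m; eapply Rle_trans; [| apply (R3 i m n)].
    apply sum_n_le; intros k.
    assert (P : forall i', 0 <= sum_n (fun j => Rabs (u k i' j)) m)
      by (intros; apply sum_n_nonneg; intros; apply Rabs_pos).
    destruct i; [rewrite sum_n_0; lra |].
    rewrite (sum_n_S (fun i => sum_n (fun j => Rabs (u k i j)) m)).
    enough (0 <= sum_n (fun i => sum_n (fun j => Rabs (u k i j)) m) i) by lra.
    apply sum_n_nonneg, P. }
  assert (Hik : abs_bd (fun k i => Series (u k i)) M).
  { intros n m.
    eapply Rle_trans with (sum_n Mk n); [| apply HM].
    apply sum_n_le; intros k. apply (abs_bd_rowsums _ _ (Hu k)). }
  assert (Ek : forall i j, ex_series (fun k => Rabs (u k i j))).
  { intros i j; apply (abs_bd1_ex_abs _ M).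
    apply (abs_bd_row (fun j k => u k i j)), (abs_bd_flip _ _ (Hjk i)). }
  split.
  - intros n m.
    eapply Rle_trans.
    { apply sum_n_le; intros i; apply sum_n_le; intros j; apply Series_Rabs, Ek. }
    rewrite (sum_n_eq _ (fun i => Series (fun k => sum_n (fun j => Rabs (u k i j)) m))).
    2:{ intros i; apply (sum_n_Series (fun j k => Rabs (u k i j))); intros; apply Ek. }
    destruct (sum_n_Series (fun i k => sum_n (fun j => Rabs (u k i j)) m) n) as [_ ->].
    { intros i; apply (sum_n_Series (fun j k => Rabs (u k i j))); intros; apply Ek. }
    apply nonneg_bd_ex_series; [| intros l; apply R3].
    intros k; apply sum_n_nonneg; intros; apply sum_n_nonneg; intros; apply Rabs_pos.
  - transitivity (dsum (fun i k => Series (u k i))).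
    + apply Series_ext; intros i.
      symmetry. exact (dsum_flip _ _ (Hjk i)).
    + symmetry; exact (dsum_flip _ _ Hik).
Qed.

(** * Summation by homogeneous degree *)

(** Row [n] is the antidiagonal of degree [n], padded with zeros; column [i] is row [i] of [u]
    delayed by [i] places. Summation by degree thus becomes a question of rows against columns. *)
Definition diag (u : nat -> nat -> R) (n i : nat) : R :=
  if Nat.leb i n then u i (n - i)%nat else 0.

Lemma diag_row (u : nat -> nat -> R) (n m : nat) :
  (n <= m)%nat -> sum_n (diag u n) m = sum_n (fun i => u i (n - i)%nat) n :> R.
Proof.
  intros H; induction H.
  - apply sum_n_ext_loc; intros i Hi; unfold diag.
    now rewrite (proj2 (Nat.leb_le i n)) by exact Hi.
  - rewrite sum_n_S, IHle; unfold diag at 1.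
    rewrite (proj2 (Nat.leb_gt (S m) n)) by lia; ring.
Qed.

Lemma diag_col (u : nat -> nat -> R) (i m : nat) :
  sum_n (fun n => diag u n i) (i + m) = sum_n (u i) m :> R.
Proof.
  assert (Z : forall k, (k < i)%nat -> sum_n (fun n => diag u n i) k = 0 :> R).
  { assert (Zd : forall k, (k < i)%nat -> diag u k i = 0).
    { intros k Hk; unfold diag; now rewrite (proj2 (Nat.leb_gt i k)) by lia. }
    induction k; intros Hk; [rewrite sum_n_0; auto |].
    rewrite sum_n_S, IHk, Zd by lia; ring. }
  induction m.
  - rewrite Nat.add_0_r, sum_n_0. destruct i.
    + rewrite sum_n_0; reflexivity.
    + rewrite sum_n_S, Z by lia. unfold diag.
      rewrite Nat.leb_refl, Nat.sub_diag; ring.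
  - rewrite Nat.add_succ_r, !sum_n_S, IHm. f_equal.
    unfold diag; rewrite (proj2 (Nat.leb_le i (S (i + m)))) by lia.
    f_equal; lia.
Qed.

Lemma diag_abs (u : nat -> nat -> R) (n i : nat) :
  Rabs (diag u n i) = diag (fun i j => Rabs (u i j)) n i.
Proof. unfold diag; destruct (Nat.leb i n); [reflexivity | apply Rabs_R0]. Qed.

Lemma abs_bd_diag (u : nat -> nat -> R) (M : R) : abs_bd u M -> abs_bd (diag u) M.
Proof.
  intros H. apply (abs_bd_flip (fun i n => diag u n i)).
  intros n m; eapply Rle_trans; [| apply (H n m)].
  apply sum_n_le; intros i.
  rewrite (sum_n_eq _ (fun n => diag (fun i j => Rabs (u i j)) n i)) by (intros; apply diag_abs).
  rewrite <- (diag_col (fun i j => Rabs (u i j)) i m).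
  apply sum_n_mono; [| lia].
  intros k; rewrite <- diag_abs; apply Rabs_pos.
Qed.

(** The rectangle with corner [(n, m)] lies inside the triangle of degrees at most [n + m]. *)
Lemma abs_bd_undiag (u : nat -> nat -> R) (M : R) :
  abs_bd1 (fun n => sum_n (fun i => Rabs (u i (n - i)%nat)) n) M -> abs_bd u M.
Proof.
  intros H n m.
  eapply Rle_trans; [| apply (H (n + m)%nat)].
  apply Rle_trans with (sum_n (fun i => sum_n (fun k => Rabs (diag u k i)) (n + m)) n).
  - assert (Hl : forall n', (n' <= n)%nat ->
      sum_n (fun i => sum_n (fun j => Rabs (u i j)) m) n' <=
      sum_n (fun i => sum_n (fun k => Rabs (diag u k i)) (n + m)) n').
    { assert (Hc : forall i, (i <= n)%nat -> sum_n (fun j => Rabs (u i j)) m <=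
                  sum_n (fun k => Rabs (diag u k i)) (n + m)).
      { intros i Hi. rewrite <- (diag_col (fun i j => Rabs (u i j)) i m).
        rewrite (sum_n_eq (fun k => Rabs (diag u k i)) (fun n => diag (fun i j => Rabs (u i j)) n i))
          by (intros; apply diag_abs).
        apply sum_n_mono; [| lia].
        intros k; rewrite <- diag_abs; apply Rabs_pos. }
      induction n'; intros Hn; [rewrite !sum_n_0; apply Hc; lia |].
      rewrite !sum_n_S; apply Rplus_le_compat; [apply IHn'; lia | apply Hc; lia]. }
    apply Hl; lia.
  - rewrite (sum_n_switch (fun i k => Rabs (diag u k i))).
    apply sum_n_le; intros k.
    rewrite Rabs_pos_eq by (apply sum_n_nonneg; intros; apply Rabs_pos).
    rewrite <- (diag_row (fun i j => Rabs (u i j)) k (n + k)) by lia.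
    rewrite (sum_n_eq _ (fun i => diag (fun i j => Rabs (u i j)) k i)) by (intros; apply diag_abs).
    apply sum_n_mono; [intros; rewrite <- diag_abs; apply Rabs_pos | lia].
Qed.

Lemma Series_stationary (u : nat -> R) (N : nat) (l : R) :
  (forall n, (N <= n)%nat -> sum_n u n = l) -> Series u = l.
Proof.
  intros H; apply is_series_unique.
  apply (is_lim_seq_ext_loc (fun _ => l) (sum_n u) l); [| apply is_lim_seq_const].
  exists N; intros n Hn; symmetry; auto.
Qed.

Lemma Series_diag_col (u : nat -> nat -> R) (i : nat) :
  Series (fun n => diag u n i) = Series (u i).
Proof.
  unfold Series. f_equal.
  rewrite <- (Lim_seq_incr_n (sum_n (fun n => diag u n i)) i).
  apply Lim_seq_ext; intros m; rewrite Nat.add_comm; apply diag_col.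
Qed.

(** This is the exchange of the order of summation for [diag u]: its columns sum to the rows of [u],
    its rows to the homogeneous parts. *)
Lemma dsum_diag (u : nat -> nat -> R) (M : R) :
  abs_bd u M ->
  abs_bd1 (fun n => sum_n (fun i => Rabs (u i (n - i)%nat)) n) M /\
  is_series (fun n => sum_n (fun i => u i (n - i)%nat) n) (dsum u).
Proof.
  intros H.
  assert (Hrow : forall v n, Series (diag v n) = sum_n (fun i => v i (n - i)%nat) n).
  { intros v n; apply (Series_stationary _ n); intros; now apply diag_row. }
  assert (Hd : forall v N, abs_bd v N -> dsum v = Series (fun n => sum_n (fun i => v i (n - i)%nat) n)
    /\ abs_bd1 (fun n => sum_n (fun i => v i (n - i)%nat) n) N).
  { intros v N Hv. split.
    - transitivity (dsum (fun i n => diag v n i)).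
      + apply Series_ext; intros i; symmetry; apply Series_diag_col.
      + rewrite <- (dsum_flip _ _ (abs_bd_diag _ _ Hv)).
        apply Series_ext; intros n; apply Hrow.
    - intros n. rewrite (sum_n_eq _ (fun n => Rabs (Series (diag v n)))) by (intros; now rewrite Hrow).
      apply abs_bd_rowsums, abs_bd_diag, Hv. }
  split.
  - apply (Hd (fun i j => Rabs (u i j))), abs_bd_le with (2 := H); intros; rewrite Rabs_Rabsolu; lra.
  - destruct (Hd u M H) as [-> Hb].
    apply Series_correct, (abs_bd1_ex _ M), Hb.
Qed.

(** * Weighted l1 norms of double power series *)

(** The functions given on the open bidisc of radius [r] by a double power series whose
    weighted l1 norm is at most [M]; these form a Banach algebra. *)
Definition anorm_le (r M : R) (f : R -> R -> R) : Prop :=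
  exists a : nat -> nat -> R,
    abs_bd (fun i j => a i j * r ^ i * r ^ j) M /\
    forall s t, Rabs s < r -> Rabs t < r -> f s t = dsum (fun i j => a i j * s ^ i * t ^ j).

Lemma abs_bd_eval (a : nat -> nat -> R) (r M s t : R) :
  Rabs s <= r -> Rabs t <= r -> abs_bd (fun i j => a i j * r ^ i * r ^ j) M ->
  abs_bd (fun i j => a i j * s ^ i * t ^ j) M.
Proof.
  intros Hs Ht; apply abs_bd_le; intros i j.
  rewrite !Rabs_mult, !Rmult_assoc.
  apply Rmult_le_compat_l; [apply Rabs_pos |].
  rewrite <- !RPow_abs.
  apply Rmult_le_compat; try apply pow_le; try apply Rabs_pos;
    apply pow_incr; split; try apply Rabs_pos;
    eapply Rle_trans; eauto; apply Rle_abs.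
Qed.

Lemma anorm_ext (r M : R) (f g : R -> R -> R) :
  (forall s t, Rabs s < r -> Rabs t < r -> f s t = g s t) -> anorm_le r M f -> anorm_le r M g.
Proof.
  intros H [a [Ha Hf]]; exists a; split; [exact Ha |].
  intros s t Hs Ht; rewrite <- H; auto.
Qed.

Lemma anorm_weaken (r M M' : R) (f : R -> R -> R) : M <= M' -> anorm_le r M f -> anorm_le r M' f.
Proof. intros H [a [Ha Hf]]; exists a; split; [eapply abs_bd_weaken; eauto | exact Hf]. Qed.

Lemma anorm_restrict (r r' M : R) (f : R -> R -> R) :
  0 <= r' <= r -> anorm_le r M f -> anorm_le r' M f.
Proof.
  intros H [a [Ha Hf]]; exists a; split.
  - apply abs_bd_eval with r; auto; rewrite Rabs_pos_eq; lra.
  - intros; apply Hf; lra.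
Qed.

Lemma anorm_nonneg (r M : R) (f : R -> R -> R) : anorm_le r M f -> 0 <= M.
Proof. intros [a [Ha _]]; eapply abs_bd_nonneg; eauto. Qed.

Lemma anorm_bound (r M : R) (f : R -> R -> R) (s t : R) :
  anorm_le r M f -> Rabs s < r -> Rabs t < r -> Rabs (f s t) <= M.
Proof.
  intros [a [Ha Hf]] Hs Ht. rewrite Hf by auto.
  apply abs_bd_dsum, abs_bd_eval with r; auto; lra.
Qed.

Lemma dsum_corner (u : nat -> nat -> R) :
  (forall i j, (i, j) <> (0, 0)%nat -> u i j = 0) ->
  abs_bd u (Rabs (u 0%nat 0%nat)) /\ dsum u = u 0%nat 0%nat.
Proof.
  intros H.
  assert (Hr : forall v, (forall i, i <> 0%nat -> v i = 0) -> forall n, sum_n v n = v 0%nat).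
  { intros v Hv n; apply (sum_n_single v n 0); [exact Hv | lia]. }
  split.
  - intros n m. rewrite (sum_n_single _ n 0).
    + rewrite (sum_n_single _ m 0); [lra | | lia].
      intros j Hj; rewrite H by congruence; apply Rabs_R0.
    + intros i Hi. rewrite (Hr (fun j => Rabs (u i j))).
      * rewrite H by congruence; apply Rabs_R0.
      * intros j Hj; rewrite H by congruence; apply Rabs_R0.
    + lia.
  - unfold dsum. rewrite (Series_stationary _ 0 (Series (u 0%nat))).
    + apply (Series_stationary _ 0); intros n _; apply Hr; intros j Hj; apply H; congruence.
    + intros n _; apply (Hr (fun i => Series (u i))).
      intros i Hi; apply (Series_stationary _ 0); intros k _.
      rewrite (Hr (u i)); intros; apply H; congruence.
Qed.

Lemma anorm_const (r c : R) : anorm_le r (Rabs c) (fun _ _ => c).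
Proof.
  exists (fun i j => match i, j with O, O => c | _, _ => 0 end); split.
  - destruct (dsum_corner (fun i j => match i, j with O, O => c | _, _ => 0 end * r ^ i * r ^ j)) as [H _].
    + intros [|i] [|j] Hij; try ring. now contradict Hij.
    + simpl in H; rewrite !Rmult_1_r in H; exact H.
  - intros s t _ _.
    destruct (dsum_corner (fun i j => match i, j with O, O => c | _, _ => 0 end * s ^ i * t ^ j)) as [_ H].
    + intros [|i] [|j] Hij; try ring. now contradict Hij.
    + rewrite H; simpl; ring.
Qed.

Lemma anorm_plus (r M N : R) (f g : R -> R -> R) :
  anorm_le r M f -> anorm_le r N g -> anorm_le r (M + N) (fun s t => f s t + g s t).
Proof.
  intros [a [Ha Hf]] [b [Hb Hg]]; exists (fun i j => a i j + b i j); split.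
  - eapply abs_bd_ext; [| apply (abs_bd_plus _ _ _ _ Ha Hb)]; intros; simpl; ring.
  - intros s t Hs Ht. rewrite Hf, Hg by auto.
    rewrite <- (dsum_plus _ _ M N).
    + apply dsum_ext; intros; ring.
    + apply abs_bd_eval with r; auto; lra.
    + apply abs_bd_eval with r; auto; lra.
Qed.

Lemma anorm_scal (c r M : R) (f : R -> R -> R) :
  anorm_le r M f -> anorm_le r (Rabs c * M) (fun s t => c * f s t).
Proof.
  intros [a [Ha Hf]]; exists (fun i j => c * a i j); split.
  - eapply abs_bd_ext; [| apply (abs_bd_scal c _ _ Ha)]; intros; simpl; ring.
  - intros s t Hs Ht. rewrite Hf by auto. rewrite <- dsum_scal.
    apply dsum_ext; intros; ring.
Qed.

Lemma anorm_flip (r M : R) (f : R -> R -> R) :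
  anorm_le r M f -> anorm_le r M (fun s t => f t s).
Proof.
  intros [a [Ha Hf]]; exists (fun i j => a j i); split.
  - eapply abs_bd_ext; [| apply (abs_bd_flip _ _ Ha)]; intros; simpl; ring.
  - intros s t Hs Ht. rewrite Hf by auto.
    rewrite (dsum_flip _ M).
    + apply dsum_ext; intros; ring.
    + apply abs_bd_eval with r; auto; lra.
Qed.

Lemma abs_bd_shift (u : nat -> nat -> R) (M : R) :
  abs_bd u M -> abs_bd (fun i j => match i with O => 0 | S i' => u i' j end) M.
Proof.
  intros H n m.
  assert (H0 : sum_n (fun _ : nat => Rabs 0) m = 0)
    by (rewrite sum_n_const, Rabs_R0; apply Rmult_0_r).
  destruct n.
  - rewrite sum_n_0, H0. eapply abs_bd_nonneg; eauto.
  - rewrite sum_n_shift, H0, Rplus_0_l. apply H.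
Qed.

Lemma abs_bd_unshift (u : nat -> nat -> R) (M : R) :
  abs_bd u M -> abs_bd (fun i j => u (S i) j) M.
Proof.
  intros H n m. eapply Rle_trans; [| apply (H (S n) m)].
  rewrite (sum_n_shift (fun i => sum_n (fun j => Rabs (u i j)) m)).
  enough (0 <= sum_n (fun j => Rabs (u 0%nat j)) m) by lra.
  apply sum_n_nonneg; intros; apply Rabs_pos.
Qed.

(** Multiplication by a coordinate shifts the coefficients. Together with scalars and summable
    series this generates all products, so no Cauchy product is ever computed. *)
Lemma anorm_mulx (r M : R) (f : R -> R -> R) :
  0 <= r -> anorm_le r M f -> anorm_le r (r * M) (fun s t => s * f s t).
Proof.
  intros Hr [a [Ha Hf]].
  exists (fun i j => match i with O => 0 | S i' => a i' j end).
  split.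
  - apply (abs_bd_scal r), abs_bd_shift in Ha. rewrite (Rabs_pos_eq r Hr) in Ha.
    eapply abs_bd_ext; [| exact Ha]; intros [|i] j; simpl; ring.
  - intros s t Hs Ht. rewrite Hf by auto. rewrite <- dsum_scal.
    unfold dsum at 2. rewrite Series_incr_1_aux.
    + apply dsum_ext; intros; simpl; ring.
    + apply (Series_stationary _ 0); intros n _.
      rewrite (sum_n_eq _ (fun _ => 0)) by (intros; ring).
      rewrite sum_n_const; apply Rmult_0_r.
Qed.

Lemma anorm_fst (r : R) : 0 <= r -> anorm_le r r (fun s _ => s).
Proof.
  intros Hr. eapply anorm_ext, anorm_weaken, (anorm_mulx r _ _ Hr (anorm_const r 1)).
  - intros; simpl; ring.
  - rewrite Rabs_R1; lra.
Qed.

Lemma anorm_snd (r : R) : 0 <= r -> anorm_le r r (fun _ t => t).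
Proof. intros Hr; exact (anorm_flip _ _ _ (anorm_fst r Hr)). Qed.

(** Completeness of the algebra in the form in which it is used: a normally convergent series is
    summed coefficient by coefficient. The coefficients of each term are only known to exist, hence
    the use of choice. *)
Lemma anorm_series (r M : R) (m : nat -> R) (f : nat -> R -> R -> R) :
  (forall k, anorm_le r (m k) (f k)) -> (forall n, sum_n m n <= M) ->
  anorm_le r M (fun s t => Series (fun k => f k s t)).
Proof.
  intros Hf HM.
  destruct (functional_choice (fun k a =>
    abs_bd (fun i j => a i j * r ^ i * r ^ j) (m k) /\
    forall s t, Rabs s < r -> Rabs t < r -> f k s t = dsum (fun i j => a i j * s ^ i * t ^ j)) Hf)
    as [a Ha].
  exists (fun i j => Series (fun k => a k i j)); split.
  - eapply abs_bd_ext; [| apply (abs_bd_series _ m M (fun k => proj1 (Ha k)) HM)].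
    intros i j; simpl.
    rewrite !Series_scal_r; reflexivity.
  - intros s t Hs Ht.
    rewrite (Series_ext _ (fun k => dsum (fun i j => a k i j * s ^ i * t ^ j)))
      by (intros; now apply Ha).
    destruct (abs_bd_series (fun k i j => a k i j * s ^ i * t ^ j) m M) as [_ E]; auto.
    { intros k; apply abs_bd_eval with r; [lra | lra | apply Ha]. }
    rewrite <- E; apply dsum_ext; intros i j.
    rewrite !Series_scal_r; reflexivity.
Qed.

Lemma anorm_dsum (r M : R) (m : nat -> nat -> R) (f : nat -> nat -> R -> R -> R) :
  (forall i j, anorm_le r (m i j) (f i j)) -> abs_bd m M ->
  anorm_le r M (fun s t => dsum (fun i j => f i j s t)).
Proof.
  intros Hf Hm. apply abs_bd_iff_rows in Hm as [E Hm].
  apply (anorm_series r M (fun i => Series (fun j => Rabs (m i j)))).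
  - intros i. apply (anorm_series r _ (fun j => Rabs (m i j))).
    + intros j; eapply anorm_weaken; [apply Rle_abs | apply Hf].
    + apply (abs_bd1_of_ex _ (E i)).
  - intros n; eapply Rle_trans; [| apply (Hm n)].
    apply sum_n_le; intros; apply Rle_abs.
Qed.

(** * Products, compositions and Lipschitz estimates *)

Lemma anorm_pow_mul (r N P : R) (u g : R -> R -> R) (k : nat) :
  (forall M f, anorm_le r M f -> anorm_le r (N * M) (fun s t => u s t * f s t)) ->
  anorm_le r P g -> anorm_le r (N ^ k * P) (fun s t => u s t ^ k * g s t).
Proof.
  intros Hu Hg; induction k.
  - eapply anorm_ext, anorm_weaken, Hg; [intros; simpl; ring | simpl; lra].
  - eapply anorm_ext, anorm_weaken, (Hu _ _ IHk); [intros; simpl; ring | simpl; lra].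
Qed.

(** The multiplication hypotheses on [u] and [v] allow this lemma to be used to prove
    [anorm_mult] itself. *)
Lemma anorm_comp_gen (R0 r M N1 N2 P : R) (F u v g : R -> R -> R) :
  0 <= N1 <= R0 -> 0 <= N2 <= R0 ->
  anorm_le R0 M F ->
  (forall s t, Rabs s < r -> Rabs t < r -> Rabs (u s t) < R0 /\ Rabs (v s t) < R0) ->
  (forall M f, anorm_le r M f -> anorm_le r (N1 * M) (fun s t => u s t * f s t)) ->
  (forall M f, anorm_le r M f -> anorm_le r (N2 * M) (fun s t => v s t * f s t)) ->
  anorm_le r P g ->
  anorm_le r (M * P) (fun s t => F (u s t) (v s t) * g s t).
Proof.
  intros H1 H2 [a [Ha HF]] Huv Hu Hv Hg.
  assert (HP := anorm_nonneg _ _ _ Hg).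
  assert (Hb : abs_bd (fun i j => P * Rabs (a i j * R0 ^ i * R0 ^ j)) (P * M)).
  { replace (P * M) with (Rabs P * M) by (rewrite (Rabs_pos_eq P HP); reflexivity). apply abs_bd_scal.
    apply abs_bd_le with (2 := Ha); intros; rewrite Rabs_Rabsolu; lra. }
  rewrite Rmult_comm.
  apply anorm_ext with (fun s t => dsum (fun i j => a i j * (u s t ^ i * (v s t ^ j * g s t)))).
  - intros s t Hs Ht. rewrite HF by (apply Huv; auto).
    rewrite Rmult_comm, <- dsum_scal. apply dsum_ext; intros; ring.
  - apply anorm_dsum with (2 := Hb). intros i j.
    eapply anorm_weaken;
      [| exact (anorm_scal (a i j) _ _ _
             (anorm_pow_mul r N1 _ u _ i Hu (anorm_pow_mul r N2 _ v _ j Hv Hg)))].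
    rewrite !Rabs_mult, <- !RPow_abs, (Rabs_pos_eq R0) by lra.
    replace (P * (Rabs (a i j) * R0 ^ i * R0 ^ j)) with (Rabs (a i j) * (R0 ^ i * (R0 ^ j * P))) by ring.
    apply Rmult_le_compat_l; [apply Rabs_pos |].
    assert (Hi : 0 <= N1 ^ i <= R0 ^ i) by (split; [apply pow_le | apply pow_incr]; lra).
    assert (Hj : 0 <= N2 ^ j <= R0 ^ j) by (split; [apply pow_le | apply pow_incr]; lra).
    apply Rmult_le_compat; try apply Rmult_le_pos; try lra.
    apply Rmult_le_compat_r; lra.
Qed.

(** [f] is composed with the coordinates themselves: [g] is multiplied by each monomial of [f],
    which only takes shifts. *)
Lemma anorm_mult (r M N : R) (f g : R -> R -> R) :
  0 <= r -> anorm_le r M f -> anorm_le r N g -> anorm_le r (M * N) (fun s t => f s t * g s t).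
Proof.
  intros Hr Hf Hg.
  apply (anorm_comp_gen r r M r r N f (fun s _ => s) (fun _ t => t) g); auto; try lra.
  - intros; apply anorm_mulx; auto.
  - intros M' f' Hf'. apply (anorm_flip r _ (fun t s => t * f' s t)).
    apply anorm_mulx; auto. exact (anorm_flip _ _ _ Hf').
Qed.

(** The norms of the inner functions may equal [R0], as those of the coordinates do on the bidisc of
    radius [R0]; the values are therefore kept in the open bidisc by a separate hypothesis. *)
Lemma anorm_comp (R0 r M N1 N2 : R) (F u v : R -> R -> R) :
  0 <= r -> N1 <= R0 -> N2 <= R0 -> anorm_le R0 M F ->
  (forall s t, Rabs s < r -> Rabs t < r -> Rabs (u s t) < R0 /\ Rabs (v s t) < R0) ->
  anorm_le r N1 u -> anorm_le r N2 v -> anorm_le r M (fun s t => F (u s t) (v s t)).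
Proof.
  intros Hr H1 H2 HF Huv Hu Hv.
  assert (P1 := anorm_nonneg _ _ _ Hu). assert (P2 := anorm_nonneg _ _ _ Hv).
  eapply anorm_ext, anorm_weaken,
    (anorm_comp_gen R0 r M N1 N2 1 F u v (fun _ _ => 1)); auto; try lra.
  - intros; simpl; ring.
  - intros; apply anorm_mult; auto.
  - intros; apply anorm_mult; auto.
  - eapply anorm_weaken, anorm_const; rewrite Rabs_R1; lra.
Qed.

Lemma anorm_pow (r M : R) (f : R -> R -> R) (k : nat) :
  0 <= r -> anorm_le r M f -> anorm_le r (M ^ k) (fun s t => f s t ^ k).
Proof.
  intros Hr Hf.
  eapply anorm_ext, anorm_weaken, (anorm_pow_mul r M 1 f (fun _ _ => 1) k).
  - intros; simpl; ring.
  - lra.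
  - intros; apply anorm_mult; auto.
  - eapply anorm_weaken, anorm_const; rewrite Rabs_R1; lra.
Qed.

Lemma dsum_xpow0 (a : nat -> nat -> R) (t : R) :
  dsum (fun i j => a i j * 0 ^ i * t ^ j) = Series (fun j => a 0%nat j * t ^ j).
Proof.
  unfold dsum. rewrite (Series_stationary _ 0 (Series (fun j => a 0%nat j * t ^ j))); [reflexivity |].
  intros n _. rewrite (sum_n_single _ n 0).
  - apply Series_ext; intros; simpl; ring.
  - intros i Hi; apply (Series_stationary _ 0); intros k _.
    rewrite (sum_n_eq _ (fun _ => 0)).
    + rewrite sum_n_const; apply Rmult_0_r.
    + intros j; rewrite pow_ne_zero by exact Hi; ring.
  - lia.
Qed.

(** Without a constant term every monomial has degree at least one, and so gains a factor [q] when
    the radius shrinks by [q]. *)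
Lemma anorm_small (r M q : R) (f : R -> R -> R) :
  0 < r -> 0 <= q <= 1 -> anorm_le r M f -> f 0 0 = 0 -> anorm_le (q * r) (q * M) f.
Proof.
  intros Hr Hq [a [Ha Hf]] H0.
  assert (a00 : a 0%nat 0%nat = 0).
  { rewrite Hf, dsum_xpow0 in H0 by (rewrite Rabs_R0; exact Hr).
    rewrite <- H0. symmetry; apply (Series_stationary _ 0); intros n _.
    rewrite (sum_n_single _ n 0); [simpl; ring | | lia].
    intros i Hi; rewrite pow_ne_zero by exact Hi; ring. }
  exists a; split.
  - replace (q * M) with (Rabs q * M) by (rewrite Rabs_pos_eq; lra).
    apply (abs_bd_le _ (fun i j => q * (a i j * r ^ i * r ^ j))), abs_bd_scal, Ha.
    intros i j. rewrite !Rabs_mult.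
    destruct (Nat.eq_dec (i + j) 0) as [E|E].
    + assert (i = 0 /\ j = 0)%nat as [-> ->] by lia. rewrite a00, Rabs_R0; lra.
    + rewrite <- !RPow_abs, !Rabs_mult, !Rpow_mult_distr, (Rabs_pos_eq q), (Rabs_pos_eq r) by lra.
      replace (Rabs (a i j) * (q ^ i * r ^ i) * (q ^ j * r ^ j))
        with (q ^ (i + j) * (Rabs (a i j) * r ^ i * r ^ j)) by (rewrite pow_add; ring).
      apply Rmult_le_compat_r.
      * repeat apply Rmult_le_pos; try apply Rabs_pos; apply pow_le; lra.
      * destruct (i + j)%nat as [|k]; [lia |]. simpl.
        assert (q ^ k <= 1) by (rewrite <- (pow1 k); apply pow_incr; lra). nra.
  - assert (q * r <= r) by (rewrite <- (Rmult_1_l r) at 2; apply Rmult_le_compat_r; lra).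
    intros; apply Hf; lra.
Qed.

(** Induction on [u^(k+1) - v^(k+1) = u (u^k - v^k) + (u - v) v^k]. The constant is the derivative
    of [t^k] at [N]. *)
Lemma anorm_pow_diff (r N P : R) (u v : R -> R -> R) (k : nat) :
  0 <= r -> anorm_le r N u -> anorm_le r N v -> anorm_le r P (fun s t => u s t - v s t) ->
  anorm_le r (INR k * N ^ pred k * P) (fun s t => u s t ^ k - v s t ^ k).
Proof.
  intros Hr Hu Hv Hd; induction k.
  - eapply anorm_ext, anorm_weaken, (anorm_const r 0); [intros; simpl; ring |].
    rewrite Rabs_R0; simpl; lra.
  - eapply anorm_ext, anorm_weaken,
      (anorm_plus _ _ _ _ _ (anorm_mult _ _ _ _ _ Hr Hu IHk)
                            (anorm_mult _ _ _ _ _ Hr Hd (anorm_pow _ _ _ k Hr Hv))).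
    + intros; simpl; ring.
    + rewrite S_INR. simpl pred. destruct k; [simpl; lra |]. simpl pred.
      apply Req_le; simpl; ring.
Qed.

(** A mean value inequality in the algebra, proved term by term: [q] bounds the series of absolute
    values of the [t]-derivative of [F] at radius [N]. *)
Lemma anorm_lipschitz (R0 r M N q P : R) (a : nat -> nat -> R) (F u v w : R -> R -> R) :
  0 <= r -> N < R0 ->
  (forall s t, Rabs s < R0 -> Rabs t < R0 -> F s t = dsum (fun i j => a i j * s ^ i * t ^ j)) ->
  abs_bd (fun i j => a i j * R0 ^ i * R0 ^ j) M ->
  abs_bd (fun i j => a i j * N ^ i * (INR j * N ^ pred j)) q ->
  anorm_le r N w -> anorm_le r N u -> anorm_le r N v ->
  anorm_le r P (fun s t => u s t - v s t) ->
  anorm_le r (q * P) (fun s t => F (w s t) (u s t) - F (w s t) (v s t)).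
Proof.
  intros Hr HN HF Ha Hq Hw Hu Hv Hd.
  assert (HP := anorm_nonneg _ _ _ Hd). assert (HN0 := anorm_nonneg _ _ _ Hu).
  apply anorm_ext with (fun s t => dsum (fun i j => a i j * (w s t ^ i * (u s t ^ j - v s t ^ j)))).
  - intros s t Hs Ht.
    assert (Bw := anorm_bound _ _ _ s t Hw Hs Ht).
    assert (Bu := anorm_bound _ _ _ s t Hu Hs Ht).
    assert (Bv := anorm_bound _ _ _ s t Hv Hs Ht).
    rewrite !HF by lra.
    replace (dsum (fun i j => a i j * w s t ^ i * u s t ^ j) - dsum (fun i j => a i j * w s t ^ i * v s t ^ j))
      with (dsum (fun i j => a i j * w s t ^ i * u s t ^ j) + -1 * dsum (fun i j => a i j * w s t ^ i * v s t ^ j)) by ring.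
    rewrite <- dsum_scal, <- (dsum_plus _ _ M (Rabs (-1) * M)).
    + apply dsum_ext; intros; ring.
    + apply abs_bd_eval with R0; auto; lra.
    + apply abs_bd_scal, abs_bd_eval with R0; auto; lra.
  - rewrite Rmult_comm, <- (Rabs_pos_eq P HP).
    apply (anorm_dsum r _ (fun i j => P * Rabs (a i j * N ^ i * (INR j * N ^ pred j)))).
    + intros i j.
      eapply anorm_weaken, anorm_scal, anorm_mult, anorm_pow_diff; eauto.
      2:{ apply anorm_pow; eauto. }
      rewrite !Rabs_mult, <- !RPow_abs, (Rabs_pos_eq N), (Rabs_pos_eq (INR j)) by (try apply pos_INR; lra).
      apply Req_le; ring.
    + apply abs_bd_scal. apply abs_bd_le with (2 := Hq); intros; rewrite Rabs_Rabsolu; lra.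
Qed.

(** The factor [q] is gained when [a 0 1 = 0], since then every term of the
    [t]-derivative has positive degree. *)
Lemma abs_bd_tderiv (r M q : R) (a : nat -> nat -> R) :
  0 < r -> 0 <= q <= 1 -> abs_bd (fun i j => a i j * r ^ i * r ^ j) M ->
  q = 1 \/ a 0%nat 1%nat = 0 ->
  abs_bd (fun i j => a i j * (q * (r / 2)) ^ i * (INR j * (q * (r / 2)) ^ pred j)) (q * (M / r)).
Proof.
  intros Hr Hq Ha Hc.
  assert (Hr' : 0 < / r) by (apply Rinv_0_lt_compat; lra).
  replace (q * (M / r)) with (Rabs (q * / r) * M)
    by (rewrite Rabs_pos_eq; [field; lra | apply Rmult_le_pos; lra]).
  apply (abs_bd_le _ (fun i j => (q * / r) * (a i j * r ^ i * r ^ j))), abs_bd_scal, Ha.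
  intros i j. destruct j as [|j].
  { simpl. rewrite Rmult_0_l, Rmult_0_r, Rabs_R0; apply Rabs_pos. }
  simpl pred. rewrite !Rabs_mult, <- !RPow_abs, !Rabs_mult.
  rewrite (Rabs_pos_eq q), (Rabs_pos_eq (r / 2)), (Rabs_pos_eq r), (Rabs_pos_eq (/ r)),
    (Rabs_pos_eq (INR (S j))) by (try apply pos_INR; lra).
  replace (q * / r * (Rabs (a i (S j)) * r ^ i * r ^ S j))
    with (Rabs (a i (S j)) * (q * (r ^ i * r ^ j))) by (simpl; field; lra).
  replace (Rabs (a i (S j)) * (q * (r / 2)) ^ i * (INR (S j) * (q * (r / 2)) ^ j))
    with (Rabs (a i (S j)) * (q ^ (i + j) * ((/ 2) ^ i * (INR (S j) * (/ 2) ^ j) * (r ^ i * r ^ j))))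
    by (unfold Rdiv; rewrite !Rpow_mult_distr, pow_add; ring).
  destruct (Req_dec (a i (S j)) 0) as [->|Hne]; [rewrite Rabs_R0; lra |].
  apply Rmult_le_compat_l; [apply Rabs_pos |].
  assert (Hrr : 0 <= r ^ i * r ^ j) by (apply Rmult_le_pos; apply pow_le; lra).
  (* Halving the radius absorbs the factor produced by differentiation, because [j + 1 <= 2^j]. *)
  assert (Hh : (/ 2) ^ i * (INR (S j) * (/ 2) ^ j) <= 1).
  { assert (0 <= (/ 2) ^ i <= 1) by (split; [apply pow_le; lra | rewrite <- (pow1 i); apply pow_incr; lra]).
    assert (0 <= INR (S j) * (/ 2) ^ j <= 1).
    { split; [apply Rmult_le_pos; [apply pos_INR | apply pow_le; lra] |].
      clear; induction j; [simpl; lra |]. rewrite S_INR. simpl pow.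
      assert (0 < (/ 2) ^ j) by (apply pow_lt; lra).
      assert (1 <= INR (S j)) by (rewrite S_INR; generalize (pos_INR j); lra).
      nra. }
    nra. }
  assert (Hh0 : 0 <= (/ 2) ^ i * (INR (S j) * (/ 2) ^ j))
    by (apply Rmult_le_pos; [| apply Rmult_le_pos]; try apply pow_le; try apply pos_INR; lra).
  (* [i + j] is the degree after differentiation; it is zero only for the coefficient [a 0 1]. *)
  assert (Hqq : q ^ (i + j) <= q).
  { destruct Hc as [->|Hc]; [rewrite pow1; lra |].
    destruct (i + j)%nat as [|k] eqn:E.
    - assert (i = 0 /\ j = 0)%nat as [-> ->] by lia. contradiction.
    - simpl. assert (q ^ k <= 1) by (rewrite <- (pow1 k); apply pow_incr; lra). nra. }
  assert (0 <= q ^ (i + j)) by (apply pow_le; lra).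
  apply Rmult_le_compat; try lra.
  - apply Rmult_le_pos; lra.
  - nra.
Qed.

(** * The contraction principle *)

(** Iteration from zero: the first increment has norm at most [rho / 2] and the increments halve, so
    the iterates stay in the ball of radius [rho] and their telescoping series converges in the
    algebra. The equation is obtained only on the bidisc, outside which the norms say nothing. *)
Lemma anorm_fixpoint (r rho : R) (Phi : (R -> R -> R) -> R -> R -> R) :
  0 <= r ->
  anorm_le r (rho / 2) (Phi (fun _ _ => 0)) ->
  (forall u v M, anorm_le r rho u -> anorm_le r rho v ->
     anorm_le r M (fun s t => u s t - v s t) ->
     anorm_le r (M / 2) (fun s t => Phi u s t - Phi v s t)) ->
  exists Y, anorm_le r rho Y /\
    forall s t, Rabs s < r -> Rabs t < r -> Phi Y s t = Y s t.
Proof.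
  intros Hr H0 HL.
  set (u := fun n => Nat.iter n Phi (fun _ _ => 0)).
  assert (Hrho : 0 <= rho) by (apply anorm_nonneg in H0; lra).
  assert (Hpos : forall n, 0 < (/ 2) ^ n) by (intros; apply pow_lt; lra).
  assert (Hu : forall n, anorm_le r (rho * (1 - (/ 2) ^ n)) (u n) /\
                 anorm_le r (rho / 2 * (/ 2) ^ n) (fun s t => u (S n) s t - u n s t)).
  { assert (Hb : forall n, anorm_le r (rho * (1 - (/ 2) ^ n)) (u n) -> anorm_le r rho (u n)).
    { intros n; apply anorm_weaken. specialize (Hpos n); nra. }
    assert (Hn : forall n, anorm_le r (rho * (1 - (/ 2) ^ n)) (u n) ->
       anorm_le r (rho / 2 * (/ 2) ^ n) (fun s t => u (S n) s t - u n s t) ->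
       anorm_le r (rho * (1 - (/ 2) ^ S n)) (u (S n))).
    { intros n H1 H2. eapply anorm_ext, anorm_weaken, (anorm_plus _ _ _ _ _ H1 H2).
      - intros; simpl; ring.
      - simpl; lra. }
    induction n as [|n [IH1 IH2]].
    - split.
      + eapply anorm_ext, anorm_weaken, (anorm_const r 0); [reflexivity |].
        rewrite Rabs_R0; simpl; lra.
      + eapply anorm_ext, anorm_weaken, H0; [intros; simpl; ring | simpl; lra].
    - split; [apply Hn; auto |].
      eapply anorm_weaken, (HL (u (S n)) (u n)), IH2; auto.
      simpl; lra. }
  assert (Hg : forall n, sum_n (fun k => rho / 2 * (/ 2) ^ k) n = rho - rho * (/ 2) ^ S n :> R).
  { induction n; [rewrite sum_n_0; simpl; field |].
    rewrite sum_n_S, IHn; simpl; field. }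
  set (d := fun n s t => u (S n) s t - u n s t).
  assert (Htail : forall n, anorm_le r (rho * (/ 2) ^ n) (fun s t => Series (fun k => d (n + k)%nat s t))).
  { intros n. apply (anorm_series r _ (fun k => rho / 2 * (/ 2) ^ (n + k))).
    - intros k; apply Hu.
    - intros m. rewrite (sum_n_eq _ (fun k => (/ 2) ^ n * (rho / 2 * (/ 2) ^ k)))
        by (intros; rewrite pow_add; simpl; ring).
      rewrite sum_n_scal, Hg. assert (Hm := Hpos (S m)). assert (Hn := Hpos n).
      assert (0 <= rho * (/ 2) ^ S m) by nra. nra. }
  set (Y := fun s t => Series (fun k => d k s t)).
  assert (HY : anorm_le r rho Y).
  { eapply anorm_weaken, (Htail 0%nat); simpl; lra. }
  assert (Hsplit : forall n s t, Rabs s < r -> Rabs t < r ->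
            Y s t - u n s t = Series (fun k => d (n + k)%nat s t)).
  { intros n s t Hs Ht.
    assert (Hex : ex_series (fun k => d k s t)).
    { apply (abs_bd1_ex _ rho); intros m.
      eapply Rle_trans; [apply sum_n_le; intros k; apply (anorm_bound r _ (d k)); [apply Hu | auto | auto] |].
      rewrite Hg. specialize (Hpos (S m)); nra. }
    assert (Htel : forall m, sum_n (fun k => d k s t) m = u (S m) s t :> R).
    { induction m; [rewrite sum_n_0; unfold d, u; simpl; ring |].
      rewrite sum_n_S, IHm; unfold d; ring. }
    unfold Y. destruct n.
    - rewrite (Series_ext (fun k => d (0 + k)%nat s t) (fun k => d k s t)) by reflexivity.
      unfold u; simpl; ring.
    - rewrite (Series_incr_n _ (S n)) by (auto; lia). simpl pred.
      rewrite <- sum_n_Reals, Htel; ring. }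
  exists Y; split; [exact HY |].
  intros s t Hs Ht.
  (* [Phi Y] and [Y] are both close to the iterate [u (S n)]: the first by contraction, the second
     by the estimate of the tail. *)
  enough (Hn : forall n, Rabs (Phi Y s t - Y s t) <= 2 * rho * (/ 2) ^ n).
  { apply Rminus_diag_uniq. destruct (Req_dec (Phi Y s t - Y s t) 0) as [E|E]; [exact E |].
    exfalso. apply Rabs_pos_lt in E.
    destruct (pow_lt_1_zero (/ 2)) with (y := Rabs (Phi Y s t - Y s t) / (2 * rho + 1)) as [n Hn'].
    - rewrite Rabs_pos_eq; lra.
    - apply Rdiv_lt_0_compat; lra.
    - specialize (Hn n). specialize (Hn' n (Nat.le_refl n)).
      rewrite Rabs_pos_eq in Hn' by (specialize (Hpos n); lra).
      apply (Rmult_lt_compat_r (2 * rho + 1)) in Hn'; [| lra].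
      unfold Rdiv in Hn'. rewrite Rmult_assoc, Rinv_l, Rmult_1_r in Hn' by lra.
      specialize (Hpos n); nra. }
  intros n.
  assert (Hbn : anorm_le r rho (u n)).
  { eapply anorm_weaken, Hu. specialize (Hpos n); nra. }
  assert (D0 : anorm_le r (rho * (/ 2) ^ n) (fun s t => Y s t - u n s t)).
  { eapply anorm_ext, Htail. intros; simpl; rewrite <- Hsplit; auto. }
  assert (D1 := HL _ _ _ HY Hbn D0).
  apply (anorm_bound _ _ _ s t) in D1; auto.
  assert (D2 := anorm_bound _ _ _ s t (Htail (S n)) Hs Ht). simpl in D2.
  rewrite <- (Hsplit (S n)) in D2 by auto.
  replace (Phi Y s t - Y s t) with ((Phi Y s t - Phi (u n) s t) - (Y s t - u (S n) s t))
    by (unfold u; simpl; ring).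
  eapply Rle_trans; [apply Rabs_triang |]. rewrite Rabs_Ropp.
  specialize (Hpos n). nra.
Qed.

(** * Differentiation and integration of double series *)

(** At fixed [t] the double series is a power series in [s], which gives access to the one-variable
    theorems on derivatives and integrals. *)
Lemma dsum_as_PSeries (a : nat -> nat -> R) (s t : R) :
  dsum (fun i j => a i j * s ^ i * t ^ j) = PSeries (fun i => Series (fun j => a i j * t ^ j)) s.
Proof.
  apply Series_ext; intros i. rewrite <- Series_scal_r.
  apply Series_ext; intros j; ring.
Qed.

Lemma ex_series_CV_radius (a : nat -> R) (r : R) :
  0 <= r -> ex_series (fun n => a n * r ^ n) -> Rbar_le r (CV_radius a).
Proof.
  intros Hr Ha. apply Rbar_not_lt_le; intros Hlt.
  apply (CV_disk_outside a r).
  - now rewrite Rabs_pos_eq.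
  - apply ex_series_lim_0, Ha.
Qed.

Lemma abs_bd_CV_radius (a : nat -> nat -> R) (r M t : R) :
  0 <= r -> Rabs t <= r -> abs_bd (fun i j => a i j * r ^ i * r ^ j) M ->
  Rbar_le r (CV_radius (fun i => Series (fun j => a i j * t ^ j))).
Proof.
  intros Hr Ht Ha. apply ex_series_CV_radius; [exact Hr |].
  eapply ex_series_ext, (abs_bd1_ex _ M), abs_bd_rowsums, (abs_bd_eval a r M r t);
    auto; [| rewrite Rabs_pos_eq; lra].
  intros i; simpl. rewrite <- Series_scal_r. apply Series_ext; intros j; ring.
Qed.

(** An estimate of Cauchy type: half of the radius is given up to absorb the factor
    [i + 1 <= 2^i]. *)
Lemma anorm_derive (r M : R) (f : R -> R -> R) :
  0 < r -> anorm_le r M f ->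
  exists f', anorm_le (r / 2) (M / r) f' /\
    forall s t, Rabs s < r / 2 -> Rabs t < r / 2 -> is_derive (fun x => f x t) s (f' s t).
Proof.
  intros Hr [a [Ha Hf]].
  exists (fun s t => dsum (fun i j => (INR (S i) * a (S i) j) * s ^ i * t ^ j)); split.
  - exists (fun i j => INR (S i) * a (S i) j); split; [| reflexivity].
    replace (M / r) with (Rabs (/ r) * M)
      by (rewrite Rabs_pos_eq; [field; lra | left; apply Rinv_0_lt_compat; lra]).
    apply abs_bd_le with (fun i j => / r * (a (S i) j * r ^ S i * r ^ j)).
    2:{ apply abs_bd_scal, (abs_bd_unshift (fun i j => a i j * r ^ i * r ^ j)), Ha. }
    intros i j. unfold Rdiv; rewrite !Rpow_mult_distr.
    replace (/ r * (a (S i) j * r ^ S i * r ^ j)) with (a (S i) j * (r ^ i * r ^ j))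
      by (simpl; field; lra).
    replace (INR (S i) * a (S i) j * (r ^ i * (/ 2) ^ i) * (r ^ j * (/ 2) ^ j))
      with ((INR (S i) * (/ 2) ^ i * (/ 2) ^ j) * (a (S i) j * (r ^ i * r ^ j))) by ring.
    rewrite (Rabs_mult (INR (S i) * _ * _)).
    rewrite <- Rmult_1_l. apply Rmult_le_compat_r; [apply Rabs_pos |].
    assert (Hi : 0 <= INR (S i) * (/ 2) ^ i <= 1).
    { split; [apply Rmult_le_pos; [apply pos_INR | apply pow_le; lra] |].
      clear; induction i; [simpl; lra |]. rewrite S_INR. simpl pow.
      assert (0 < (/ 2) ^ i) by (apply pow_lt; lra).
      assert (1 <= INR (S i)) by (rewrite S_INR; generalize (pos_INR i); lra). nra. }
    assert (Hj : 0 <= (/ 2) ^ j <= 1) by (split; [apply pow_le | rewrite <- (pow1 j); apply pow_incr]; lra).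
    rewrite Rabs_pos_eq; nra.
  - intros s t Hs Ht. set (A := fun i => Series (fun j => a i j * t ^ j)).
    assert (HA : Rbar_le r (CV_radius A)) by (apply abs_bd_CV_radius with M; auto; lra).
    replace (dsum _) with (PSeries (PS_derive A) s).
    + apply is_derive_ext_loc with (PSeries A).
      * assert (He : 0 < r / 2) by lra. exists (mkposreal _ He); intros x Hx.
        change (Rabs (x - s) < r / 2) in Hx.
        rewrite Hf; [symmetry; apply dsum_as_PSeries | | lra].
        replace x with ((x - s) + s) by ring.
        eapply Rle_lt_trans; [apply Rabs_triang | lra].
      * apply is_derive_PSeries. eapply Rbar_lt_le_trans; [| exact HA]. simpl; lra.
    + rewrite dsum_as_PSeries. apply PSeries_ext; intros i. unfold PS_derive, A.
      rewrite <- Series_scal_l. apply Series_ext; intros; ring.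
Qed.

(** Integration divides coefficients by [i + 1], so it costs no radius. The factor [r] comes from
    the additional power of [s]; it is what makes the Picard operator contracting on a small
    bidisc. *)
Lemma anorm_RInt (r M : R) (f : R -> R -> R) :
  0 <= r -> anorm_le r M f ->
  anorm_le r (r * M) (fun s t => RInt (fun x => f x t) 0 s) /\
  forall s t, Rabs s < r -> Rabs t < r ->
    ex_RInt (fun x => f x t) 0 s /\ is_derive (fun s => RInt (fun x => f x t) 0 s) s (f s t).
Proof.
  intros Hr [a [Ha Hf]].
  assert (HI : forall s t, Rabs s < r -> Rabs t < r ->
    is_RInt (fun x => f x t) 0 s (PSeries (PS_Int (fun i => Series (fun j => a i j * t ^ j))) s)).
  { intros s t Hs Ht.
    apply is_RInt_ext with (PSeries (fun i => Series (fun j => a i j * t ^ j))).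
    - intros x Hx. rewrite Hf; [symmetry; apply dsum_as_PSeries | | exact Ht].
      apply Rabs_def2 in Hs. apply Rabs_def1; revert Hx; unfold Rmin, Rmax; destruct (Rle_dec 0 s); lra.
    - apply is_RInt_PSeries. eapply Rbar_lt_le_trans; [| apply (abs_bd_CV_radius a r M t); auto; lra].
      exact Hs. }
  split.
  - exists (fun i j => match i with O => 0 | S i' => a i' j / INR i end); split.
    + apply (abs_bd_scal r), abs_bd_shift in Ha. rewrite (Rabs_pos_eq r Hr) in Ha.
      apply abs_bd_le with (2 := Ha).
      intros [|i] j; [rewrite !Rmult_0_l, Rabs_R0; lra |].
      replace (a i j / INR (S i) * r ^ S i * r ^ j) with (/ INR (S i) * (r * (a i j * r ^ i * r ^ j)))
        by (rewrite <- tech_pow_Rmult; field; apply not_0_INR; lia).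
      rewrite (Rabs_mult (/ _)), <- Rmult_1_l.
      apply Rmult_le_compat_r; [apply Rabs_pos |].
      rewrite Rabs_pos_eq by (left; apply Rinv_0_lt_compat, lt_0_INR; lia).
      rewrite <- Rinv_1. apply Rinv_le_contravar; [lra |].
      rewrite S_INR; generalize (pos_INR i); lra.
    + intros s t Hs Ht. rewrite (is_RInt_unique _ _ _ _ (HI s t Hs Ht)), dsum_as_PSeries.
      apply PSeries_ext; intros [|i]; unfold PS_Int.
      * symmetry; apply (Series_stationary _ 0); intros n _.
        rewrite (sum_n_eq _ (fun _ => 0)) by (intros; ring).
        rewrite sum_n_const; apply Rmult_0_r.
      * unfold Rdiv; rewrite <- Series_scal_r. apply Series_ext; intros; ring.
  - intros s t Hs Ht. split; [eexists; apply HI; auto |].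
    assert (He : 0 < r - Rabs s) by lra.
    assert (Hn : forall x, ball s (mkposreal _ He) x -> Rabs x < r).
    { intros x Hx. change (Rabs (x - s) < r - Rabs s) in Hx.
      replace x with ((x - s) + s) by ring.
      eapply Rle_lt_trans; [apply Rabs_triang | lra]. }
    apply (is_derive_RInt (fun x => f x t) _ 0).
    + exists (mkposreal _ He); intros x Hx.
      apply (RInt_correct (fun x => f x t)). eexists; apply HI; auto.
    + apply continuous_ext_loc with (PSeries (fun i => Series (fun j => a i j * t ^ j))).
      * exists (mkposreal _ He); intros x Hx. rewrite Hf; auto. symmetry; apply dsum_as_PSeries.
      * apply (ex_derive_continuous (PSeries _)).
        eexists; apply is_derive_PSeries.
        eapply Rbar_lt_le_trans; [| apply (abs_bd_CV_radius a r M t); auto; lra].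
        exact Hs.
Qed.

(** Absolute convergence at the single point [(r / 2, r / 2)] of the given bidisc already bounds the
    weighted norm at radius [r / 2]. What remains is the passage between summation by degree and
    iterated summation. *)
Lemma analytic_at_iff (f : R * R -> R) (p : R * R) :
  analytic_at f p <->
  exists r M, 0 < r /\ anorm_le r M (fun s t => f (fst p + s, snd p + t)).
Proof.
  split.
  - intros (a & r & Hr & H). exists (r / 2).
    assert (Hr2 : Rabs (r / 2) < r) by (rewrite Rabs_pos_eq; lra).
    destruct (H _ _ Hr2 Hr2) as [E _].
    set (U := fun i j => a i j * (r / 2) ^ i * (r / 2) ^ j).
    set (M := Series (fun n => sum_n (fun i => Rabs (U i (n - i)%nat)) n)).
    assert (Hb : abs_bd U M).
    { apply abs_bd_undiag.
      assert (P : forall n, 0 <= sum_n (fun i => Rabs (U i (n - i)%nat)) n)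
        by (intros; apply sum_n_nonneg; intros; apply Rabs_pos).
      intros n. rewrite (sum_n_eq _ (fun n => sum_n (fun i => Rabs (U i (n - i)%nat)) n))
        by (intros; apply Rabs_pos_eq, P).
      apply sum_n_le_Series; [exact P | exact E]. }
    exists M. split; [lra |]. exists a; split; [exact Hb |].
    intros s t Hs Ht.
    assert (Hst : abs_bd (fun i j => a i j * s ^ i * t ^ j) M)
      by (apply abs_bd_eval with (r / 2); auto; lra).
    destruct (H s t) as [_ E2]; [lra | lra |].
    apply is_series_unique in E2. rewrite <- E2.
    exact (is_series_unique _ _ (proj2 (dsum_diag _ _ Hst))).
  - intros (r & M & Hr & a & Ha & Hf). exists a, r. split; [exact Hr |].
    intros s t Hs Ht.
    assert (Hst : abs_bd (fun i j => a i j * s ^ i * t ^ j) M)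
      by (apply abs_bd_eval with r; auto; lra).
    destruct (dsum_diag _ _ Hst) as [H1 H2]. split.
    + apply (nonneg_bd_ex_series _ M).
      * intros; apply sum_n_nonneg; intros; apply Rabs_pos.
      * intros n. eapply Rle_trans; [| apply (H1 n)].
        apply sum_n_le; intros; apply Rle_abs.
    + rewrite Hf by auto. exact H2.
Qed.

(** * Germs of analytic functions *)

Definition swap (z : R * R) : R * R := (snd z, fst z).

Lemma locally_box (p : R * R) (P : R * R -> Prop) :
  locally p P <->
  exists d, 0 < d /\ forall x y, Rabs (x - fst p) < d -> Rabs (y - snd p) < d -> P (x, y).
Proof.
  split.
  - intros [d Hd]. exists d; split; [apply cond_pos |].
    intros x y Hx Hy; apply Hd; split; [exact Hx | exact Hy].
  - intros (d & Hd & H). exists (mkposreal d Hd).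
    intros [x y] [Hx Hy]; apply H; [exact Hx | exact Hy].
Qed.

Lemma locally_imp (p : R * R) (P Q : R * R -> Prop) :
  (forall x y : R, P (x, y) -> Q (x, y)) -> locally p P -> locally p Q.
Proof. intros H; apply filter_imp; intros [x y]; apply H. Qed.

Lemma locally_imp2 (p : R * R) (P Q S : R * R -> Prop) :
  (forall x y : R, P (x, y) -> Q (x, y) -> S (x, y)) ->
  locally p P -> locally p Q -> locally p S.
Proof.
  intros H HP HQ; generalize (filter_and _ _ HP HQ); apply filter_imp.
  intros [x y] [H1 H2]; auto.
Qed.

Lemma locally_at (p : R * R) (P : R * R -> Prop) : locally p P -> P p.
Proof. apply locally_singleton. Qed.

(** This brings the inner functions of a composition into the bidisc where the outer series
    converges; continuity is the same estimate read pointwise. *)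
Lemma anorm_at_small (f : R * R -> R) (p : R * R) (rho : R) :
  analytic_at f p -> 0 < rho ->
  exists r, 0 < r /\ anorm_le r rho (fun s t => f (fst p + s, snd p + t) - f p).
Proof.
  intros Hf Hrho. apply analytic_at_iff in Hf as (r & M & Hr & Hf).
  assert (HM := anorm_nonneg _ _ _ Hf).
  set (N := M + Rabs (- f p)).
  assert (HN : 0 <= N) by (unfold N; generalize (Rabs_pos (- f p)); lra).
  set (q := Rmin 1 (rho / (N + 1))).
  assert (Hq : 0 < q <= 1).
  { split; [apply Rmin_glb_lt; [lra | apply Rdiv_lt_0_compat; lra] | apply Rmin_l]. }
  exists (q * r); split; [nra |].
  apply anorm_weaken with (q * N).
  - apply Rle_trans with (rho / (N + 1) * N); [apply Rmult_le_compat_r; [lra | apply Rmin_r] |].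
    replace (rho / (N + 1) * N) with (rho * (N / (N + 1))) by (field; lra).
    rewrite <- (Rmult_1_r rho) at 2. apply Rmult_le_compat_l; [lra |].
    apply Rle_div_l; lra.
  - apply anorm_small; [lra | lra | |].
    + exact (anorm_plus _ _ _ _ _ Hf (anorm_const r (- f p))).
    + simpl. rewrite !Rplus_0_r. destruct p; simpl; ring.
Qed.

Lemma analytic_continuous (f : R * R -> R) (p : R * R) : analytic_at f p -> continuous f p.
Proof.
  intros Hf. apply filterlim_locally. intros eps.
  assert (He : 0 < eps / 2) by (generalize (cond_pos eps); lra).
  destruct (anorm_at_small f p _ Hf He) as (r & Hr & H).
  apply locally_box. exists r; split; [exact Hr |]. intros x y Hx Hy.
  change (Rabs (f (x, y) - f p) < eps).
  apply (anorm_bound _ _ _ (x - fst p) (y - snd p)) in H; auto.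
  cbv beta in H. replace (fst p + (x - fst p)) with x in H by ring.
  replace (snd p + (y - snd p)) with y in H by ring. lra.
Qed.

Lemma analytic_const (c : R) (p : R * R) : analytic_at (fun _ => c) p.
Proof.
  apply analytic_at_iff; exists 1, (Rabs c); split; [lra | apply anorm_const].
Qed.

Lemma analytic_plus (f g : R * R -> R) (p : R * R) :
  analytic_at f p -> analytic_at g p -> analytic_at (fun z => f z + g z) p.
Proof.
  rewrite !analytic_at_iff. intros (r & M & Hr & Hf) (r' & N & Hr' & Hg).
  exists (Rmin r r'), (M + N).
  assert (Hm : 0 < Rmin r r') by (apply Rmin_glb_lt; auto).
  split; [exact Hm |].
  apply (anorm_plus _ _ _ (fun s t => f (fst p + s, snd p + t)) (fun s t => g (fst p + s, snd p + t))).
  - apply anorm_restrict with r; auto; generalize (Rmin_l r r'); lra.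
  - apply anorm_restrict with r'; auto; generalize (Rmin_r r r'); lra.
Qed.

Lemma analytic_mult (f g : R * R -> R) (p : R * R) :
  analytic_at f p -> analytic_at g p -> analytic_at (fun z => f z * g z) p.
Proof.
  rewrite !analytic_at_iff. intros (r & M & Hr & Hf) (r' & N & Hr' & Hg).
  exists (Rmin r r'), (M * N).
  assert (Hm : 0 < Rmin r r') by (apply Rmin_glb_lt; auto).
  split; [exact Hm |].
  apply (anorm_mult _ _ _ (fun s t => f (fst p + s, snd p + t)) (fun s t => g (fst p + s, snd p + t))).
  - lra.
  - apply anorm_restrict with r; auto; generalize (Rmin_l r r'); lra.
  - apply anorm_restrict with r'; auto; generalize (Rmin_r r r'); lra.
Qed.

Lemma analytic_fst (p : R * R) : analytic_at fst p.
Proof.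
  apply analytic_at_iff; exists 1; eexists; split; [lra |].
  exact (anorm_plus 1 _ _ _ _ (anorm_const 1 (fst p)) (anorm_fst 1 Rle_0_1)).
Qed.

Lemma analytic_snd (p : R * R) : analytic_at snd p.
Proof.
  apply analytic_at_iff; exists 1; eexists; split; [lra |].
  exact (anorm_plus 1 _ _ _ _ (anorm_const 1 (snd p)) (anorm_snd 1 Rle_0_1)).
Qed.

Lemma analytic_ext_loc (f g : R * R -> R) (p : R * R) :
  locally p (fun z => f z = g z) -> analytic_at f p -> analytic_at g p.
Proof.
  intros H. apply locally_box in H as (d & Hd & H).
  rewrite !analytic_at_iff. intros (r & M & Hr & Hf).
  exists (Rmin r d), M. assert (Hm : 0 < Rmin r d) by (apply Rmin_glb_lt; auto).
  split; [exact Hm |].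
  generalize (Rmin_l r d) (Rmin_r r d); intros.
  apply anorm_ext with (fun s t => f (fst p + s, snd p + t)).
  - intros s t Hs Ht; apply H; simpl.
    + replace (fst p + s - fst p) with s by ring; lra.
    + replace (snd p + t - snd p) with t by ring; lra.
  - apply anorm_restrict with r; auto; lra.
Qed.

Lemma analytic_ext (f g : R * R -> R) (p : R * R) :
  (forall z, f z = g z) -> analytic_at f p -> analytic_at g p.
Proof. intros H; apply analytic_ext_loc, filter_forall, H. Qed.

Lemma analytic_opp (f : R * R -> R) (p : R * R) :
  analytic_at f p -> analytic_at (fun z => - f z) p.
Proof.
  intros Hf. apply analytic_ext with (fun z => -1 * f z); [intros; ring |].
  apply analytic_mult; [apply analytic_const | exact Hf].
Qed.

Lemma analytic_minus (f g : R * R -> R) (p : R * R) :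
  analytic_at f p -> analytic_at g p -> analytic_at (fun z => f z - g z) p.
Proof. intros Hf Hg; apply analytic_plus; [exact Hf | apply analytic_opp, Hg]. Qed.

Lemma analytic_pow (f : R * R -> R) (k : nat) (p : R * R) :
  analytic_at f p -> analytic_at (fun z => f z ^ k) p.
Proof.
  intros Hf; induction k; [exact (analytic_const 1 p) | exact (analytic_mult _ _ _ Hf IHk)].
Qed.

Lemma analytic_comp (f g1 g2 : R * R -> R) (p : R * R) :
  analytic_at f (g1 p, g2 p) -> analytic_at g1 p -> analytic_at g2 p ->
  analytic_at (fun z => f (g1 z, g2 z)) p.
Proof.
  intros Hf H1 H2. apply analytic_at_iff in Hf as (R0 & M & HR & Hf).
  assert (HR2 : 0 < R0 / 2) by lra.
  destruct (anorm_at_small g1 p _ H1 HR2) as (r1 & Hr1 & B1).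
  destruct (anorm_at_small g2 p _ H2 HR2) as (r2 & Hr2 & B2).
  apply analytic_at_iff. exists (Rmin r1 r2), M.
  assert (Hm : 0 < Rmin r1 r2) by (apply Rmin_glb_lt; auto).
  generalize (Rmin_l r1 r2) (Rmin_r r1 r2); intros.
  split; [exact Hm |].
  apply anorm_restrict with (r' := Rmin r1 r2) in B1; [| lra].
  apply anorm_restrict with (r' := Rmin r1 r2) in B2; [| lra].
  eapply anorm_ext, (anorm_comp R0 _ M _ _ _ _ _ _ _ _ Hf _ B1 B2).
  - intros s t Hs Ht; simpl. apply f_equal, f_equal2; ring.
  Unshelve. all: try lra.
  intros s t Hs Ht.
  apply (anorm_bound _ _ _ s t) in B1; auto. apply (anorm_bound _ _ _ s t) in B2; auto. lra.
Qed.

Lemma analytic_swap (f : R * R -> R) (p : R * R) :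
  analytic_at f (swap p) -> analytic_at (fun z => f (swap z)) p.
Proof.
  intros Hf. apply (analytic_comp f snd fst); [exact Hf | apply analytic_snd | apply analytic_fst].
Qed.

(** Re-expansion at a nearby point is composition with a translation; a shift below [r / 2] and a
    radius [r / 4] keep the values inside the bidisc of radius [r]. *)
Lemma analytic_locally (f : R * R -> R) (p : R * R) :
  analytic_at f p -> locally p (analytic_at f).
Proof.
  intros Hf. apply analytic_at_iff in Hf as (r & M & Hr & Hf).
  apply locally_box. exists (r / 2). split; [lra |]. intros x y Hx Hy.
  apply analytic_at_iff. exists (r / 4), M. split; [lra |].
  eapply anorm_ext, (anorm_comp r (r / 4) M (Rabs (x - fst p) + r / 4) (Rabs (y - snd p) + r / 4)
    _ (fun s _ => (x - fst p) + s) (fun _ t => (y - snd p) + t)); try exact Hf; try lra.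
  - intros s t _ _; cbn beta; simpl fst; simpl snd. apply f_equal. apply f_equal2; ring.
  - intros s t Hs Ht. split; (eapply Rle_lt_trans; [apply Rabs_triang | lra]).
  - apply (anorm_plus _ _ _ (fun _ _ => x - fst p) (fun s _ => s));
      [apply anorm_const | apply anorm_fst; lra].
  - apply (anorm_plus _ _ _ (fun _ _ => y - snd p) (fun _ t => t));
      [apply anorm_const | apply anorm_snd; lra].
Qed.

(** * Partial derivatives and the chain rule *)

(** Differentiability is stated along with analyticity because [partial_x] rests on the total
    operator [Derive], whose value alone does not say that a derivative exists. *)
Lemma analytic_partial_x (f : R * R -> R) (p : R * R) :
  analytic_at f p ->
  analytic_at (partial_x f) p /\ is_derive (fun t => f (t, snd p)) (fst p) (partial_x f p).
Proof.
  intros Hf. apply analytic_at_iff in Hf as (r & M & Hr & Hf).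
  destruct (anorm_derive _ _ _ Hr Hf) as (f' & Hf' & HD).
  assert (HD' : forall s t, Rabs s < r / 2 -> Rabs t < r / 2 ->
     is_derive (fun x => f (x, snd p + t)) (fst p + s) (f' s t)).
  { intros s t Hs Ht.
    apply is_derive_ext with (fun x => f (fst p + (x - fst p), snd p + t)).
    { intros x; apply f_equal, f_equal2; ring. }
    replace (f' s t) with (scal 1 (f' s t)) by apply (scal_one (f' s t)).
    apply (is_derive_comp (fun x => f (fst p + x, snd p + t)) (fun x => x - fst p)).
    - replace (fst p + s - fst p) with s by ring. apply HD; auto.
    - auto_derive; [exact I | ring]. }
  assert (HE : forall s t, Rabs s < r / 2 -> Rabs t < r / 2 ->
     partial_x f (fst p + s, snd p + t) = f' s t)
    by (intros s t Hs Ht; apply is_derive_unique, HD'; auto).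
  split.
  - apply analytic_at_iff. exists (r / 2), (M / r). split; [lra |].
    eapply anorm_ext, Hf'. intros s t Hs Ht; symmetry; auto.
  - assert (H0 : Rabs 0 < r / 2) by (rewrite Rabs_R0; lra).
    specialize (HD' 0 0 H0 H0). specialize (HE 0 0 H0 H0).
    rewrite <- HE in HD'. rewrite !Rplus_0_r in HD'. destruct p; exact HD'.
Qed.

Lemma analytic_partial_y (f : R * R -> R) (p : R * R) :
  analytic_at f p ->
  analytic_at (partial_y f) p /\ is_derive (fun t => f (fst p, t)) (snd p) (partial_y f p).
Proof.
  intros Hf.
  destruct (analytic_partial_x (fun z => f (swap z)) (swap p)) as [H1 H2].
  { apply analytic_swap. destruct p; exact Hf. }
  split; [| exact H2].
  apply analytic_ext with (fun z => partial_x (fun w => f (swap w)) (swap z)).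
  - intros [x y]; reflexivity.
  - apply analytic_swap, H1.
Qed.

(** Total differentiability, on which the chain rule rests, follows from a continuous partial
    derivative in one variable and the existence of the other. *)
Lemma analytic_filterdiff (f : R * R -> R) (p : R * R) :
  analytic_at f p ->
  filterdiff f (locally p) (fun u => fst u * partial_x f p + snd u * partial_y f p).
Proof.
  intros Hf. destruct p as [x y].
  apply filterdiff_ext_lin with
    (fun u : R * R => plus (scal (fst u) ((fun a b => partial_x f (a, b)) x y))
                           (scal (snd u) (partial_y f (x, y)))).
  2: reflexivity.
  apply filterdiff_ext with (fun u : R * R => (fun a b => f (a, b)) (fst u) (snd u)).
  { intros [a b]; reflexivity. }
  apply (is_derive_filterdiff (fun a b => f (a, b)) x y (fun a b => partial_x f (a, b))).
  - eapply filter_imp, analytic_locally, Hf.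
    intros [a b] H; exact (proj2 (analytic_partial_x _ _ H)).
  - exact (proj2 (analytic_partial_y _ _ Hf)).
  - apply continuous_ext with (partial_x f); [intros [a b]; reflexivity |].
    apply analytic_continuous, analytic_partial_x, Hf.
Qed.

Lemma is_derive_analytic_curve (f : R * R -> R) (g1 g2 : R -> R) (t d1 d2 : R) :
  analytic_at f (g1 t, g2 t) -> is_derive g1 t d1 -> is_derive g2 t d2 ->
  is_derive (fun x => f (g1 x, g2 x)) t
    (partial_x f (g1 t, g2 t) * d1 + partial_y f (g1 t, g2 t) * d2).
Proof.
  intros Hf H1 H2. unfold is_derive.
  eapply filterdiff_ext_lin.
  - apply (filterdiff_comp'_2 g1 g2 (fun a b => f (a, b)) t _ _
      (fun a b => a * partial_x f (g1 t, g2 t) + b * partial_y f (g1 t, g2 t)) H1 H2).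
    eapply filterdiff_ext; [| exact (analytic_filterdiff _ _ Hf)].
    intros [a b]; reflexivity.
  - intros u; simpl. unfold scal; simpl; unfold mult; simpl. ring.
Qed.

Lemma partial_comp (f g1 g2 : R * R -> R) (p : R * R) :
  analytic_at f (g1 p, g2 p) -> analytic_at g1 p -> analytic_at g2 p ->
  partial_x (fun z => f (g1 z, g2 z)) p =
    partial_x f (g1 p, g2 p) * partial_x g1 p + partial_y f (g1 p, g2 p) * partial_x g2 p /\
  partial_y (fun z => f (g1 z, g2 z)) p =
    partial_x f (g1 p, g2 p) * partial_y g1 p + partial_y f (g1 p, g2 p) * partial_y g2 p.
Proof.
  intros Hf H1 H2. destruct p as [x y]. split; apply is_derive_unique; simpl.
  - apply (is_derive_analytic_curve f (fun t => g1 (t, y)) (fun t => g2 (t, y))); auto.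
    + apply (analytic_partial_x g1 (x, y) H1).
    + apply (analytic_partial_x g2 (x, y) H2).
  - apply (is_derive_analytic_curve f (fun t => g1 (x, t)) (fun t => g2 (x, t))); auto.
    + apply (analytic_partial_y g1 (x, y) H1).
    + apply (analytic_partial_y g2 (x, y) H2).
Qed.

Lemma locally_slices (p : R * R) (P : R * R -> Prop) :
  locally p P -> locally (fst p) (fun t => P (t, snd p)) /\ locally (snd p) (fun t => P (fst p, t)).
Proof.
  intros H. apply locally_box in H as (d & Hd & H).
  split; exists (mkposreal d Hd); intros t Ht; apply H;
    try exact Ht; rewrite Rminus_diag, Rabs_R0; exact Hd.
Qed.

Lemma partial_ext_loc (f g : R * R -> R) (p : R * R) :
  locally p (fun z => f z = g z) -> partial_x f p = partial_x g p /\ partial_y f p = partial_y g p.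
Proof.
  intros H. apply locally_slices in H as [H1 H2].
  split; apply Derive_ext_loc; assumption.
Qed.

Lemma locally_comp (g1 g2 : R * R -> R) (p : R * R) (P : R * R -> Prop) :
  analytic_at g1 p -> analytic_at g2 p -> locally (g1 p, g2 p) P ->
  locally p (fun z => P (g1 z, g2 z)).
Proof.
  intros H1 H2 H. apply locally_box in H as (d & Hd & H). simpl in H.
  apply analytic_continuous in H1. apply analytic_continuous in H2.
  apply (proj1 (filterlim_locally _ _)) with (eps := mkposreal d Hd) in H1.
  apply (proj1 (filterlim_locally _ _)) with (eps := mkposreal d Hd) in H2.
  generalize (filter_and _ _ H1 H2); apply filter_imp.
  intros z [Z1 Z2]; apply H; assumption.
Qed.

Lemma analytic_nonzero_locally (f : R * R -> R) (p : R * R) :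
  analytic_at f p -> f p <> 0 -> locally p (fun z => f z <> 0).
Proof.
  intros Hf H0. apply analytic_continuous in Hf.
  assert (Hp : 0 < Rabs (f p)) by (apply Rabs_pos_lt; exact H0).
  apply (proj1 (filterlim_locally _ _)) with (eps := mkposreal _ Hp) in Hf.
  revert Hf; apply filter_imp. intros z Hz E.
  change (Rabs (f z - f p) < Rabs (f p)) in Hz.
  rewrite E, Rminus_0_l, Rabs_Ropp in Hz. lra.
Qed.

(** * The implicit function theorem and flows *)

Lemma coef01_is_derive (r M l : R) (a : nat -> nat -> R) :
  0 < r -> abs_bd (fun i j => a i j * r ^ i * r ^ j) M ->
  is_derive (fun t => dsum (fun i j => a i j * 0 ^ i * t ^ j)) 0 l -> a 0%nat 1%nat = l.
Proof.
  intros Hr Ha Hd.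
  apply is_derive_unique in Hd. rewrite <- Hd. symmetry. apply is_derive_unique.
  apply is_derive_ext with (PSeries (a 0%nat)).
  { intros t; symmetry; apply dsum_xpow0. }
  replace (a 0%nat 1%nat) with (PSeries (PS_derive (a 0%nat)) 0).
  2:{ rewrite PSeries_0. unfold PS_derive; simpl; ring. }
  apply is_derive_PSeries. rewrite Rabs_R0.
  apply Rbar_lt_le_trans with r; [exact Hr |].
  apply ex_series_CV_radius; [lra |].
  eapply ex_series_ext, (abs_bd1_ex _ M), (abs_bd_row _ _ 0 Ha).
  intros j; simpl; ring.
Qed.

(** The estimate in the algebra is applied to constant functions on the bidisc of radius one. *)
Lemma lipschitz_pointwise (R0 M N q : R) (a : nat -> nat -> R) (F : R -> R -> R) (s y1 y2 : R) :
  N < R0 ->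
  (forall s t, Rabs s < R0 -> Rabs t < R0 -> F s t = dsum (fun i j => a i j * s ^ i * t ^ j)) ->
  abs_bd (fun i j => a i j * R0 ^ i * R0 ^ j) M ->
  abs_bd (fun i j => a i j * N ^ i * (INR j * N ^ pred j)) q ->
  Rabs s <= N -> Rabs y1 <= N -> Rabs y2 <= N ->
  Rabs (F s y1 - F s y2) <= q * Rabs (y1 - y2).
Proof.
  intros HN HF Ha Hq Hs H1 H2.
  assert (Hc : forall c, Rabs c <= N -> anorm_le 1 N (fun _ _ => c))
    by (intros c Hc; apply anorm_weaken with (1 := Hc), anorm_const).
  apply (anorm_bound 1 _ (fun _ _ => F s y1 - F s y2) 0 0).
  - apply (anorm_lipschitz R0 1 M N q _ a F (fun _ _ => y1) (fun _ _ => y2) (fun _ _ => s));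
      auto; [lra | apply anorm_const].
  - rewrite Rabs_R0; lra.
  - rewrite Rabs_R0; lra.
Qed.

(* Solves [t = h (s, Y)] as the fixed point of [Y = t / b + (Y - h (s, Y) / b)], whose
   right-hand side has small derivative in [Y] near the base point. *)
Lemma implicit_function (h : R * R -> R) (p : R * R) :
  analytic_at h p -> partial_y h p <> 0 ->
  exists k, analytic_at k (fst p, h p) /\ k (fst p, h p) = snd p /\
    locally (fst p, h p) (fun w => h (fst w, k w) = snd w) /\
    locally p (fun z => k (fst z, h z) = snd z).
Proof.
  intros Hh Hb. set (b := partial_y h p) in *.
  set (F := fun s t => h (fst p + s, snd p + t) - h p).
  set (G := fun s t => t + - / b * F s t).
  assert (F00 : F 0 0 = 0) by (unfold F; rewrite !Rplus_0_r; destruct p; simpl; ring).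
  assert (HG : exists R0 M, 0 < R0 /\ anorm_le R0 M G).
  { apply analytic_at_iff in Hh as (R0 & M & HR & Hh). exists R0. eexists. split; [exact HR |].
    exact (anorm_plus _ _ _ _ _ (anorm_snd R0 (Rlt_le _ _ HR))
             (anorm_scal (- / b) _ _ _ (anorm_plus _ _ _ _ _ Hh (anorm_const R0 (- h p))))). }
  destruct HG as (R0 & M & HR & HG). assert (HM := anorm_nonneg _ _ _ HG).
  destruct HG as (a & Ha & HGa).
  assert (HG : anorm_le R0 M G) by (exists a; auto).
  assert (a01 : a 0%nat 1%nat = 0).
  { apply (coef01_is_derive R0 M); auto.
    apply is_derive_ext_loc with (fun t => G 0 t).
    - exists (mkposreal R0 HR). intros t Ht.
      apply HGa; [rewrite Rabs_R0; exact HR |].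
      change (Rabs (t - 0) < R0) in Ht. now rewrite Rminus_0_r in Ht.
    - assert (HF : is_derive (F 0) 0 b).
      { apply is_derive_ext with (fun t => h (fst p, snd p + t) + - h p).
        { intros t; unfold F; rewrite Rplus_0_r; reflexivity. }
        replace b with (scal 1 b + 0) by (unfold scal; simpl; unfold mult; simpl; ring).
        apply (is_derive_plus (fun t => h (fst p, snd p + t)) (fun _ => - h p));
          [| exact (is_derive_const (- h p) 0)].
        apply (is_derive_comp (fun y => h (fst p, y)) (fun t => snd p + t)).
        + rewrite Rplus_0_r. apply (analytic_partial_y h p Hh).
        + auto_derive; [exact I | ring]. }
      assert (E : 1 + - / b * b = 0) by (field; exact Hb).
      rewrite <- E at 2.
      exact (is_derive_plus (fun t => t) (fun t => - / b * F 0 t) 0 1 _ (is_derive_id 0)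
               (is_derive_scal (F 0) 0 (- / b) b HF)). }
  (* Chosen so that [q * (M / R0) <= 1 / 2]: this makes [G] contracting in its second variable at
     radius [N = q * (R0 / 2)]. *)
  set (q := / (2 * (M / R0) + 1)).
  assert (HMR : 0 <= M / R0) by (apply Rdiv_le_0_compat; lra).
  assert (Hq : 0 < q <= 1).
  { unfold q; split; [apply Rinv_0_lt_compat; lra |].
    rewrite <- Rinv_1 at 2; apply Rinv_le_contravar; lra. }
  assert (Hq2 : q * (M / R0) <= 1 / 2).
  { unfold q. apply (Rmult_le_reg_l (2 * (M / R0) + 1)); [lra |].
    rewrite <- Rmult_assoc, Rinv_r by lra. lra. }
  set (N := q * (R0 / 2)).
  assert (HN : 0 < N < R0) by (unfold N; nra).
  assert (HL := abs_bd_tderiv R0 M q a HR (conj (Rlt_le _ _ (proj1 Hq)) (proj2 Hq)) Ha (or_intror a01)).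
  fold N in HL.
  (* [t - F / b] contracts with ratio one half, so [F] is injective in its second variable. This
     yields the value of [k] at the base point and the left inverse identity. *)
  assert (Huniq : forall s y1 y2, Rabs s <= N -> Rabs y1 <= N -> Rabs y2 <= N ->
            F s y1 = F s y2 -> y1 = y2).
  { intros s y1 y2 Hs H1 H2 E.
    assert (H := lipschitz_pointwise R0 M N _ a G s y1 y2 (proj2 HN) HGa Ha HL Hs H1 H2).
    unfold G in H. rewrite E in H.
    replace (y1 + - / b * F s y2 - (y2 + - / b * F s y2)) with (y1 - y2) in H by ring.
    apply Rminus_diag_uniq. destruct (Req_dec (y1 - y2) 0) as [|Hne]; [assumption |].
    apply Rabs_pos_lt in Hne. nra. }
  (* With [r = c * R0] and [c * D <= N / 2], this sum ensures both that the image of zero has norm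
     at most [N / 2] and that [r <= N]. *)
  set (D := R0 * Rabs (/ b) + M + R0 + 1).
  assert (HD : 1 <= D /\ R0 * Rabs (/ b) + M <= D /\ R0 <= D).
  { assert (0 <= R0 * Rabs (/ b)) by (apply Rmult_le_pos; [lra | apply Rabs_pos]).
    unfold D; lra. }
  set (c := Rmin 1 (N / 2 / D)).
  assert (Hc : 0 < c <= 1).
  { split; [apply Rmin_glb_lt; [lra | apply Rdiv_lt_0_compat; lra] | apply Rmin_l]. }
  assert (HcD : c * D <= N / 2).
  { apply Rle_trans with (N / 2 / D * D); [apply Rmult_le_compat_r; [lra | apply Rmin_r] |].
    apply Req_le; field; lra. }
  set (r := c * R0).
  assert (Hr : 0 < r) by (unfold r; nra).
  assert (HrN : r <= N) by (unfold r; nra).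
  destruct (anorm_fixpoint r N (fun Y s t => / b * t + G s (Y s t))) as (Y & HY & EY).
  { lra. }
  { apply anorm_weaken with (Rabs (/ b) * r + c * M).
    - unfold r. nra.
    - apply (anorm_plus r _ _ (fun _ t => / b * t) (fun s _ => G s 0)).
      + apply (anorm_scal (/ b) r r (fun _ t => t)), anorm_snd; lra.
      + apply anorm_small; [exact HR | lra | |].
        * apply (anorm_comp R0 R0 M R0 (Rabs 0) G (fun s _ => s) (fun _ _ => 0)); auto; try lra.
          -- rewrite Rabs_R0; lra.
          -- intros; rewrite Rabs_R0; lra.
          -- apply anorm_fst; lra.
          -- apply anorm_const.
        * unfold G. rewrite F00; ring. }
  { intros u v P Hu Hv Hd.
    apply anorm_ext with (fun s t => G s (u s t) - G s (v s t)); [intros; ring |].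
    assert (HP := anorm_nonneg _ _ _ Hd).
    apply anorm_weaken with (q * (M / R0) * P); [nra |].
    apply (anorm_lipschitz R0 r M N _ P a G u v (fun s _ => s)); auto; try lra.
    apply anorm_weaken with r; [lra | apply anorm_fst; lra]. }
  assert (EF : forall s t, Rabs s < r -> Rabs t < r -> F s (Y s t) = t /\ Rabs (Y s t) <= N).
  { intros s t Hs Ht. split; [| apply (anorm_bound r N Y); auto].
    specialize (EY s t Hs Ht). unfold G in EY.
    assert (E : / b * (t - F s (Y s t)) = 0) by lra.
    apply Rmult_integral in E as [E|E]; [| lra].
    apply Rinv_neq_0_compat in Hb; contradiction. }
  assert (R00 : Rabs 0 < r) by (rewrite Rabs_R0; lra).
  exists (fun w => snd p + Y (fst w - fst p) (snd w - h p)).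
  split; [| split; [| split]].
  - apply analytic_at_iff. exists r, (Rabs (snd p) + N). split; [exact Hr |].
    apply (anorm_ext r _ (fun s t => snd p + Y s t)).
    + intros s t _ _; simpl. f_equal; f_equal; ring.
    + apply (anorm_plus r _ _ (fun _ _ => snd p)); [apply anorm_const | exact HY].
  - simpl. rewrite !Rminus_diag.
    destruct (EF 0 0 R00 R00) as [E1 E2].
    rewrite (Huniq 0 (Y 0 0) 0); try rewrite E1; try rewrite Rabs_R0; auto; lra.
  - apply locally_box. exists r; split; [exact Hr |]. simpl. intros x w Hx Hw.
    destruct (EF _ _ Hx Hw) as [E _]. unfold F in E.
    replace (fst p + (x - fst p)) with x in E by ring. lra.
  - assert (Hcont : locally p (fun z => Rabs (h z - h p) < r)).
    { apply analytic_continuous in Hh.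
      apply (proj1 (filterlim_locally _ _)) with (eps := mkposreal r Hr) in Hh. exact Hh. }
    assert (Hbox : locally p (fun z => Rabs (fst z - fst p) < r /\ Rabs (snd z - snd p) < r))
      by (apply locally_box; exists r; split; [exact Hr |]; intros; split; assumption).
    revert Hcont Hbox; apply locally_imp2. simpl; intros x y Hw [Hx Hy].
    destruct (EF _ _ Hx Hw) as [E1 E2].
    change (snd p + Y (x - fst p) (h (x, y) - h p) = y).
    rewrite (Huniq (x - fst p) (Y (x - fst p) (h (x, y) - h p)) (y - snd p)); [ring | | exact E2 | |]; try lra.
    transitivity (h (x, y) - h p); [exact E1 |].
    unfold F. apply f_equal2; [apply f_equal, f_equal2; unfold Rminus; ring | reflexivity].
Qed.

(** The Picard operator is [Y -> t + int_0^s F (x, Y (x, t)) dx]. The initial value [t] is the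
    second variable of the series, so analytic dependence on it comes with the fixed point. *)
Lemma analytic_flow (g : R * R -> R) (p : R * R) :
  analytic_at g p ->
  exists Y, analytic_at Y p /\
    locally p (fun z => Y (fst p, snd z) = snd z) /\
    locally p (fun z => is_derive (fun t => Y (t, snd z)) (fst z) (g (fst z, Y z))).
Proof.
  intros Hg. apply analytic_at_iff in Hg as (R0 & M & HR & HF).
  set (F := fun s t => g (fst p + s, snd p + t)) in *.
  assert (HM := anorm_nonneg _ _ _ HF).
  destruct HF as (a & Ha & HFa).
  assert (HF : anorm_le R0 M F) by (exists a; auto).
  assert (HL := abs_bd_tderiv R0 M 1 a HR (conj Rle_0_1 (Rle_refl 1)) Ha (or_introl eq_refl)).
  rewrite !Rmult_1_l in HL. set (N := R0 / 2) in *.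
  assert (HMR : 0 <= M / R0) by (apply Rdiv_le_0_compat; lra).
  assert (HN : 0 < N < R0) by (unfold N; lra).
  (* From [r * D = Rmin N 1] follow the contraction ratio [r * (M / R0) <= 1 / 2] and the bound
     [r + r * M <= N / 2] on the image of zero. *)
  set (D := 2 * (M / R0) + 2 + 2 * M).
  assert (HD : 0 < D) by (unfold D; lra).
  set (r := Rmin N 1 / D).
  assert (Hm : 0 < Rmin N 1) by (apply Rmin_glb_lt; lra).
  assert (HrD : r * D = Rmin N 1) by (unfold r; field; lra).
  assert (Hr : 0 < r) by (apply Rdiv_lt_0_compat; lra).
  generalize (Rmin_l N 1) (Rmin_r N 1); intros Hm1 Hm2.
  assert (Hr1 : r * (M / R0) <= 1 / 2) by (unfold D in HrD; nra).
  assert (Hr2 : r + r * M <= N / 2) by (unfold D in HrD; nra).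
  assert (HrN : r <= N / 2) by nra.
  assert (Hcomp : forall u, anorm_le r N u -> anorm_le r M (fun s t => F s (u s t))).
  { intros u Hu. apply (anorm_comp R0 r M r N F (fun s _ => s) u); auto; try lra.
    - intros s t Hs Ht. apply (anorm_bound r N u s t) in Hu; auto. lra.
    - apply anorm_fst; lra. }
  destruct (anorm_fixpoint r N (fun Y s t => t + RInt (fun x => F x (Y x t)) 0 s)) as (Y & HY & EY).
  { lra. }
  { apply anorm_weaken with (r + r * M); [lra |].
    apply (anorm_plus r _ _ (fun _ t => t)); [apply anorm_snd; lra |].
    apply (anorm_RInt r M (fun x _ => F x 0)); [lra |].
    apply (Hcomp (fun _ _ => 0)). apply anorm_weaken with (Rabs 0); [rewrite Rabs_R0; lra | apply anorm_const]. }
  { intros u v P Hu Hv Hd. assert (HP := anorm_nonneg _ _ _ Hd).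
    assert (Hr0 : 0 <= r) by lra.
    apply anorm_ext with (fun s t => RInt (fun x => F x (u x t) - F x (v x t)) 0 s).
    - intros s t Hs Ht.
      rewrite (RInt_minus (fun x => F x (u x t)) (fun x => F x (v x t))).
      + unfold minus, plus, opp; simpl; ring.
      + apply (proj2 (anorm_RInt r M _ Hr0 (Hcomp u Hu)) s t Hs Ht).
      + apply (proj2 (anorm_RInt r M _ Hr0 (Hcomp v Hv)) s t Hs Ht).
    - apply anorm_weaken with (r * (M / R0 * P)); [nra |].
      apply (anorm_RInt r _ (fun x t => F x (u x t) - F x (v x t))); [lra |].
      apply (anorm_lipschitz R0 r M N _ P a F u v (fun s _ => s)); auto; try lra.
      apply anorm_weaken with r; [lra | apply anorm_fst; lra]. }
  exists (fun z => snd p + Y (fst z - fst p) (snd z - snd p)).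
  assert (Hbox : locally p (fun z => Rabs (fst z - fst p) < r /\ Rabs (snd z - snd p) < r))
    by (apply locally_box; exists r; split; [exact Hr |]; intros; split; assumption).
  split; [| split].
  - apply analytic_at_iff. exists r, (Rabs (snd p) + N). split; [exact Hr |].
    apply (anorm_ext r _ (fun s t => snd p + Y s t)).
    + intros s t _ _; simpl. f_equal; f_equal; ring.
    + apply (anorm_plus r _ _ (fun _ _ => snd p)); [apply anorm_const | exact HY].
  - revert Hbox; apply locally_imp. simpl; intros x y [_ Hz].
    rewrite Rminus_diag, <- (EY 0 (y - snd p)); [| rewrite Rabs_R0; exact Hr | exact Hz].
    rewrite RInt_point. unfold zero; simpl; ring.
  - revert Hbox; apply locally_imp. simpl; intros x y [Hx Hz].
    set (s := x - fst p) in *. set (t := y - snd p) in *.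
    assert (Hr0 : 0 <= r) by lra.
    destruct (proj2 (anorm_RInt r M _ Hr0 (Hcomp Y HY)) s t Hx Hz) as [_ HI].
    replace (g (x, snd p + Y s t)) with (0 + scal 1 (0 + F s (Y s t)))
      by (unfold F, s, scal; simpl; unfold mult; simpl;
          replace (fst p + (x - fst p)) with x by ring; ring).
    apply (is_derive_plus (fun _ => snd p) (fun v => Y (v - fst p) t)); [exact (is_derive_const (snd p) _) |].
    apply (is_derive_comp (fun v => Y v t) (fun v => v - fst p)).
    + fold s. apply is_derive_ext_loc with (fun s => t + RInt (fun x => F x (Y x t)) 0 s).
      * assert (He : 0 < r - Rabs s) by lra.
        exists (mkposreal _ He). intros x' Hx'. apply EY; [| exact Hz].
        change (Rabs (x' - s) < r - Rabs s) in Hx'.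
        replace x' with ((x' - s) + s) by ring.
        eapply Rle_lt_trans; [apply Rabs_triang | lra].
      * apply (is_derive_plus (fun _ => t)); [exact (is_derive_const t _) | exact HI].
    + auto_derive; [exact I | ring].
Qed.

(** * Rules of calculation for partial derivatives *)

Lemma partial_const (c : R) (p : R * R) : partial_x (fun _ => c) p = 0 /\ partial_y (fun _ => c) p = 0.
Proof. split; [exact (Derive_const c (fst p)) | exact (Derive_const c (snd p))]. Qed.

Lemma partial_plus (f g : R * R -> R) (p : R * R) :
  analytic_at f p -> analytic_at g p ->
  partial_x (fun z => f z + g z) p = partial_x f p + partial_x g p /\
  partial_y (fun z => f z + g z) p = partial_y f p + partial_y g p.
Proof.
  intros Hf Hg. split; apply is_derive_unique.
  - apply (is_derive_plus (fun t => f (t, snd p)) (fun t => g (t, snd p))); now apply analytic_partial_x.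
  - apply (is_derive_plus (fun t => f (fst p, t)) (fun t => g (fst p, t))); now apply analytic_partial_y.
Qed.

Lemma partial_mult (f g : R * R -> R) (p : R * R) :
  analytic_at f p -> analytic_at g p ->
  partial_x (fun z => f z * g z) p = partial_x f p * g p + f p * partial_x g p /\
  partial_y (fun z => f z * g z) p = partial_y f p * g p + f p * partial_y g p.
Proof.
  intros Hf Hg. destruct p as [x y].
  split; apply is_derive_unique.
  - apply (is_derive_mult (fun t => f (t, y)) (fun t => g (t, y)));
      [apply (analytic_partial_x f (x, y) Hf) | apply (analytic_partial_x g (x, y) Hg) | intros; apply Rmult_comm].
  - apply (is_derive_mult (fun t => f (x, t)) (fun t => g (x, t)));
      [apply (analytic_partial_y f (x, y) Hf) | apply (analytic_partial_y g (x, y) Hg) | intros; apply Rmult_comm].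
Qed.

Lemma partial_fst (p : R * R) : partial_x fst p = 1 /\ partial_y fst p = 0.
Proof. split; [exact (Derive_id (fst p)) | exact (Derive_const (fst p) (snd p))]. Qed.

Lemma partial_snd (p : R * R) : partial_x snd p = 0 /\ partial_y snd p = 1.
Proof. split; [exact (Derive_const (snd p) (fst p)) | exact (Derive_id (snd p))]. Qed.

Lemma partial_minus_const (f : R * R -> R) (c : R) (p : R * R) :
  analytic_at f p ->
  partial_x (fun z => f z - c) p = partial_x f p /\ partial_y (fun z => f z - c) p = partial_y f p.
Proof.
  intros Hf. destruct (partial_plus f (fun _ => - c) p Hf (analytic_const _ _)) as [E1 E2].
  destruct (partial_const (- c) p) as [C1 C2].
  unfold Rminus. rewrite E1, E2, C1, C2, !Rplus_0_r. split; reflexivity.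
Qed.

Lemma partial_pow (f : R * R -> R) (k : nat) (p : R * R) :
  analytic_at f p ->
  partial_x (fun z => f z ^ k) p = INR k * f p ^ pred k * partial_x f p /\
  partial_y (fun z => f z ^ k) p = INR k * f p ^ pred k * partial_y f p.
Proof.
  intros Hf; induction k as [|k [IH1 IH2]].
  - destruct (partial_const 1 p) as [E1 E2]; simpl; rewrite E1, E2; lra.
  - destruct (partial_mult f (fun z => f z ^ k) p Hf (analytic_pow _ _ _ Hf)) as [E1 E2].
    change (fun z => f z ^ S k) with (fun z => f z * f z ^ k). rewrite E1, E2, IH1, IH2, S_INR. simpl pred.
    destruct k; simpl; split; ring.
Qed.

(** * Local diffeomorphisms *)

Lemma analytic_vcomp (f : R * R -> R) (phi : R * R -> R * R) (p : R * R) :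
  vanalytic_at phi p -> analytic_at f (phi p) -> analytic_at (fun z => f (phi z)) p.
Proof.
  intros [H1 H2] Hf.
  apply analytic_ext with (fun z => f (fst (phi z), snd (phi z))).
  - intros z; now rewrite <- surjective_pairing.
  - rewrite (surjective_pairing (phi p)) in Hf.
    exact (analytic_comp f (fun z => fst (phi z)) (fun z => snd (phi z)) p Hf H1 H2).
Qed.

Lemma locally_vcomp (phi : R * R -> R * R) (p : R * R) (P : R * R -> Prop) :
  vanalytic_at phi p -> locally (phi p) P -> locally p (fun z => P (phi z)).
Proof.
  intros [H1 H2] HP. rewrite (surjective_pairing (phi p)) in HP.
  generalize (locally_comp _ _ _ _ H1 H2 HP); apply filter_imp.
  intros z; now rewrite <- surjective_pairing.
Qed.

Lemma vanalytic_comp (phi1 phi2 : R * R -> R * R) (p : R * R) :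
  vanalytic_at phi1 p -> vanalytic_at phi2 (phi1 p) -> vanalytic_at (fun z => phi2 (phi1 z)) p.
Proof.
  intros H1 [H2 H3]. split.
  - apply (analytic_vcomp (fun w => fst (phi2 w)) phi1); auto.
  - apply (analytic_vcomp (fun w => snd (phi2 w)) phi1); auto.
Qed.

Lemma local_diffeo_comp (phi1 phi2 : R * R -> R * R) (p q r : R * R) :
  local_diffeo phi1 p q -> local_diffeo phi2 q r -> local_diffeo (fun z => phi2 (phi1 z)) p r.
Proof.
  intros (E1 & A1 & psi1 & F1 & B1 & L1 & M1) (E2 & A2 & psi2 & F2 & B2 & L2 & M2).
  subst q r. split; [reflexivity |]. split; [apply vanalytic_comp; auto |].
  exists (fun w => psi1 (psi2 w)). split; [congruence |]. split; [| split].
  - apply vanalytic_comp; [exact B2 | now rewrite F2].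
  - generalize L1 (locally_vcomp _ _ _ A1 L2). apply locally_imp2.
    intros x y H1 H2; congruence.
  - rewrite <- F2 in M1. generalize M2 (locally_vcomp _ _ _ B2 M1). apply locally_imp2.
    intros x y H1 H2; congruence.
Qed.

(** The chain rule for [psi o phi = id] shows that the determinant is non-zero at [p]; being
    analytic, it stays non-zero nearby. *)
Lemma local_diffeo_jacobian (phi : R * R -> R * R) (p q : R * R) :
  local_diffeo phi p q ->
  locally p (fun z => vanalytic_at phi z /\
    m11 (jacobian phi z) * m22 (jacobian phi z) - m12 (jacobian phi z) * m21 (jacobian phi z) <> 0).
Proof.
  intros (E & A & psi & F & [B1 B2] & L & _). subst q.
  assert (A' := A). destruct A' as [A1 A2].
  assert (HA : locally p (vanalytic_at phi)).
  { generalize (analytic_locally _ _ A1) (analytic_locally _ _ A2).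
    apply locally_imp2; intros x y; split; auto. }
  apply (locally_imp2 _ (vanalytic_at phi)
    (fun z => m11 (jacobian phi z) * m22 (jacobian phi z) - m12 (jacobian phi z) * m21 (jacobian phi z) <> 0));
    [intros; split; auto | exact HA |].
  simpl. destruct (analytic_partial_x _ _ A1) as [X1 _]. destruct (analytic_partial_x _ _ A2) as [X2 _].
  destruct (analytic_partial_y _ _ A1) as [Y1 _]. destruct (analytic_partial_y _ _ A2) as [Y2 _].
  apply (analytic_nonzero_locally (fun z =>
    partial_x (fun w => fst (phi w)) z * partial_y (fun w => snd (phi w)) z -
    partial_y (fun w => fst (phi w)) z * partial_x (fun w => snd (phi w)) z)).
  - apply analytic_minus; apply analytic_mult; assumption.
  - rewrite (surjective_pairing (phi p)) in B1, B2.
    destruct (partial_comp (fun z => fst (psi z)) (fun z => fst (phi z)) (fun z => snd (phi z)) p B1 A1 A2) as [P1 P2].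
    destruct (partial_comp (fun z => snd (psi z)) (fun z => fst (phi z)) (fun z => snd (phi z)) p B2 A1 A2) as [P3 P4].
    assert (Hid : forall i : R * R -> R,
      locally p (fun z => i (psi (fst (phi z), snd (phi z))) = i z)).
    { intros i; revert L; apply locally_imp; intros x y Hxy.
      rewrite <- surjective_pairing; now rewrite Hxy. }
    destruct (partial_ext_loc (fun z => fst (psi (fst (phi z), snd (phi z)))) fst p (Hid fst)) as [I1 I2].
    destruct (partial_ext_loc (fun z => snd (psi (fst (phi z), snd (phi z)))) snd p (Hid snd)) as [I3 I4].
    rewrite P1 in I1. rewrite P2 in I2. rewrite P3 in I3. rewrite P4 in I4.
    destruct (partial_fst p) as [J1 J2]. destruct (partial_snd p) as [J3 J4].
    rewrite J1 in I1. rewrite J2 in I2. rewrite J3 in I3. rewrite J4 in I4.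
    set (a := partial_x (fun w => fst (phi w)) p) in *. set (b := partial_y (fun w => fst (phi w)) p) in *.
    set (c := partial_x (fun w => snd (phi w)) p) in *. set (d := partial_y (fun w => snd (phi w)) p) in *.
    set (a' := partial_x (fun w => fst (psi w)) _) in *. set (b' := partial_y (fun w => fst (psi w)) _) in *.
    set (c' := partial_x (fun w => snd (psi w)) _) in *. set (d' := partial_y (fun w => snd (psi w)) _) in *.
    intros Hd.
    assert (Hprod : (a' * d' - b' * c') * (a * d - b * c) = 1).
    { replace ((a' * d' - b' * c') * (a * d - b * c))
        with ((a' * a + b' * c) * (c' * b + d' * d) - (a' * b + b' * d) * (c' * a + d' * c)) by ring.
      rewrite I1, I2, I3, I4; ring. }
    rewrite Hd in Hprod; lra.
Qed.

(** As the first coordinate is kept, inversion amounts to a single implicit equation. *)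
Lemma shear_local_diffeo (h : R * R -> R) :
  analytic_at h (0, 0) -> h (0, 0) = 0 -> partial_y h (0, 0) <> 0 ->
  local_diffeo (fun z => (fst z, h z)) (0, 0) (0, 0).
Proof.
  intros Hh H0 Hy. destruct (implicit_function h (0, 0) Hh Hy) as (k & Hk & K0 & K1 & K2).
  simpl in *. rewrite H0 in *.
  split; [now rewrite H0 |]. split; [split; [apply analytic_fst | exact Hh] |].
  exists (fun w => (fst w, k w)). split; [now rewrite K0 |].
  split; [split; [apply analytic_fst | exact Hk] |]. split.
  - revert K2; apply locally_imp; simpl; intros x y E; now rewrite E.
  - revert K1; apply locally_imp; simpl; intros x y E; now rewrite E.
Qed.

Lemma swap_local_diffeo (p : R * R) : local_diffeo swap p (swap p).
Proof.
  split; [reflexivity |]. split; [split; [apply analytic_snd | apply analytic_fst] |].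
  exists swap. split; [now destruct p |]. split; [split; [apply analytic_snd | apply analytic_fst] |].
  split; apply filter_forall; now intros [x y].
Qed.

(* The reciprocal of [t] solves [t w = 1], to which the implicit function theorem applies. *)
Lemma analytic_inv (f : R * R -> R) (p : R * R) :
  analytic_at f p -> f p <> 0 -> analytic_at (fun z => / f z) p.
Proof.
  intros Hf H0.
  destruct (implicit_function (fun z => fst z * snd z) (f p, / f p)) as (k & Hk & _ & K1 & _).
  - apply analytic_mult; [apply analytic_fst | apply analytic_snd].
  - destruct (partial_mult fst snd (f p, / f p) (analytic_fst _) (analytic_snd _)) as [_ ->].
    destruct (partial_fst (f p, / f p)) as [_ ->]. destruct (partial_snd (f p, / f p)) as [_ ->].
    simpl; lra.
  - simpl in *. rewrite Rinv_r in * by exact H0.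
    apply analytic_ext_loc with (fun z => k (f z, 1)).
    + generalize (locally_comp f (fun _ => 1) p _ Hf (analytic_const 1 p) K1).
      apply locally_imp; simpl; intros x y E.
      assert (f (x, y) <> 0) by (intros E0; rewrite E0 in E; lra).
      apply (Rmult_eq_reg_l (f (x, y))); [rewrite E; field; assumption | assumption].
    + apply (analytic_comp k f (fun _ => 1)); auto. apply analytic_const.
Qed.

(** * Roots and order of vanishing *)

(** The equation [y^k = t] is solved near the positive root [w0] of [f p]; the first variable is a
    dummy, set to [0]. The branch is a function [g] of the value of [f], so that it can later be
    composed with a single coordinate. *)
Lemma analytic_root (f : R * R -> R) (k : nat) (p : R * R) :
  (1 <= k)%nat -> analytic_at f p -> 0 < f p ->
  exists g, analytic_at (fun z => g (f z)) p /\ g (f p) <> 0 /\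
    locally p (fun z => g (f z) ^ k = f z).
Proof.
  intros Hk Hf H0.
  assert (HkR : 0 < INR k) by (apply lt_0_INR; lia).
  set (w0 := Rpower (f p) (/ INR k)).
  assert (Hw : 0 < w0) by apply exp_pos.
  assert (Ew : w0 ^ k = f p).
  { rewrite <- Rpower_pow by exact Hw. unfold w0.
    rewrite Rpower_mult, Rinv_l, Rpower_1; lra. }
  destruct (implicit_function (fun z => snd z ^ k) (0, w0)) as (g & Hg & G0 & G1 & _).
  - apply analytic_pow, analytic_snd.
  - destruct (partial_pow snd k (0, w0) (analytic_snd _)) as [_ ->].
    destruct (partial_snd (0, w0)) as [_ ->].
    apply Rmult_integral_contrapositive_currified; [| lra].
    apply Rmult_integral_contrapositive_currified; [lra | apply pow_nonzero; simpl; lra].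
  - simpl in *. rewrite Ew in *.
    exists (fun t => g (0, t)). split; [| split].
    + apply (analytic_comp g (fun _ => 0) f); auto. apply analytic_const.
    + rewrite G0; lra.
    + exact (locally_comp (fun _ => 0) f p _ (analytic_const 0 p) Hf G1).
Qed.

Lemma zero_partial_x_constant (f : R * R -> R) (p : R * R) :
  analytic_at f p -> locally p (fun z => partial_x f z = 0) ->
  locally p (fun z => f z = f (fst p, snd z)).
Proof.
  intros Hf H0.
  assert (HD : locally p (fun z => is_derive (fun t => f (t, snd z)) (fst z) 0)).
  { generalize (analytic_locally _ _ Hf) H0. apply locally_imp2; intros x y H1 H2.
    rewrite <- H2. now apply analytic_partial_x. }
  apply locally_box in HD as (d & Hd & HD).
  apply locally_box. exists d; split; [exact Hd |]. simpl in *. intros x y Hx Hy.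
  assert (Hp : forall t, Rmin x (fst p) <= t <= Rmax x (fst p) -> is_derive (fun t => f (t, y)) t 0).
  { intros t Ht; apply (HD t y); [| exact Hy].
    apply Rabs_def2 in Hx. apply Rabs_def1; revert Ht; unfold Rmin, Rmax; destruct (Rle_dec x (fst p)); lra. }
  destruct (Rtotal_order x (fst p)) as [Hlt | [-> | Hlt]]; [| reflexivity |].
  - apply (eq_is_derive (fun t => f (t, y)) x (fst p)); [| exact Hlt].
    intros t Ht; apply Hp. rewrite Rmin_left, Rmax_right; lra.
  - symmetry. apply (eq_is_derive (fun t => f (t, y)) (fst p) x); [| exact Hlt].
    intros t Ht; apply Hp. rewrite Rmin_right, Rmax_left; lra.
Qed.

Lemma anorm_pseries_snd (r M : R) (c : nat -> R) :
  0 <= r -> abs_bd1 (fun j => c j * r ^ j) M -> anorm_le r M (fun _ t => Series (fun j => c j * t ^ j)).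
Proof.
  intros Hr Hc. apply (anorm_series r M (fun j => Rabs (c j * r ^ j))); [| exact Hc].
  intros j. rewrite Rabs_mult, <- RPow_abs, (Rabs_pos_eq r Hr).
  apply (anorm_scal (c j) r (r ^ j) (fun _ t => t ^ j)), anorm_pow; [exact Hr | apply anorm_snd, Hr].
Qed.

Lemma sum_n_drop (u : nat -> R) (m n : nat) :
  (forall j, 0 <= u j) -> sum_n (fun j => u (m + j)%nat) n <= sum_n u (m + n).
Proof.
  revert u; induction m; intros u Hu; [apply Rle_refl |].
  change (S m + n)%nat with (S (m + n)). rewrite (sum_n_shift u (m + n)).
  specialize (IHm (fun j => u (S j)) (fun j => Hu (S j))). specialize (Hu 0%nat). simpl in *; lra.
Qed.

(** Functions of one variable are viewed as functions on the plane independent of [x], which keeps a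
    single notion of analyticity; their coefficients form row [0] of the double series. The order
    [m] is the least positive index with a non-zero coefficient, found by classical reasoning. *)
Lemma analytic_order (D : R -> R) :
  analytic_at (fun z => D (snd z)) (0, 0) ->
  locally (0, 0) (fun z : R * R => D (snd z) = D 0) \/
  exists m w, (1 <= m)%nat /\ analytic_at (fun z => w (snd z)) (0, 0) /\ w 0 <> 0 /\
    locally (0, 0) (fun z : R * R => D (snd z) = D 0 + snd z ^ m * w (snd z)).
Proof.
  intros HD. apply analytic_at_iff in HD as (r & M & Hr & a & Ha & HD). simpl in HD.
  assert (Ht : forall t, Rabs t < r -> D t = Series (fun j => a 0%nat j * t ^ j)).
  { intros t Ht. rewrite <- dsum_xpow0, <- HD; [f_equal; ring | rewrite Rabs_R0; exact Hr | exact Ht]. }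
  assert (Hrow : abs_bd1 (fun j => a 0%nat j * r ^ j) M).
  { eapply abs_bd1_le, (abs_bd_row _ _ 0 Ha). intros j; simpl; rewrite Rmult_1_r; lra. }
  assert (Hex : forall t, Rabs t < r -> ex_series (fun j => a 0%nat j * t ^ j)).
  { intros t Hlt. eapply abs_bd1_ex, abs_bd1_le, Hrow. intros j; simpl.
    rewrite !Rabs_mult. apply Rmult_le_compat_l; [apply Rabs_pos |].
    rewrite <- !RPow_abs. apply pow_incr. split; [apply Rabs_pos |].
    rewrite (Rabs_pos_eq r); lra. }
  assert (Hloc : forall P : R -> Prop, (forall t, Rabs t < r -> P t) -> locally (0, 0) (fun z : R * R => P (snd z))).
  { intros P HP. apply locally_box. exists r; split; [exact Hr |]. simpl; intros x y _ Hy.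
    apply HP. now rewrite Rminus_0_r in Hy. }
  assert (Hsplit : forall m t, (1 <= m)%nat -> (forall j, (1 <= j < m)%nat -> a 0%nat j = 0) -> Rabs t < r ->
    D t = a 0%nat 0%nat + t ^ m * Series (fun j => a 0%nat (m + j)%nat * t ^ j)).
  { intros m t Hm Hz Hlt. rewrite Ht, (Series_incr_n _ m) by (auto; lia).
    rewrite <- sum_n_Reals.
    rewrite (sum_n_ext_loc _ (fun j => match j with O => a 0%nat 0%nat | _ => 0 end)).
    - rewrite (sum_n_single _ _ 0); [| intros [|i]; congruence | lia].
      rewrite <- Series_scal_l. f_equal. apply Series_ext; intros j. rewrite pow_add; ring.
    - intros [|j] Hj; [apply Rmult_1_r |]. rewrite Hz by lia. apply Rmult_0_l. }
  assert (H0 : D 0 = a 0%nat 0%nat).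
  { assert (R00 : Rabs 0 < r) by (rewrite Rabs_R0; exact Hr).
    rewrite (Hsplit 1%nat 0); [ring | lia | intros; lia | exact R00]. }
  destruct (classic (exists m, (1 <= m)%nat /\ a 0%nat m <> 0)) as [Hne | Hall].
  - right.
    destruct (dec_inh_nat_subset_has_unique_least_element _ (fun n => classic _) Hne)
      as (m & [[Hm Ham] Hmin] & _).
    exists m, (fun t => Series (fun j => a 0%nat (m + j)%nat * t ^ j)).
    split; [exact Hm |]. split; [| split].
    + apply analytic_at_iff. exists r, (Rabs (/ r ^ m) * M). split; [exact Hr |].
      apply (anorm_ext r _ (fun _ t => Series (fun j => a 0%nat (m + j)%nat * t ^ j))).
      { intros s t _ _; simpl. apply Series_ext; intros; now rewrite Rplus_0_l. }
      apply anorm_pseries_snd; [lra |]. intros n.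
      rewrite (sum_n_eq _ (fun j => Rabs (/ r ^ m) * Rabs (a 0%nat (m + j)%nat * r ^ (m + j)))).
      * rewrite sum_n_scal. apply Rmult_le_compat_l; [apply Rabs_pos |].
        eapply Rle_trans; [| apply (Hrow (m + n)%nat)].
        apply (sum_n_drop (fun j => Rabs (a 0%nat j * r ^ j))). intros; apply Rabs_pos.
      * intros j. rewrite <- Rabs_mult. f_equal. rewrite pow_add. field. apply pow_nonzero; lra.
    + rewrite (Series_stationary _ 0 (a 0%nat m)); [exact Ham |].
      intros n _. rewrite (sum_n_single _ n 0); [rewrite Nat.add_0_r; simpl; ring | | lia].
      intros j Hj; rewrite pow_ne_zero by exact Hj; ring.
    + apply (Hloc (fun t => D t = D 0 + t ^ m * Series (fun j => a 0%nat (m + j)%nat * t ^ j))). intros t Hlt. rewrite H0. apply Hsplit; auto.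
      intros j Hj. apply NNPP; intros Hnz. specialize (Hmin j (conj (proj1 Hj) Hnz)). lia.
  - left. apply (Hloc (fun t => D t = D 0)). intros t Hlt.
    assert (Hz : forall j, (1 <= j)%nat -> a 0%nat j = 0)
      by (intros j Hj; apply NNPP; intros Hnz; apply Hall; exists j; auto).
    rewrite (Hsplit 1%nat t), H0; [| lia | intros; lia | exact Hlt].
    rewrite (Series_stationary _ 0 0); [ring |].
    intros n _. rewrite (sum_n_eq _ (fun _ => 0)); [rewrite sum_n_const; apply Rmult_0_r |].
    intros j. rewrite Hz by lia. ring.
Qed.

(** * Coordinates adapted to a vector field *)

(* With [g = e_y / e_x] the curves [x -> (x, Y (x, s))] are the integral curves of [e]; the
   new coordinates are [lam] and the label [s] of the curve. *)
Lemma rectify_transversal (e : R * R -> R * R) (lam : R * R -> R) (p : R * R) :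
  vanalytic_at e p -> analytic_at lam p ->
  locally p (fun z => vderiv e lam z = 1) -> fst (e p) <> 0 ->
  exists u, local_diffeo (fun z => (lam z - lam p, u z)) p (0, 0) /\
    locally p (fun z => vderiv e u z = 0) /\
    forall delta, analytic_at delta p -> locally p (fun z => vderiv e delta z = 0) ->
      exists D, analytic_at (fun z => D (snd z)) (0, 0) /\ locally p (fun z => delta z = D (u z)).
Proof.
  intros [He1 He2] Hlam Hel Hne.
  set (g := fun z => snd (e z) * / fst (e z)).
  assert (Hg : analytic_at g p).
  { apply analytic_mult; [exact He2 | apply (analytic_inv (fun z => fst (e z))); assumption]. }
  assert (Hvg : locally p (fun z => forall f, vderiv e f z = fst (e z) * (partial_x f z + partial_y f z * g z)
                                  /\ fst (e z) <> 0)).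
  { generalize (analytic_nonzero_locally _ _ He1 Hne). apply locally_imp; intros x y H f.
    unfold vderiv, g. split; [field; exact H | exact H]. }
  destruct (analytic_flow g p Hg) as (Y & HY & Y0 & Y1).
  assert (EYp : Y p = snd p) by (apply locally_at in Y0; destruct p; exact Y0).
  assert (HYy : partial_y Y p = 1).
  { destruct (locally_slices _ _ Y0) as [_ L]. unfold partial_y.
    rewrite (Derive_ext_loc _ (fun t => t)); [apply Derive_id | exact L]. }
  destruct (implicit_function Y p HY) as (k & Hk & Ekp & K1 & K2); [rewrite HYy; lra |].
  (* [T] sends [(x, s)] to the point of abscissa [x] on the integral curve labelled [s]; [K] is its
     inverse, so [k] reads off the label of a point. *)
  set (T := fun z => (fst z, Y z)). set (K := fun z => (fst z, k z)).
  rewrite EYp, <- surjective_pairing in Hk, Ekp, K1.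
  assert (HT : vanalytic_at T p) by (split; [apply analytic_fst | exact HY]).
  assert (HK : vanalytic_at K p) by (split; [apply analytic_fst | exact Hk]).
  assert (ETp : T p = p) by (unfold T; rewrite EYp; now destruct p).
  assert (EKp : K p = p) by (unfold K; rewrite Ekp; now destruct p).
  assert (TK : locally p (fun z => T (K z) = z)).
  { revert K1; apply locally_imp; simpl; intros x y E. unfold T, K; simpl. now rewrite E. }
  assert (PT : forall P, locally p P -> locally p (fun z => P (T z)))
    by (intros P HP; apply locally_vcomp; [exact HT | now rewrite ETp]).
  assert (PK : forall P, locally p P -> locally p (fun z => P (K z)))
    by (intros P HP; apply locally_vcomp; [exact HK | now rewrite EKp]).
  (* The [x]-derivative of [f o T] is the derivative of [f] along an integral curve, that is [e f]
     divided by the first component of [e]. *)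
  assert (Hchain : forall f, analytic_at f p -> locally p (fun z =>
     partial_x (fun w => f (T w)) z = partial_x f (T z) + partial_y f (T z) * g (T z))).
  { intros f Hf.
    generalize (filter_and _ _ (PT _ (analytic_locally _ _ Hf)) (analytic_locally _ _ HY)) Y1.
    apply locally_imp2. intros x y [Hf' HY'] HD.
    destruct (partial_comp f fst Y (x, y) Hf' (analytic_fst _) HY') as [E _].
    unfold T; simpl fst. rewrite E. destruct (partial_fst (x, y)) as [-> _].
    assert (E1 : partial_x Y (x, y) = g (x, Y (x, y))) by (apply is_derive_unique, HD).
    rewrite E1; simpl; ring. }
  assert (Hek : locally p (fun z => partial_x k z + partial_y k z * g z = 0)).
  { assert (HQ : locally p (fun z => partial_x k (T z) + partial_y k (T z) * g (T z) = 0)).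
    { generalize (Hchain k Hk) (locally_locally _ _ K2). apply locally_imp2.
      intros x y E L. rewrite <- E.
      transitivity (partial_x snd (x, y)); [exact (proj1 (partial_ext_loc _ snd (x, y) L)) |].
      apply partial_snd. }
    generalize (PK _ HQ) TK. apply locally_imp2. intros x y H E. now rewrite E in H. }
  (* Since [e lam = 1], the function [lam] has non-zero derivative along the curves and can replace
     the abscissa: [m (s, l)] is the abscissa at which [lam] takes the value [l] on the curve [s].
     The exchange of axes puts the abscissa in the place that [implicit_function] solves for. *)
  assert (Hm : exists m, analytic_at m (snd p, lam p) /\ m (snd p, lam p) = fst p /\
     locally (snd p, lam p) (fun w => lam (T (m w, fst w)) = snd w) /\
     locally (swap p) (fun z => m (fst z, lam (T (swap z))) = snd z)).
  { assert (HlT : analytic_at (fun z => lam (T z)) p)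
      by (apply analytic_vcomp; [exact HT | now rewrite ETp]).
    destruct (implicit_function (fun z => lam (T (swap z))) (swap p)) as (m & Hm1 & Hm2 & Hm3 & Hm4).
    - apply (analytic_swap (fun z => lam (T z))). destruct p; exact HlT.
    - change (partial_x (fun z => lam (T z)) (swap (swap p)) <> 0).
      replace (swap (swap p)) with p by now destruct p.
      rewrite (locally_at _ _ (Hchain lam Hlam)), ETp. intros E0.
      destruct (locally_at _ _ Hvg lam) as [E1 _].
      rewrite (locally_at _ _ Hel), E0 in E1. lra.
    - replace (swap (swap p)) with p in * by now destruct p.
      rewrite ETp in *. exists m. split; [exact Hm1 |]. split; [exact Hm2 |]. split; [exact Hm3 | exact Hm4]. }
  destruct Hm as (m & Hm & Emp & M1 & M2).
  exists (fun z => k z - snd p).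
  split; [| split].
  (* The inverse is [T o N]: [W] restores the base values and orders them as label and value of
     [lam], [N] finds the abscissa, and [T] returns to the plane. *)
  - set (W := fun w : R * R => (snd w + snd p, fst w + lam p)).
    assert (HW : vanalytic_at W (0, 0)).
    { split; (apply analytic_plus; [| apply analytic_const]); [apply analytic_snd | apply analytic_fst]. }
    assert (EW : W (0, 0) = (snd p, lam p)) by (unfold W; simpl; now rewrite !Rplus_0_l).
    set (N := fun w => (m (W w), fst (W w))).
    assert (HN : vanalytic_at N (0, 0)).
    { split; [apply (analytic_vcomp m W); [exact HW | now rewrite EW] | exact (proj1 HW)]. }
    assert (EN : N (0, 0) = p) by (unfold N; rewrite EW, Emp; now destruct p).
    split; [rewrite Ekp, !Rminus_diag; reflexivity |].
    split; [split; apply analytic_minus; auto; apply analytic_const |].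
    exists (fun w => T (N w)). split; [now rewrite EN |].
    split; [apply vanalytic_comp; [exact HN | now rewrite EN] |]. split.
    + assert (L : locally p (fun z => m (k z, lam (T (K z))) = fst z)).
      { apply (locally_vcomp (fun z => swap (K z)) p (fun z => m (fst z, lam (T (swap z))) = snd z)).
        - apply vanalytic_comp; [exact HK |]. split; [apply analytic_snd | apply analytic_fst].
        - now rewrite EKp. }
      generalize L TK. apply locally_imp2. intros x y E1 E2. rewrite E2 in E1.
      transitivity (T (K (x, y))); [apply f_equal | exact E2]. unfold N, W; simpl.
      replace (k (x, y) - snd p + snd p) with (k (x, y)) by ring.
      replace (lam (x, y) - lam p + lam p) with (lam (x, y)) by ring.
      rewrite E1; reflexivity.
    + assert (L1 : locally (0, 0) (fun w => lam (T (N w)) = snd (W w))).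
      { apply (locally_vcomp W (0, 0) (fun w => lam (T (m w, fst w)) = snd w)); [exact HW | now rewrite EW]. }
      assert (L2 : locally (0, 0) (fun w => k (T (N w)) = snd (N w))).
      { apply (locally_vcomp N (0, 0) (fun z => k (T z) = snd z)); [exact HN | rewrite EN; exact K2]. }
      generalize L1 L2. apply locally_imp2. intros x y E1 E2. rewrite E1, E2.
      unfold N, W; simpl. f_equal; ring.
  - generalize (filter_and _ _ Hvg (analytic_locally _ _ Hk)) Hek. apply locally_imp2.
    intros x y [Hv Hk'] H.
    destruct (Hv (fun z => k z - snd p)) as [-> _].
    destruct (partial_minus_const k (snd p) (x, y) Hk') as [-> ->]. rewrite H; ring.
  - intros delta Hd Hed.
    (* [delta] is constant on each curve, so it is read where the curve meets the vertical line
       through [p]. *)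
    exists (fun s => delta (fst p, s + snd p)). split.
    { apply (analytic_comp delta (fun _ => fst p) (fun z => snd z + snd p)).
      - simpl. rewrite Rplus_0_l. destruct p; exact Hd.
      - apply analytic_const.
      - apply analytic_plus; [apply analytic_snd | apply analytic_const]. }
    assert (HdT : locally p (fun z => partial_x (fun w => delta (T w)) z = 0)).
    { generalize (filter_and _ _ (PT _ Hvg) (PT _ Hed)) (Hchain delta Hd). apply locally_imp2.
      intros x y [Hv E1] ->. destruct (Hv delta) as [E2 Hnz]. rewrite E1 in E2.
      symmetry in E2; apply Rmult_integral in E2 as [E2|E2]; [contradiction | exact E2]. }
    apply zero_partial_x_constant in HdT;
      [| apply analytic_vcomp; [exact HT | now rewrite ETp]].
    assert (HdK : locally p (fun z => delta (T z) = delta (fst p, snd z))).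
    { generalize HdT Y0. apply locally_imp2. intros x y -> E. unfold T; simpl in *. now rewrite E. }
    generalize (PK _ HdK) TK. apply locally_imp2. intros x y E1 E2. rewrite E2 in E1.
    rewrite E1. unfold K; simpl. f_equal; f_equal; ring.
Qed.

(** [e lam = 1] forces [e p] to be non-zero; when its first component vanishes, exchanging the axes
    gives the transversal case. *)
Lemma rectify (e : R * R -> R * R) (lam : R * R -> R) (p : R * R) :
  vanalytic_at e p -> analytic_at lam p ->
  locally p (fun z => vderiv e lam z = 1) ->
  exists u, local_diffeo (fun z => (lam z - lam p, u z)) p (0, 0) /\
    locally p (fun z => vderiv e u z = 0) /\
    forall delta, analytic_at delta p -> locally p (fun z => vderiv e delta z = 0) ->
      exists D, analytic_at (fun z => D (snd z)) (0, 0) /\ locally p (fun z => delta z = D (u z)).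
Proof.
  intros He Hlam Hel.
  destruct (Req_dec (fst (e p)) 0) as [E0 | Hne]; [| now apply rectify_transversal].
  assert (Hss : forall z, swap (swap z) = z) by now intros [x y].
  assert (Hsw : forall q, vanalytic_at swap q) by (intros q; split; [apply analytic_snd | apply analytic_fst]).
  assert (Pull : forall P, locally p P -> locally (swap p) (fun z => P (swap z)))
    by (intros P HP; apply locally_vcomp; [apply Hsw | now rewrite Hss]).
  assert (Push : forall P, locally (swap p) P -> locally p (fun z => P (swap z)))
    by (intros P HP; apply locally_vcomp; [apply Hsw | exact HP]).
  assert (Hv : forall f z, vderiv (fun z => swap (e (swap z))) (fun z => f (swap z)) z = vderiv e f (swap z)).
  { intros f [x y]. unfold vderiv, partial_x, partial_y, swap; simpl. ring. }
  destruct (rectify_transversal (fun z => swap (e (swap z))) (fun z => lam (swap z)) (swap p))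
    as (u & Hu & Heu & HD).
  - apply vanalytic_comp; [apply (vanalytic_comp swap e); [apply Hsw | now rewrite Hss] | apply Hsw].
  - apply analytic_vcomp; [apply Hsw | now rewrite Hss].
  - generalize (Pull _ Hel). apply locally_imp; intros x y H. now rewrite Hv.
  - rewrite Hss. simpl. apply locally_at in Hel. unfold vderiv in Hel. intros E. rewrite E, E0 in Hel. lra.
  - rewrite Hss in Hu. exists (fun z => u (swap z)). split; [| split].
    + apply (local_diffeo_comp _ _ _ _ _ (swap_local_diffeo p)) in Hu.
      eapply eq_ind with (1 := Hu) (P := fun phi => local_diffeo phi p (0, 0)).
      apply functional_extensionality; intros z; simpl. now rewrite Hss.
    + generalize (Push _ Heu). apply locally_imp; intros x y H.
      rewrite <- H. unfold vderiv, partial_x, partial_y, swap; simpl. ring.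
    + intros delta Hd Hed.
      destruct (HD (fun z => delta (swap z))) as (D & HD1 & HD2).
      * apply analytic_vcomp; [apply Hsw | now rewrite Hss].
      * generalize (Pull _ Hed). apply locally_imp; intros x y H. now rewrite Hv.
      * exists D. split; [exact HD1 |].
        generalize (Push _ HD2). apply locally_imp; intros x y H. exact H.
Qed.

(** * Two-dimensional Nijenhuis operators with a unity *)

(** This function and the next are written as linear combinations so that [partial_lin] applies to
    them literally. *)
Definition half_trace (L : R * R -> mat2) (z : R * R) : R := / 2 * m11 (L z) + / 2 * m22 (L z).
Definition half_diff (L : R * R -> mat2) (z : R * R) : R := / 2 * m11 (L z) + - / 2 * m22 (L z).

(** [- det N] for the trace-free part [N] of [L], so that [N ^ 2 = discr L * Id]. *)
Definition discr (L : R * R -> mat2) (z : R * R) : R :=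
  half_diff L z * half_diff L z + m12 (L z) * m21 (L z).

Lemma partial_lin (c d : R) (f g : R * R -> R) (p : R * R) :
  analytic_at f p -> analytic_at g p ->
  partial_x (fun z => c * f z + d * g z) p = c * partial_x f p + d * partial_x g p /\
  partial_y (fun z => c * f z + d * g z) p = c * partial_y f p + d * partial_y g p.
Proof.
  intros Hf Hg.
  assert (Hs : forall a h, analytic_at h p -> analytic_at (fun z => a * h z) p /\
     partial_x (fun z => a * h z) p = a * partial_x h p /\ partial_y (fun z => a * h z) p = a * partial_y h p).
  { intros a h Hh. destruct (partial_mult (fun _ => a) h p (analytic_const a p) Hh) as [-> ->].
    destruct (partial_const a p) as [-> ->].
    split; [apply analytic_mult; [apply analytic_const | exact Hh] | split; ring]. }
  destruct (Hs c f Hf) as (F1 & F2 & F3). destruct (Hs d g Hg) as (G1 & G2 & G3).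
  destruct (partial_plus _ _ p F1 G1) as [-> ->]. rewrite F2, F3, G2, G3. split; reflexivity.
Qed.

(* In dimension two the torsion vanishes iff [N^T (d lam) = (1/2) d delta], where [lam] is half
   the trace, [N = L - lam] and [N^2 = delta]; taking trace and determinant in [Lie_e L = Id]
   gives [e lam = 1] and [e delta = 0]. *)
Lemma nijenhuis_invariants (U : R * R -> Prop) (L : R * R -> mat2) (e : R * R -> R * R) (z : R * R) :
  nijenhuis_with_unity U L e -> U z ->
  vderiv e (half_trace L) z = 1 /\ vderiv e (discr L) z = 0 /\
  half_diff L z * partial_x (half_trace L) z + m21 (L z) * partial_y (half_trace L) z
    = / 2 * partial_x (discr L) z /\
  m12 (L z) * partial_x (half_trace L) z - half_diff L z * partial_y (half_trace L) z
    = / 2 * partial_y (discr L) z.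
Proof.
  intros (HL & He & HN & HU) Hz.
  destruct (HL z Hz) as (HA & HB & HC & HE).
  assert (Hc : forall c d z, vanalytic_at (fun _ => (c, d)) z) by (intros; split; apply analytic_const).
  (* Both tensorial conditions are tested on the constant coordinate fields, whose own derivatives
     vanish. *)
  specialize (HN d_x (fun _ => (0, 1)) (fun z _ => Hc 1 0 z) (fun z _ => Hc 0 1 z) z Hz).
  assert (HU1 := HU d_x (fun z _ => Hc 1 0 z) z Hz).
  assert (HU2 := HU (fun _ => (0, 1)) (fun z _ => Hc 0 1 z) z Hz).
  clear HU.
  unfold nijenhuis_torsion, lie_derivative_op in *.
  assert (EX : oapp L d_x = fun z => (m11 (L z), m21 (L z))).
  { apply functional_extensionality; intros w; unfold oapp, mapp, d_x; simpl; f_equal; ring. }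
  assert (EY : oapp L (fun _ => (0, 1)) = fun z => (m12 (L z), m22 (L z))).
  { apply functional_extensionality; intros w; unfold oapp, mapp; simpl; f_equal; ring. }
  rewrite EX in *; rewrite EY in *. clear EX EY.
  assert (PD : forall c, partial_x (fun _ => c) z = 0 /\ partial_y (fun _ => c) z = 0)
    by (intros; apply partial_const).
  unfold oapp, mapp, lie_bracket, vderiv, minus, plus, opp in *; simpl in *.
  unfold minus, plus, opp in *; simpl in *.
  rewrite (proj1 (PD 0)), (proj1 (PD 1)), (proj2 (PD 0)), (proj2 (PD 1)) in *.
  injection HN as N1 N2. injection HU1 as U1 U2. injection HU2 as U3 U4.
  assert (Hal : analytic_at (half_diff L) z).
  { apply analytic_plus; apply analytic_mult; auto; apply analytic_const. }
  destruct (partial_lin (/ 2) (/ 2) _ _ z HA HE) as [T1 T2].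
  destruct (partial_lin (/ 2) (- / 2) _ _ z HA HE) as [D1 D2].
  destruct (partial_mult _ _ z Hal Hal) as [S1 S2].
  destruct (partial_mult _ _ z HB HC) as [S3 S4].
  destruct (partial_plus _ _ z (analytic_mult _ _ _ Hal Hal) (analytic_mult _ _ _ HB HC)) as [S5 S6].
  change (partial_x (half_trace L) z) with (partial_x (fun z => / 2 * m11 (L z) + / 2 * m22 (L z)) z).
  change (partial_y (half_trace L) z) with (partial_y (fun z => / 2 * m11 (L z) + / 2 * m22 (L z)) z).
  change (partial_x (discr L) z) with (partial_x (fun z => half_diff L z * half_diff L z + m12 (L z) * m21 (L z)) z).
  change (partial_y (discr L) z) with (partial_y (fun z => half_diff L z * half_diff L z + m12 (L z) * m21 (L z)) z).
  rewrite S5, S6, S1, S2, S3, S4, T1, T2.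
  change (partial_x (half_diff L) z) with (partial_x (fun z => / 2 * m11 (L z) + - / 2 * m22 (L z)) z).
  change (partial_y (half_diff L) z) with (partial_y (fun z => / 2 * m11 (L z) + - / 2 * m22 (L z)) z).
  rewrite D1, D2. unfold half_diff.
  unfold plus, opp in N1, N2, U1, U2, U3, U4; simpl in N1, N2, U1, U2, U3, U4.
  clear - N1 N2 U1 U2 U3 U4.
  set (a := m11 (L z)) in *. set (b := m12 (L z)) in *. set (c := m21 (L z)) in *. set (d := m22 (L z)) in *.
  set (ax := partial_x (fun w => m11 (L w)) z) in *. set (bx := partial_x (fun w => m12 (L w)) z) in *.
  set (cx := partial_x (fun w => m21 (L w)) z) in *. set (dx := partial_x (fun w => m22 (L w)) z) in *.
  set (ay := partial_y (fun w => m11 (L w)) z) in *. set (by_ := partial_y (fun w => m12 (L w)) z) in *.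
  set (cy := partial_y (fun w => m21 (L w)) z) in *. set (dy := partial_y (fun w => m22 (L w)) z) in *.
  set (e1 := fst (e z)) in *. set (e2 := snd (e z)) in *.
  split; [lra |]. split; [| split; lra].
  (* As [delta] is half the trace of [N^2], [e delta] is the trace of [N (Lie_e L)], the commutator
     terms dropping out under the trace. With [Lie_e L = Id] this is the trace of [N], which is
     zero. *)
  lazymatch type of (conj (conj U1 U2) (conj U3 U4)) with
  | (?X1 = _ /\ ?X2 = _) /\ (?X3 = _ /\ ?X4 = _) =>
      transitivity ((/ 2 * a + - / 2 * d) * (X1 - X4) + b * X2 + c * X3);
        [field | rewrite U1, U2, U3, U4; ring]
  end.
Qed.

(* Keeps unification from comparing power series expansions. *)
Local Opaque analytic_at.

(** * Normal forms from the action of [N] on differentials *)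

(** The last hypothesis says [N^T (d lam) = b d v] and [N^T (d v) = c d lam]. These are the two rows
    of the conjugation equation once the common term [lam] is cancelled, the target having equal
    diagonal entries [lam]. *)
Lemma pair_brought_to_intro (p : R * R) (L L' : R * R -> mat2) (e : R * R -> R * R) (v b c : R * R -> R) :
  local_diffeo (fun z => (half_trace L z - half_trace L p, v z)) p (0, 0) ->
  locally p (fun z => vderiv e (half_trace L) z = 1) ->
  locally p (fun z => vderiv e v z = 0) ->
  locally p (fun z =>
    L' (half_trace L z - half_trace L p, v z) = Mat2 (half_trace L z) (b z) (c z) (half_trace L z)) ->
  locally p (fun z =>
    half_diff L z * partial_x (half_trace L) z + m21 (L z) * partial_y (half_trace L) z = b z * partial_x v z /\
    m12 (L z) * partial_x (half_trace L) z - half_diff L z * partial_y (half_trace L) z = b z * partial_y v z /\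
    half_diff L z * partial_x v z + m21 (L z) * partial_y v z = c z * partial_x (half_trace L) z /\
    m12 (L z) * partial_x v z - half_diff L z * partial_y v z = c z * partial_y (half_trace L) z) ->
  pair_brought_to p L e L' d_x.
Proof.
  intros Hphi H1 H2 HL' Hrows.
  assert (HJ : locally p (fun z => jacobian (fun z => (half_trace L z - half_trace L p, v z)) z =
     Mat2 (partial_x (half_trace L) z) (partial_y (half_trace L) z) (partial_x v z) (partial_y v z))).
  { generalize (local_diffeo_jacobian _ _ _ Hphi). apply locally_imp. intros x y [[Ha _] _].
    assert (Hl : analytic_at (half_trace L) (x, y)).
    { apply analytic_ext with (fun z => (half_trace L z - half_trace L p) + half_trace L p);
        [intros; ring | apply analytic_plus; [exact Ha | apply analytic_const]]. }
    unfold jacobian; simpl.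
    destruct (partial_minus_const _ (half_trace L p) _ Hl) as [-> ->]. reflexivity. }
  eexists. split; [exact Hphi |]. split.
  - generalize (filter_and _ _ HJ HL') Hrows. apply locally_imp2.
    intros x y [EJ EL] (R1 & R2 & R3 & R4). rewrite EJ, EL. unfold mmul; simpl.
    assert (E1 : m11 (L (x, y)) = half_trace L (x, y) + half_diff L (x, y))
      by (unfold half_trace, half_diff; field).
    assert (E2 : m22 (L (x, y)) = half_trace L (x, y) - half_diff L (x, y))
      by (unfold half_trace, half_diff; field).
    rewrite E1, E2. f_equal; lra.
  - generalize (filter_and _ _ HJ H1) H2. apply locally_imp2.
    intros x y [EJ E1] E2. rewrite EJ. unfold mapp, vderiv, d_x in *; simpl.
    f_equal; [rewrite <- E1 | rewrite <- E2]; ring.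
Qed.

(** The second coordinate is constrained only by [e u = 0], hence is free up to a change
    [theta (u)]; this freedom is what normalises [D]. *)
Lemma reparametrize (e : R * R -> R * R) (lam u : R * R -> R) (theta : R -> R) (p : R * R) :
  local_diffeo (fun z => (lam z, u z)) p (0, 0) -> locally p (fun z => vderiv e u z = 0) ->
  analytic_at (fun z => theta (snd z)) (0, 0) -> theta 0 = 0 ->
  partial_y (fun z => theta (snd z)) (0, 0) <> 0 ->
  local_diffeo (fun z => (lam z, theta (u z))) p (0, 0) /\
  locally p (fun z => vderiv e (fun z => theta (u z)) z = 0).
Proof.
  intros Hphi Heu Hth H0 Hy. split.
  - exact (local_diffeo_comp _ (fun z => (fst z, theta (snd z))) _ _ _ Hphi
             (shear_local_diffeo (fun z => theta (snd z)) Hth H0 Hy)).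
  - destruct Hphi as (E & [_ Hu] & _). simpl in Hu.
    assert (Eu : u p = 0) by congruence.
    assert (L : locally p (fun z => analytic_at (fun z => theta (snd z)) (0, u z))).
    { apply (locally_comp (fun _ => 0) u p (analytic_at (fun z => theta (snd z))) (analytic_const 0 p) Hu).
      rewrite Eu. apply analytic_locally, Hth. }
    generalize (filter_and _ _ L (analytic_locally _ _ Hu)) Heu. apply locally_imp2.
    intros x y [Ht Hu'] Ee.
    destruct (partial_comp (fun z => theta (snd z)) (fun _ => 0) u (x, y) Ht (analytic_const 0 _) Hu') as [E1 E2].
    destruct (partial_const 0 (x, y)) as [C1 C2]. rewrite C1 in E1. rewrite C2 in E2. simpl in E1, E2.
    unfold vderiv in *. rewrite E1, E2.
    transitivity (partial_y (fun z => theta (snd z)) (0, u (x, y)) *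
      (fst (e (x, y)) * partial_x u (x, y) + snd (e (x, y)) * partial_y u (x, y)));
      [ring | rewrite Ee; ring].
Qed.

Lemma partial_y_snd_mult (g : R -> R) :
  analytic_at (fun z => g (snd z)) (0, 0) ->
  analytic_at (fun z => snd z * g (snd z)) (0, 0) /\
  partial_y (fun z => snd z * g (snd z)) (0, 0) = g 0.
Proof.
  intros Hg. split; [apply analytic_mult; [apply analytic_snd | exact Hg] |].
  destruct (partial_mult snd (fun z => g (snd z)) (0, 0) (analytic_snd _) Hg) as [_ ->].
  destruct (partial_snd (0, 0)) as [_ ->]. simpl; ring.
Qed.

Section Cases.

Variables (L : R * R -> mat2) (e : R * R -> R * R) (p : R * R).

Let lam := half_trace L.
Let alpha := half_diff L.
Let delta := discr L.

Hypothesis analytic_L : locally p (manalytic_at L).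
Hypothesis analytic_e : locally p (vanalytic_at e).
Hypothesis e_lam : locally p (fun z => vderiv e lam z = 1).
Hypothesis e_delta : locally p (fun z => vderiv e delta z = 0).
Hypothesis N_lam : locally p (fun z =>
  alpha z * partial_x lam z + m21 (L z) * partial_y lam z = / 2 * partial_x delta z /\
  m12 (L z) * partial_x lam z - alpha z * partial_y lam z = / 2 * partial_y delta z).

Lemma discr_differential : locally p (fun z =>
  alpha z * partial_x delta z + m21 (L z) * partial_y delta z = 2 * delta z * partial_x lam z /\
  m12 (L z) * partial_x delta z - alpha z * partial_y delta z = 2 * delta z * partial_y lam z).
Proof.
  generalize N_lam. apply locally_imp. intros x y [E1 E2].
  assert (E3 : delta (x, y) = alpha (x, y) * alpha (x, y) + m12 (L (x, y)) * m21 (L (x, y))) by reflexivity.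
  replace (partial_x delta (x, y)) with (2 * (/ 2 * partial_x delta (x, y))) by field.
  replace (partial_y delta (x, y)) with (2 * (/ 2 * partial_y delta (x, y))) by field.
  rewrite <- E1, <- E2, E3. split; ring.
Qed.

Lemma analytic_half_diff_discr : locally p (fun z => analytic_at alpha z /\ analytic_at delta z).
Proof.
  generalize analytic_L. apply locally_imp. intros x y (HA & HB & HC & HE).
  assert (Ha : analytic_at alpha (x, y))
    by (apply analytic_plus; apply analytic_mult; auto; apply analytic_const).
  split; [exact Ha |].
  apply analytic_plus; apply analytic_mult; auto.
Qed.

(** With [delta] constant, [N^T] kills [d lam]; being trace-free it is nilpotent and maps [d u] to a
    multiple [c d lam]. Evaluation on [e], where [e lam = 1], gives [c = d u (N e)], an analytic
    expression; [f] is [c] in the new coordinates. *)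
Lemma brought_to_form4 (u : R * R -> R) :
  local_diffeo (fun z => (lam z - lam p, u z)) p (0, 0) ->
  locally p (fun z => vderiv e u z = 0) ->
  locally p (fun z => delta z = delta p) ->
  exists f, analytic_at f (0, 0) /\ pair_brought_to p L e (normal_form4 (lam p) f) d_x.
Proof.
  intros Hphi Heu Hd.
  set (c := fun z => partial_x u z * (alpha z * fst (e z) + m12 (L z) * snd (e z)) +
                     partial_y u z * (m21 (L z) * fst (e z) - alpha z * snd (e z))).
  assert (Hc : analytic_at c p).
  { destruct (locally_at _ _ analytic_L) as (HA & HB & HC & HE).
    destruct (locally_at _ _ analytic_e) as [He1 He2].
    destruct (locally_at _ _ analytic_half_diff_discr) as [Ha _].
    destruct Hphi as (_ & [_ Hu] & _). simpl in Hu.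
    assert (Ux := proj1 (analytic_partial_x _ _ Hu)). assert (Uy := proj1 (analytic_partial_y _ _ Hu)).
    apply analytic_plus; apply analytic_mult; auto.
    - apply analytic_plus; apply analytic_mult; assumption.
    - apply analytic_minus; apply analytic_mult; assumption. }
  assert (Hpsi := Hphi). destruct Hpsi as (_ & _ & psi & Ep & Hpsi & Lp & _).
  exists (fun w => c (psi w)). split; [apply analytic_vcomp; [exact Hpsi | now rewrite Ep] |].
  apply pair_brought_to_intro with u (fun _ => 0) c; auto.
  - revert Lp. apply locally_imp. intros x y E. unfold normal_form4, madd; simpl.
    fold lam. rewrite E. f_equal; unfold lam; ring.
  - assert (Hd' : locally p (fun z => partial_x delta z = 0 /\ partial_y delta z = 0)).
    { generalize (locally_locally _ _ Hd). apply locally_imp. intros x y L'.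
      destruct (partial_ext_loc delta (fun _ => delta p) (x, y) L') as [-> ->].
      apply partial_const. }
    generalize (filter_and _ _ N_lam Hd') e_lam. apply locally_imp2.
    intros x y [[E1 E2] [D1 D2]] El. rewrite D1 in E1. rewrite D2 in E2.
    unfold vderiv in El. fold lam alpha. unfold c.
    set (z := (x, y)) in *.
    set (lx := partial_x lam z) in *. set (ly := partial_y lam z) in *.
    set (a := alpha z) in *. set (B := m12 (L z)) in *. set (C := m21 (L z)) in *.
    set (e1 := fst (e z)) in *. set (e2 := snd (e z)) in *.
    set (ux := partial_x u z). set (uy := partial_y u z).
    split; [lra | split; [lra | split]].
    + transitivity ((a * ux + C * uy) * (e1 * lx + e2 * ly)
        + ux * e2 * (B * lx - a * ly) - uy * e2 * (a * lx + C * ly)); [rewrite El, E1, E2; ring | ring].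
    + transitivity ((B * ux - a * uy) * (e1 * lx + e2 * ly)
        - ux * e1 * (B * lx - a * ly) + uy * e1 * (a * lx + C * ly)); [rewrite El, E1, E2; ring | ring].
Qed.

(** Here [d v = - d delta], so the formulas for [N^T (d lam)] and [N^T (d delta)] are already the
    two required rows. *)
Lemma brought_to_form2 (d : R) (v : R * R -> R) :
  local_diffeo (fun z => (lam z - lam p, v z)) p (0, 0) ->
  locally p (fun z => vderiv e v z = 0) ->
  locally p (fun z => delta z = - (v z + d)) ->
  pair_brought_to p L e (normal_form2 (lam p) d) d_x.
Proof.
  intros Hphi Hev Hd.
  apply pair_brought_to_intro with v (fun _ => - (1 / 2)) (fun z => 2 * (v z + d)); auto.
  - apply filter_forall. intros z. unfold normal_form2, madd; simpl. fold lam. f_equal; unfold lam; ring.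
  - assert (Hd' : locally p (fun z => partial_x v z = - partial_x delta z /\ partial_y v z = - partial_y delta z)).
    { generalize (filter_and _ _ (locally_locally _ _ Hd) (local_diffeo_jacobian _ _ _ Hphi)).
      apply filter_imp. intros z [L' [[_ Hv] _]]. simpl in Hv.
      destruct (partial_ext_loc delta (fun z => -1 * v z + (- d) * 1) z) as [E1 E2].
      { generalize L'; apply filter_imp; intros w ->; ring. }
      destruct (partial_lin (-1) (- d) v (fun _ => 1) z Hv (analytic_const _ _)) as [E3 E4].
      destruct (partial_const 1 z) as [C1 C2].
      rewrite C1 in E3. rewrite C2 in E4. rewrite E3 in E1. rewrite E4 in E2. split; lra. }
    generalize (filter_and _ _ N_lam discr_differential) (filter_and _ _ Hd Hd'). apply locally_imp2.
    intros x y [[E1 E2] [E3 E4]] [Ed [D1 D2]]. fold lam alpha. rewrite D1, D2.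
    rewrite Ed in E3, E4. repeat split; lra.
Qed.

(** [N^T (d lam)] is immediate from [d delta = - sg k v^(k-1) d v]. In
    [N^T (d delta) = 2 delta d lam] both sides carry [v^(k-1)], and cancelling it gives
    [N^T (d v) = (2 / k) v d lam] wherever [v] is non-zero. *)
Lemma brought_to_form3 (k : nat) (sg : R) (v : R * R -> R) :
  (1 <= k)%nat -> sg <> 0 ->
  local_diffeo (fun z => (lam z - lam p, v z)) p (0, 0) ->
  locally p (fun z => vderiv e v z = 0) ->
  locally p (fun z => delta z = - sg * v z ^ k) ->
  pair_brought_to p L e (normal_form3 (lam p) sg k) d_x.
Proof.
  intros Hk Hsg Hphi Hev Hd.
  assert (HkR : 0 < INR k) by (apply lt_0_INR; lia).
  assert (HJ := local_diffeo_jacobian _ _ _ Hphi). simpl in HJ.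
  apply pair_brought_to_intro with v (fun z => - sg * (INR k / 2) * v z ^ (k - 1)) (fun z => 2 / INR k * v z); auto.
  - apply filter_forall. intros z. unfold normal_form3, madd; simpl. fold lam. f_equal; unfold lam; ring.
  - assert (Hd' : locally p (fun z =>
      partial_x delta z = - sg * INR k * v z ^ (k - 1) * partial_x v z /\
      partial_y delta z = - sg * INR k * v z ^ (k - 1) * partial_y v z)).
    { generalize (filter_and _ _ (locally_locally _ _ Hd) HJ).
      apply filter_imp. intros z [L' [[_ Hv] _]]. simpl in Hv.
      destruct (partial_ext_loc delta (fun z => - sg * v z ^ k + 0 * 1) z) as [E1 E2].
      { generalize L'; apply filter_imp; intros w ->; ring. }
      destruct (partial_lin (- sg) 0 (fun z => v z ^ k) (fun _ => 1) z (analytic_pow _ _ _ Hv) (analytic_const _ _)) as [E3 E4].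
      destruct (partial_pow v k z Hv) as [P1 P2].
      rewrite P1 in E3. rewrite P2 in E4. rewrite E3 in E1. rewrite E4 in E2.
      replace (pred k) with (k - 1)%nat in * by lia. rewrite E1, E2. split; ring. }
    assert (Hrow : locally p (fun z => v z <> 0 ->
      alpha z * partial_x v z + m21 (L z) * partial_y v z = 2 / INR k * v z * partial_x lam z /\
      m12 (L z) * partial_x v z - alpha z * partial_y v z = 2 / INR k * v z * partial_y lam z)).
    { generalize (filter_and _ _ discr_differential Hd) Hd'. apply locally_imp2.
      intros x y [[E1 E2] Ed] [D1 D2] Hv.
      rewrite D1, D2, Ed in E1, E2.
      set (z := (x, y)) in *.
      assert (Hpow : v z ^ k = v z * v z ^ (k - 1))
        by (replace k with (S (k - 1)) at 1 by lia; reflexivity).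
      rewrite Hpow in E1, E2.
      assert (Hnz : - sg * INR k * v z ^ (k - 1) <> 0).
      { apply Rmult_integral_contrapositive_currified; [| now apply pow_nonzero].
        apply Rmult_integral_contrapositive_currified; lra. }
      split; apply (Rmult_eq_reg_l _ _ _) with (2 := Hnz).
      - transitivity (2 * (- sg * (v z * v z ^ (k - 1))) * partial_x lam z);
          [rewrite <- E1; ring | field; lra].
      - transitivity (2 * (- sg * (v z * v z ^ (k - 1))) * partial_y lam z);
          [rewrite <- E2; ring | field; lra]. }
    (* Where [v = 0] the rows follow by continuity, as [d v <> 0]. *)
    assert (Hrow' : locally p (fun z =>
      alpha z * partial_x v z + m21 (L z) * partial_y v z = 2 / INR k * v z * partial_x lam z /\
      m12 (L z) * partial_x v z - alpha z * partial_y v z = 2 / INR k * v z * partial_y lam z)).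
    { assert (Han : locally p (fun z => (analytic_at alpha z /\ manalytic_at L z) /\ vanalytic_at
         (fun z => (lam z - lam p, v z)) z /\ (partial_x v z <> 0 \/ partial_y v z <> 0))).
      { generalize (filter_and _ _ analytic_half_diff_discr analytic_L) HJ.
        apply locally_imp2. intros x y [[Ha _] HL] [Hv Hdet]. split; [split; assumption |]. split; [exact Hv |].
        destruct (Req_dec (partial_x v (x, y)) 0) as [E|E]; [| now left].
        right; intros E'. apply Hdet.
        change (partial_x (fun z => lam z - lam p) (x, y) * partial_y v (x, y) -
                partial_y (fun z => lam z - lam p) (x, y) * partial_x v (x, y) = 0).
        rewrite E, E'. ring. }
      generalize (locally_locally _ _ Hrow) Han. apply locally_imp2.
      intros x y HR [[Ha (HA & HB & HC & HE)] [[Hl Hv] Hdv]]. simpl in Hl, Hv. set (z := (x, y)) in *.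
      assert (Hlam : analytic_at lam z).
      { apply analytic_plus; apply analytic_mult; auto; apply analytic_const. }
      assert (Hzero : forall w, analytic_at w z -> locally z (fun q => v q <> 0 -> w q = 0) -> w z = 0).
      { intros w Hw Hloc. apply NNPP; intros Hwz.
        assert (Hv0 : locally z (fun q => v q = 0)).
        { generalize Hloc (analytic_nonzero_locally w z Hw Hwz). apply locally_imp2.
          intros x' y' H1 H2. apply NNPP; auto. }
        destruct (partial_ext_loc v (fun _ => 0) z Hv0) as [V1 V2].
        destruct (partial_const 0 z) as [C1 C2]. rewrite C1 in V1. rewrite C2 in V2.
        destruct Hdv; contradiction. }
      assert (Vx := proj1 (analytic_partial_x _ _ Hv)). assert (Vy := proj1 (analytic_partial_y _ _ Hv)).
      assert (Lx := proj1 (analytic_partial_x _ _ Hlam)). assert (Ly := proj1 (analytic_partial_y _ _ Hlam)).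
      split; apply Rminus_diag_uniq.
      - apply (Hzero (fun z => alpha z * partial_x v z + m21 (L z) * partial_y v z - 2 / INR k * v z * partial_x lam z)).
        + repeat first [apply analytic_minus | apply analytic_plus | apply analytic_mult | apply analytic_const | assumption].
        + revert HR; apply filter_imp. intros q H Hq. destruct (H Hq) as [-> _]; ring.
      - apply (Hzero (fun z => m12 (L z) * partial_x v z - alpha z * partial_y v z - 2 / INR k * v z * partial_y lam z)).
        + repeat first [apply analytic_minus | apply analytic_plus | apply analytic_mult | apply analytic_const | assumption].
        + revert HR; apply filter_imp. intros q H Hq. destruct (H Hq) as [_ ->]; ring. }
    generalize (filter_and _ _ N_lam Hd') Hrow'. apply locally_imp2.
    intros x y [[E1 E2] [D1 D2]] [R1 R2]. fold lam alpha.
    rewrite E1, E2, D1, D2. repeat split; [field | field | exact R1 | exact R2].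
Qed.

End Cases.

(** * The classification *)

Lemma classification (U : R * R -> Prop) (L : R * R -> mat2) (e : R * R -> R * R) (p : R * R) :
  open U -> U p -> nijenhuis_with_unity U L e ->
  (exists l0 d : R, pair_brought_to p L e (normal_form2 l0 d) d_x) \/
  (exists (l0 sg : R) (k : nat),
     (sg = 1 \/ sg = -1) /\ (1 <= k)%nat /\
     pair_brought_to p L e (normal_form3 l0 sg k) d_x) \/
  (exists (l0 : R) (f : R * R -> R),
     analytic_at f (0, 0) /\ pair_brought_to p L e (normal_form4 l0 f) d_x).
Proof.
  intros HU Up HL.
  assert (HUp : locally p U) by (apply HU, Up).
  assert (Hinv : locally p (fun z => vderiv e (half_trace L) z = 1 /\ vderiv e (discr L) z = 0 /\
    half_diff L z * partial_x (half_trace L) z + m21 (L z) * partial_y (half_trace L) z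
      = / 2 * partial_x (discr L) z /\
    m12 (L z) * partial_x (half_trace L) z - half_diff L z * partial_y (half_trace L) z
      = / 2 * partial_y (discr L) z))
    by (revert HUp; apply filter_imp; intros z; apply nijenhuis_invariants, HL).
  destruct HL as (HaL & Hae & _ & _).
  assert (AL : locally p (manalytic_at L)) by (revert HUp; apply filter_imp; exact HaL).
  assert (Ae : locally p (vanalytic_at e)) by (revert HUp; apply filter_imp; exact Hae).
  clear HaL Hae HUp HU Up U.
  assert (El : locally p (fun z => vderiv e (half_trace L) z = 1))
    by (revert Hinv; apply filter_imp; tauto).
  assert (Ed : locally p (fun z => vderiv e (discr L) z = 0))
    by (revert Hinv; apply filter_imp; tauto).
  assert (EN := Hinv). apply (filter_imp _ _ (fun z H => proj2 (proj2 H))) in EN. clear Hinv.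
  assert (Hlam : analytic_at (half_trace L) p).
  { destruct (locally_at _ _ AL) as (HA & _ & _ & HE).
    apply analytic_plus; apply analytic_mult; auto; apply analytic_const. }
  assert (Hdel := proj2 (locally_at _ _ (analytic_half_diff_discr L p AL))).
  destruct (rectify e (half_trace L) p (locally_at _ _ Ae) Hlam El) as (u & Hphi & Heu & HD).
  destruct (HD _ Hdel Ed) as (D & HDa & HDu). clear HD.
  assert (Hu : analytic_at u p /\ u p = 0) by (destruct Hphi as (E & [_ Hu] & _); split; [exact Hu | congruence]).
  destruct Hu as [Hu Eu].
  assert (Pull : forall P : R -> Prop, locally (0, 0) (fun z : R * R => P (snd z)) -> locally p (fun z => P (u z))).
  { intros P HP. apply (locally_comp (fun _ => 0) u p (fun z => P (snd z)) (analytic_const 0 p) Hu).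
    now rewrite Eu. }
  assert (ED0 : discr L p = D 0) by (rewrite (locally_at _ _ HDu), Eu; reflexivity).
  destruct (analytic_order D HDa) as [Hconst | (m & w & Hm & Hw & Hw0 & HDw)].
  - right; right. exists (half_trace L p).
    apply (brought_to_form4 L e p AL Ae El EN u Hphi Heu).
    generalize (Pull (fun t => D t = D 0) Hconst) HDu. apply locally_imp2. intros x y E1 E2. now rewrite E2, E1, ED0.
  - assert (HDw' : locally p (fun z => discr L z = D 0 + u z ^ m * w (u z))).
    { generalize (Pull (fun t => D t = D 0 + t ^ m * w t) HDw) HDu. apply locally_imp2. intros x y E1 E2. now rewrite E2. }
    destruct (Nat.eq_dec m 1) as [-> | Hm1].
    (* The new coordinate [- u * w (u)] equals [D 0 - delta], so [d = - D 0] makes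
       [delta = - (v + d)]. *)
    + left. exists (half_trace L p), (- D 0).
      destruct (partial_y_snd_mult (fun t => - w t)) as [Ht1 Ht2]; [apply analytic_opp; exact Hw |].
      destruct (reparametrize e (fun z => half_trace L z - half_trace L p) u (fun t => t * - w t) p Hphi Heu Ht1)
        as [Hphi' Hev]; [ring | rewrite Ht2; lra |].
      apply (brought_to_form2 L e p El EN _ _ Hphi' Hev).
      revert HDw'. apply locally_imp. intros x y ->. ring.
    + right; left.
      (* With [m] at least two [d delta] is zero at [p]; the differential identity for [delta],
         paired with [e], then leaves [2 * delta = 0]. *)
      assert (HD0 : D 0 = 0).
      { assert (Hwu : analytic_at (fun z => w (u z)) p).
        { apply (analytic_comp (fun z => w (snd z)) (fun _ => 0) u); [rewrite Eu; exact Hw | apply analytic_const | exact Hu]. }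
        destruct (partial_minus_const _ (D 0) p Hdel) as [F1 F2].
        destruct (partial_ext_loc (fun z => discr L z - D 0) (fun z => u z * (u z ^ (m - 1) * w (u z))) p) as [F3 F4].
        { revert HDw'. apply locally_imp. intros x y ->.
          replace m with (S (m - 1)) at 1 by lia. simpl; ring. }
        destruct (partial_mult u (fun z => u z ^ (m - 1) * w (u z)) p Hu
          (analytic_mult _ _ _ (analytic_pow _ _ _ Hu) Hwu)) as [F5 F6].
        rewrite Eu, pow_ne_zero in F5, F6 by lia.
        assert (F7 : partial_x (discr L) p = 0) by (rewrite <- F1, F3, F5; ring).
        assert (F8 : partial_y (discr L) p = 0) by (rewrite <- F2, F4, F6; ring).
        destruct (locally_at _ _ (discr_differential L p EN)) as [G1 G2].
        rewrite F7, F8 in G1, G2. rewrite <- ED0.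
        assert (G3 := locally_at _ _ El). unfold vderiv in G3.
        transitivity (discr L p * (fst (e p) * partial_x (half_trace L) p + snd (e p) * partial_y (half_trace L) p));
          [rewrite G3; ring |].
        transitivity (/ 2 * (fst (e p) * (2 * discr L p * partial_x (half_trace L) p)
                             + snd (e p) * (2 * discr L p * partial_y (half_trace L) p))); [field |].
        rewrite <- G1, <- G2. ring. }
      (* The sign makes [- sg * w 0] positive, so that a real [m]-th root [g] exists. Then
         [v = u * g] satisfies [v^m = - sg * delta], and [sg^2 = 1] gives [delta = - sg * v^m]. *)
      assert (Hsg : exists sg, (sg = 1 \/ sg = -1) /\ 0 < - sg * w 0).
      { destruct (Rlt_le_dec (w 0) 0); [exists 1 | exists (-1)]; split; auto; lra. }
      destruct Hsg as (sg & Hsg & Hpos).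
      assert (Hsw : analytic_at (fun z => - sg * w (snd z)) (0, 0))
        by (apply analytic_mult; [apply analytic_const | exact Hw]).
      destruct (analytic_root (fun z => - sg * w (snd z)) m (0, 0) Hm Hsw Hpos) as (g & Hg & Hg0 & Hgm).
      exists (half_trace L p), sg, m. split; [exact Hsg |]. split; [exact Hm |].
      destruct (partial_y_snd_mult (fun t => g (- sg * w t)) Hg) as [Ht1 Ht2].
      destruct (reparametrize e (fun z => half_trace L z - half_trace L p) u (fun t => t * g (- sg * w t)) p Hphi Heu Ht1)
        as [Hphi' Hev]; [ring | rewrite Ht2; exact Hg0 |].
      assert (Hsg0 : sg <> 0) by (destruct Hsg; lra).
      apply (brought_to_form3 L e p AL El EN m sg _ Hm Hsg0 Hphi' Hev).
      generalize HDw' (Pull (fun t => g (- sg * w t) ^ m = - sg * w t) Hgm). apply locally_imp2.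
      intros x y E1 E2. rewrite E1, HD0, Rpow_mult_distr, E2. destruct Hsg as [-> | ->]; ring.
Qed.

(** * Equivalence of operators of type 4 *)

(** Writing [phi = (X, h)], the first row of the conjugation says that [d X], which is non-zero, is
    an eigencovector for [l0 + X]. The only eigenvalue is [l0 + x], so [X = x], and the second row
    becomes the relation between [f] and [fb]. Conversely the shear by [h] works. *)
Lemma op_brought_to_form4_iff (l0 : R) (f fb : R * R -> R) :
  op_brought_to (0, 0) (normal_form4 l0 f) (normal_form4 l0 fb) <-> param_related f fb.
Proof.
  split.
  - intros (phi & Hphi & Hop).
    assert (HJ := local_diffeo_jacobian _ _ _ Hphi).
    destruct Hphi as (E0 & [_ Hh] & _).
    assert (H1 : locally (0, 0) (fun z => fst (phi z) = fst z)).
    { generalize HJ Hop. apply locally_imp2. intros x y [_ Hdet] E.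
      destruct (phi (x, y)) as [X Y'] eqn:Ep. simpl.
      unfold normal_form4, mmul, madd in E; simpl in *.
      injection E as E1 E2 E3 E4.
      set (a := partial_x (fun w => fst (phi w)) (x, y)) in *.
      set (b := partial_y (fun w => fst (phi w)) (x, y)) in *.
      apply Rminus_diag_uniq. destruct (Req_dec (X - x) 0) as [|Hne]; [assumption |].
      exfalso. apply Hdet.
      assert (Eb : b = 0) by (apply (Rmult_eq_reg_l (X - x)); [lra | exact Hne]).
      assert (Ea : a = 0) by (apply (Rmult_eq_reg_l (X - x)); [rewrite Eb in E1; lra | exact Hne]).
      rewrite Ea, Eb; ring. }
    assert (HJ1 : locally (0, 0) (fun z =>
       partial_x (fun w => fst (phi w)) z = 1 /\ partial_y (fun w => fst (phi w)) z = 0)).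
    { generalize (locally_locally _ _ H1). apply locally_imp. intros x y L.
      destruct (partial_ext_loc (fun w => fst (phi w)) fst (x, y) L) as [-> ->]. apply partial_fst. }
    exists (fun z => snd (phi z)). split; [exact Hh |]. split; [now rewrite E0 |]. split.
    + generalize (filter_and _ _ H1 HJ1) Hop. apply locally_imp2. intros x y [Ex [Ea Eb]] E.
      destruct (phi (x, y)) as [X Y'] eqn:Ep. simpl in *. subst X.
      unfold normal_form4, mmul, madd in E; simpl in E.
      injection E as E1 E2 E3 E4. rewrite Ea, Eb in *. lra.
    + destruct (locally_at _ _ HJ) as [_ Hdet]. destruct (locally_at _ _ HJ1) as [Ea Eb].
      simpl in Hdet. rewrite Ea, Eb in Hdet. intros E. apply Hdet. rewrite E; ring.
  - intros (h & Hh & H0 & Heq & Hy).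
    exists (fun z => (fst z, h z)). split; [apply shear_local_diffeo; assumption |].
    revert Heq. apply locally_imp. intros x y E. simpl in E.
    unfold jacobian, mmul, normal_form4, madd; simpl.
    destruct (partial_fst (x, y)) as [E1 E2].
    change (partial_x (fun w => fst w) (x, y)) with (partial_x fst (x, y)).
    change (partial_y (fun w => fst w) (x, y)) with (partial_y fst (x, y)).
    change (fun w => h w) with h.
    rewrite E1, E2, E. f_equal; ring.
Qed.

(** The second component of [(Lie_e L) d_x] for [e = d_x] is the [x]-derivative of [f]. A parameter
    compatible with the unity is therefore locally a function of [y] alone. *)
Lemma unity_form4_partial_x (l0 : R) (f : R * R -> R) :
  nijenhuis_with_unity_at (0, 0) (normal_form4 l0 f) d_x ->
  locally (0, 0) (fun z => partial_x f z = 0).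
Proof.
  intros (U & HU & U0 & _ & _ & _ & Hun).
  generalize (HU _ U0). apply locally_imp. intros x y Uz.
  assert (Hc : forall z, U z -> vanalytic_at d_x z) by (intros z _; split; [exact (analytic_const 1 z) | exact (analytic_const 0 z)]).
  specialize (Hun d_x Hc (x, y) Uz). apply (f_equal snd) in Hun.
  assert (EX : oapp (normal_form4 l0 f) d_x = fun z => (l0 + fst z, f z)).
  { apply functional_extensionality; intros [a b]. unfold oapp, mapp, d_x; simpl. f_equal; ring. }
  unfold lie_derivative_op in Hun. rewrite EX in Hun.
  unfold oapp, mapp, lie_bracket, vderiv, minus, plus, opp in Hun; simpl in Hun.
  unfold plus, opp in Hun; simpl in Hun.
  destruct (partial_const 0 (x, y)) as [C1 C2]. destruct (partial_const 1 (x, y)) as [C3 C4].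
  rewrite C1, C2, C3, C4 in Hun. change (partial_x f (x, y) = 0).
  change (partial_x (fun w => f w) (x, y)) with (partial_x f (x, y)) in Hun. lra.
Qed.

(** A map [(x, h)] preserves [d_x] only if [h] does not depend on [x], whereas [param_related]
    allows any [h]; independence of [f] and [fb] from [x] bridges the gap. *)
Lemma pair_brought_to_form4_iff (l0 : R) (f fb : R * R -> R) :
  analytic_at f (0, 0) -> analytic_at fb (0, 0) ->
  locally (0, 0) (fun z => partial_x f z = 0) -> locally (0, 0) (fun z => partial_x fb z = 0) ->
  pair_brought_to (0, 0) (normal_form4 l0 f) d_x (normal_form4 l0 fb) d_x <-> param_related f fb.
Proof.
  intros Hf Hfb Ff Ffb. split.
  - intros (phi & Hphi & Hop & _). apply (op_brought_to_form4_iff l0). exists phi; auto.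
  - intros (h & Hh & H0 & Heq & Hy).
    apply zero_partial_x_constant in Ff; [| exact Hf].
    apply zero_partial_x_constant in Ffb; [| exact Hfb]. simpl in Ff, Ffb.
    (* Along [x = 0] the relation only involves [y], so [h] may be replaced by [h (0, y)]. *)
    set (h0 := fun z : R * R => h (0, snd z)).
    assert (Hh0 : analytic_at h0 (0, 0)).
    { apply (analytic_comp h (fun _ => 0) snd); [exact Hh | apply analytic_const | apply analytic_snd]. }
    assert (Hproj : forall P, locally (0, 0) P -> locally (0, 0) (fun z : R * R => P (0, snd z))).
    { intros P HP. apply (locally_comp (fun _ => 0) snd (0, 0) P (analytic_const 0 _) (analytic_snd _) HP). }
    assert (Hfbh : locally (0, 0) (fun z => fb (fst z, h0 z) = fb (0, h0 z))).
    { apply (locally_comp fst h0 (0, 0) (fun z => fb z = fb (0, snd z)) (analytic_fst _) Hh0).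
      unfold h0; simpl; rewrite H0; exact Ffb. }
    exists (fun z => (fst z, h0 z)).
    split; [apply shear_local_diffeo; assumption |].
    assert (Hjac : forall x y, jacobian (fun z => (fst z, h0 z)) (x, y) = Mat2 1 0 0 (partial_y h (0, y))).
    { intros x y. unfold jacobian; simpl. destruct (partial_fst (x, y)) as [E1 E2].
      change (partial_x (fun w => fst w) (x, y)) with (partial_x fst (x, y)).
      change (partial_y (fun w => fst w) (x, y)) with (partial_y fst (x, y)).
      rewrite E1, E2. f_equal. exact (Derive_const (h (0, y)) x). }
    split.
    + generalize (filter_and _ _ (Hproj _ Heq) Ff) Hfbh. apply locally_imp2.
      intros x y [E1 E2] E3. rewrite Hjac. unfold mmul, normal_form4, madd; simpl in *.
      rewrite E3, E2. unfold h0; simpl. rewrite E1. f_equal; ring.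
    + unfold vf_pushed. apply filter_forall. intros [x y]. rewrite Hjac. unfold mapp, d_x; simpl. f_equal; ring.
Qed.

(** Equivalence of type 4 can be read for operators alone, with arbitrary analytic parameters, or
    for pairs having [d_x] as unity; both readings lead to the same relation between parameters. *)
Theorem theorem2p4 :
  (forall (U : R * R -> Prop) (L : R * R -> mat2) (e : R * R -> R * R) (p : R * R),
     open U -> U p -> nijenhuis_with_unity U L e ->
     (exists l0 : R, pair_brought_to p L e (normal_form1 l0) d_x) \/
     (exists l0 d : R, pair_brought_to p L e (normal_form2 l0 d) d_x) \/
     (exists (l0 sg : R) (k : nat),
        (sg = 1 \/ sg = -1) /\ (1 <= k)%nat /\
        pair_brought_to p L e (normal_form3 l0 sg k) d_x) \/
     (exists (l0 : R) (f : R * R -> R),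
        analytic_at f (0, 0) /\ pair_brought_to p L e (normal_form4 l0 f) d_x)) /\
  (forall (l0 : R) (f fb : R * R -> R),
     analytic_at f (0, 0) -> analytic_at fb (0, 0) ->
     (op_brought_to (0, 0) (normal_form4 l0 f) (normal_form4 l0 fb) <-> param_related f fb) /\
     (nijenhuis_with_unity_at (0, 0) (normal_form4 l0 f) d_x ->
      nijenhuis_with_unity_at (0, 0) (normal_form4 l0 fb) d_x ->
      (pair_brought_to (0, 0) (normal_form4 l0 f) d_x (normal_form4 l0 fb) d_x <-> param_related f fb))).
Proof.
  split.
  (* An operator of form 1 is obtained here as form 4 with [f = 0]. *)
  - intros U L e p HU Up HL. right. exact (classification U L e p HU Up HL).
  - intros l0 f fb Hf Hfb. split; [apply op_brought_to_form4_iff |].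
    intros H1 H2. apply pair_brought_to_form4_iff; auto;
      eapply unity_form4_partial_x; eassumption.
Qed.
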